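(* Let $\gamma\ge2$ be an integer, let $\sigma>0$, and let $W=(W(x))_{x\in\mathbb{R}_+}$ be a Brownian motion with $W(0)=0$ and $\mathrm{Var}(W(x))=\sigma^2x$. For $t>1$ let $\zeta_\gamma(t)$ be the functional of $W$ defined in the context. Then the distribution of $\zeta_\gamma(t)$ does not depend on $t$. Moreover, for each $t>1$, the random variable $\zeta_\gamma(t)-\frac{\gamma(\gamma-1)}{2}$ has density $f_\gamma$ given by $$f_\gamma(x)=\sum_{i=1}^{\gamma-1}\frac{(-1)^{\gamma-1-i}\,i^{\gamma-2}}{i!\,(\gamma-1-i)!}\,e^{-x/i}$$ for $x\ge0$ (and $f_\gamma(x)=0$ for $x<0$).
   Context: **$t$-stable points of $W$.** Let $t>1$. For $m\in\mathbb{R}_+$ let $r(t,m)$ be the smallest $x>m$ such that $W(x)\ge W(m)+\ln t$ (it exists almost surely), and let $l(t,m)$ be the largest $x<m$, $x\in\mathbb{R}_+$, such that $W(x)\ge W(m)+\ln t$, if such an $x$ exists. The first $t$-stable point to the right of the origin is the smallest $m^*\in\mathbb{R}_+$ such that $W(m^* )=\min_{x\in[0,r(t,m^* )]}W(x)$. A point $m\in\mathbb{R}_+$, $m\ne m^*$, is a $t$-stable point if $l(t,m)$ and $r(t,m)$ exist and $W(m)=\min_{x\in[l(t,m),r(t,m)]}W(x)$. The $t$-stable points are $m^*$ together with all such $m$. **The process $\zeta_\gamma$.** Let $\hat m_1(t)<\hat m_2(t)<\dots<\hat m_\gamma(t)$ be the first $\gamma$ $t$-stable points to the right of the origin and, for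 $1\le i\le\gamma-1$, let $\hat h_i(t)=\arg\max_{x\in(\hat m_i(t),\hat m_{i+1}(t))}W(x)$. Then, for $t>1$, $$\zeta_\gamma(t)=\sum_{i=1}^{\gamma-1}(\gamma-i)\,\frac{W(\hat h_i(t))-W(\hat m_i(t))}{\ln t}.$$ *)

(* Defs.v *)
From HB Require Import structures.
From mathcomp Require Import all_boot all_order all_algebra.
From mathcomp Require Import all_classical all_reals all_analysis.

Set Implicit Arguments.
Unset Strict Implicit.
Unset Printing Implicit Defensive.

Import Order.TTheory GRing.Theory Num.Theory.
Import numFieldNormedType.Exports.

Local Open Scope classical_set_scope.
Local Open Scope ring_scope.

Section Brownian.
Context (d : measure_display) (T : measurableType d) (R : realType).
Context (P : probability T R).

(* Taking some [B i := setT] gives the product rule for every subfamily. *)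
Definition mutually_independent (n : nat) (X : 'I_n -> T -> R) : Prop :=
  forall B : 'I_n -> set R, (forall i, measurable (B i)) ->
    P (\bigcap_(i in [set: 'I_n]) (X i @^-1` B i)) =
    (\prod_(i < n) P (X i @^-1` B i))%E.

Definition independent_increments (W : R -> {RV P >-> R}) : Prop :=
  forall (n : nat) (s : nat -> R),
    0 <= s 0%N -> (forall i, (i < n)%N -> s i < s i.+1) ->
    @mutually_independent n (fun i om => W (s i.+1) om - W (s i) om).

(* [normal_prob] takes the standard deviation, and is a Dirac mass for no
   parameter, whence the strict [x < y]. *)
Definition gaussian_increments (sigma : R) (W : R -> {RV P >-> R}) : Prop :=
  forall x y : R, 0 <= x -> x < y -> forall B : set R, measurable B ->
    P ((fun om => W y om - W x om) @^-1` B) =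
    normal_prob 0 (sigma * Num.sqrt (y - x)) B.

(* The time set is R_+: the variables [W x] with [x < 0] are unconstrained, and
   none of the definitions below looks at them. *)
Definition brownian_motion (sigma : R) (W : R -> {RV P >-> R}) : Prop :=
  [/\ {ae P, forall om, W 0 om = 0},
      independent_increments W,
      gaussian_increments sigma W &
      {ae P, forall om, {within `[0, +oo[, continuous (fun x => W x om)}}].

Definition has_density (X : T -> R) (f : R -> R) : Prop :=
  [/\ measurable_fun setT f, forall x, 0 <= f x &
      forall B : set R, measurable B ->
        P (X @^-1` B) = (\int[lebesgue_measure]_(x in B) (f x)%:E)%E].

End Brownian.

Section Stable.
Context (R : realType).
Implicit Types (w : R -> R) (t m x l r : R) (A : set R).

Definition smallest A : set R := A `&` lbound A.
Definition largest A : set R := A `&` ubound A.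

(* [is_r w t m] and [is_l w t m] have at most one element: r(t,m), l(t,m). *)
Definition is_r w t m : set R :=
  smallest [set x | m < x /\ w m + ln t <= w x].

Definition is_l w t m : set R :=
  largest [set x | [/\ 0 <= x, x < m & w m + ln t <= w x]].

Definition first_stable w t : set R :=
  smallest [set m | 0 <= m /\
    exists2 r, is_r w t m r & smallest (w @` `[0, r]) (w m)].

Definition stable w t : set R :=
  [set m | first_stable w t m \/
    [/\ 0 <= m, ~ first_stable w t m &
        exists l r, [/\ is_l w t m l, is_r w t m r &
                        smallest (w @` `[l, r]) (w m)]]].

(* [m 1 < ... < m g] are the first [g] [t]-stable points of [w]; the values of
   [m] outside [1, g] are irrelevant. *)
Definition first_stable_points w t (g : nat) (m : nat -> R) : Prop :=
  [/\ forall i, (1 <= i < g)%N -> m i < m i.+1,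
      forall i, (1 <= i <= g)%N -> stable w t (m i) &
      forall x, stable w t x -> x <= m g ->
        exists2 i, (1 <= i <= g)%N & x = m i].

Definition is_argmax w (a b h : R) : Prop :=
  a < h < b /\ forall x, a < x < b -> w x <= w h.

(* The path functional zeta_g(t), as the graph of a partial function: see
   [is_zeta_unique]. *)
Definition is_zeta (g : nat) t w (z : R) : Prop :=
  exists m h : nat -> R,
    [/\ first_stable_points w t g m,
        forall i, (1 <= i < g)%N -> is_argmax w (m i) (m i.+1) (h i) &
        z = \sum_(1 <= i < g) (g - i)%:R * ((w (h i) - w (m i)) / ln t)].

Definition f_density (g : nat) (x : R) : R :=
  if x < 0 then 0
  else \sum_(1 <= i < g)
         ((-1) ^+ (g - 1 - i) * i%:R ^+ (g - 2)) / (i`! * (g - 1 - i)`!)%:R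
         * expR (- (x / i%:R)).

Lemma first_stable_points_lt w t g (m : nat -> R) (i j : nat) :
  first_stable_points w t g m -> (1 <= i)%N -> (i < j <= g)%N -> m i < m j.
Proof.
move=> [mS _ _] i1; elim: j => [|j IH]; first by rewrite ltn0.
move=> /andP[]; rewrite ltnS leq_eqVlt => /orP[/eqP <-|ij] jg.
  by apply: mS; rewrite i1.
apply: (lt_trans (IH _)); first by rewrite ij ltnW.
by apply: mS; rewrite (leq_trans i1 (ltnW ij)).
Qed.

(* The [i]-th point of one enumeration occurs in the other one at an index
   [>= i], by strong induction on [i]. *)
Lemma first_stable_points_le w t g (m m' : nat -> R) (i : nat) :
  first_stable_points w t g m -> first_stable_points w t g m' ->
  m g <= m' g -> (1 <= i <= g)%N -> m i = m' i.
Proof.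
move=> H H' gg; have [_ mst mex] := H; have [_ mst' mex'] := H'.
have le_g k n : first_stable_points w t g n -> (1 <= k <= g)%N -> n k <= n g.
  move=> Hn /andP[k1]; rewrite leq_eqVlt => /orP[/eqP -> //|kg].
  by apply/ltW/(first_stable_points_lt Hn) => //; rewrite kg leqnn.
elim/ltn_ind: i => i IH ig; have /andP[i1 ig'] := ig.
have [j /andP[j1 jg] mij] :
    exists2 j, (1 <= j <= g)%N & m i = m' j.
  by apply: mex' => //; [exact: mst | exact: (le_trans (le_g _ _ H ig))].
case: (ltngtP i j) => [ij|ji|ij]; last by rewrite mij ij.
  2: {
    have := first_stable_points_lt H j1; move/(_ i); rewrite ji ig' => /(_ isT).
    by rewrite (IH j ji) ?j1 ?jg // mij ltxx. }
have lt' : m' i < m i.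
  by rewrite mij; apply: (first_stable_points_lt H' i1); rewrite ij jg.
have [k /andP[k1 kg] mik] :
    exists2 k, (1 <= k <= g)%N & m' i = m k.
  by apply: mex; [exact: mst' | exact: (le_trans (ltW lt') (le_g _ _ H ig))].
have ki : (k < i)%N.
  rewrite ltnNge leq_eqVlt; apply/negP => /orP[/eqP ik|ik].
    by move: lt'; rewrite mik ik ltxx.
  have := first_stable_points_lt H i1; move/(_ k); rewrite ik kg => /(_ isT).
  by rewrite -mik => /(lt_trans lt'); rewrite ltxx.
have := IH k ki; rewrite k1 kg => /(_ isT) mk.
have := first_stable_points_lt H' k1; move/(_ i); rewrite ki ig' => /(_ isT).
by rewrite mik mk ltxx.
Qed.

Lemma is_zeta_unique g t w z z' : is_zeta g t w z -> is_zeta g t w z' -> z = z'.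
Proof.
move=> [m [h [Hm Hh ->]]] [m' [h' [Hm' Hh' ->]]].
have mm' i : (1 <= i <= g)%N -> m i = m' i.
  case: (leP (m g) (m' g)) => [|/ltW] gg ig.
    exact: (first_stable_points_le Hm Hm').
  exact/esym/(first_stable_points_le Hm' Hm).
apply: eq_big_nat => i ig; have /andP[i1 i2] := ig.
have [hI hmax] := Hh i ig; have [hI' hmax'] := Hh' i ig.
have E1 : m i = m' i by apply: mm'; rewrite i1 ltnW.
have E2 : m i.+1 = m' i.+1 by apply: mm'.
move: hI hmax; rewrite E1 E2 => hI hmax.
by have -> : w (h i) = w (h' i) by apply/le_anti; rewrite hmax' // hmax.
Qed.

End Stable.

(* Main.v *)
(* Let h = ln t, let n = gamma - 1, and let E_1, ..., E_n be independent exponential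
   variables of mean 1.  Between two consecutive stable points W rises by h above its
   running minimum and then stays in a rising phase until it has fallen by h below its
   running maximum M.  The functions u_r(z) = E (a - z - (E_1 + 2 E_2 + ... + r E_r))_+
   satisfy u_r - r u_r' = u_(r-1).  Hence, if z is the weighted excess accumulated so
   far and r the weight of the current rising phase, the Azema-Yor process
   u_r(z) - (r / h) u_r'(z) (M - W) is a martingale, and it equals u_(r-1)(z) when
   M - W reaches h, that is, at the beginning of the next phase.  So the final excess
   Z = zeta - gamma (gamma - 1) / 2 satisfies E (a - Z)_+ = u_n(0) for all a, which
   determines its law.

   No strong Markov property is needed: W is sampled along k / 2^N, and an automaton
   tracks the phases of the sampled path.  The discrete stochastic integral has mean 0
   because the increments are independent and centered, and the discretization error is
   at most a telescoping sum times the largest increment.  When N tends to infinity, the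
   excess computed by the automaton converges to that of W, because almost surely no two
   local extrema of W over disjoint intervals differ by exactly h (so that W crosses each
   level h strictly right after reaching it), and no two local minima coincide. *)
From HB Require Import structures.
Require Import Defs.
From mathcomp Require Import all_boot all_order all_algebra.
From mathcomp Require Import all_classical all_reals all_analysis.
From mathcomp Require Import measurable_realfun.
From mathcomp Require Import ring lra zify.
Import Order.TTheory GRing.Theory Num.Theory.
Import numFieldNormedType.Exports.
Local Open Scope classical_set_scope.
Local Open Scope ring_scope.
Set Implicit Arguments.
Unset Strict Implicit.
Unset Printing Implicit Defensive.


(** * The law of E_1 + 2 E_2 + ... + n E_n *)

(** The factor [r / h] in the Azema-Yor process is the rate at which [z] grows with the running
    maximum [M]. As [M] increases only while [M = W], the variation [(r / h) u' dM] of [u (z)]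
    cancels against that of the second term, and only [(r / h) u' dW] remains. On a grid this is
    true up to overshoots, committed over a number of steps that tends to infinity; a bounded
    nonincreasing potential of the automaton pays for all of them, so that their sum has the order
    of a single increment. The test functions [(a - z)_+] suit the problem because [z >= 0]: all
    arguments stay below [a], the process is bounded uniformly in the mesh, and the limit is an
    instance of dominated convergence instead of optional stopping. Horizon [N] and mesh [2^-N] are
    tied together, so that one limit both refines the grid and lets the automaton reach its final
    state. *)

Lemma alternating_binomial_pow (R : comRingType) (n k : nat) : (k < n)%N ->
  \sum_(i < n.+1) (-1) ^+ i * 'C(n, i)%:R * i%:R ^+ k = 0 :> R.
Proof.
elim: n k => [//|n IH] [|k] kn.
  transitivity ((1 - 1 : R) ^+ n.+1); last by rewrite subrr expr0n.
  by rewrite exprBn; apply: eq_bigr => i _; rewrite !expr1n !mulr1 mulr_natr.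
rewrite big_ord_recl /= expr0n /= mulr0 add0r.
(* The sum is a finite difference of order larger than the degree of [i^k]. Absorption,
   [i C(n+1, i) = (n+1) C(n, i-1)], removes one factor [i], and expanding [(1 + i)^k] leaves
   differences of order [n] of powers [l <= k < n]. *)
have E (i : 'I_n.+1) : (-1) ^+ bump 0 i * 'C(n.+1, bump 0 i)%:R * (bump 0 i)%:R ^+ k.+1 =
   - n.+1%:R * \sum_(l < k.+1) 'C(k, l)%:R * ((-1) ^+ i * 'C(n, i)%:R * i%:R ^+ l) :> R.
  rewrite /bump leq0n add1n !exprS.
  have -> : -1 * (-1) ^+ i * 'C(n.+1, i.+1)%:R * (i.+1%:R * i.+1%:R ^+ k) =
     - ((-1) ^+ i * (i.+1 * 'C(n.+1, i.+1))%:R * i.+1%:R ^+ k) :> R by rewrite natrM; ring.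
  rewrite -mul_bin_diag /= natrM.
  rewrite (_ : i.+1%:R = 1 + i%:R :> R) ;last by rewrite nat1r.
  rewrite exprDn -mulrN1 -[RHS]opprK -mulNr opprK -[LHS]opprK; congr (- _).
  rewrite mulrN1 opprK !mulr_sumr; apply: eq_bigr => l _.
  by rewrite expr1n mul1r -mulr_natr; ring.
under eq_bigr do rewrite E.
rewrite -mulr_sumr exchange_big /= big1 ?mulr0 // => l _.
by rewrite -mulr_sumr IH ?mulr0 //; move: (ltn_ord l) kn; lia.
Qed.

Section Hypoexponential.
Context (R : realType).
Implicit Types (n i : nat) (x y a : R).

(* [hypo_pdf n] is the density on [R_+] of [E_1 + 2 E_2 + ... + n E_n], where the
   [E_i] are independent exponential variables of mean 1. *)
Definition hypo_coef n i : R :=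
  ((-1) ^+ (n - i) * i%:R ^+ (n - 1)) / (i`! * (n - i)`!)%:R.

Definition hypo_pdf n x : R :=
  \sum_(1 <= i < n.+1) hypo_coef n i * expR (- (x / i%:R)).

Definition hypo_cdf n x : R :=
  \sum_(1 <= i < n.+1) hypo_coef n i * (i%:R * (1 - expR (- (x / i%:R)))).

Definition hypo_icdf n x : R :=
  \sum_(1 <= i < n.+1)
    hypo_coef n i * (i%:R * (x - i%:R * (1 - expR (- (x / i%:R))))).

(** Comparison of the coefficients of [e^(-x/i)] in [(n+1) f_(n+1)' + f_(n+1) = f_n], the equation
    for adding an independent exponential variable of mean [n+1]. *)
Lemma hypo_coef_rec n i : (0 < n)%N -> (i <= n)%N ->
  (n.+1%:R - i%:R) * hypo_coef n.+1 i = - (i%:R * hypo_coef n i).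
Proof.
move=> n0 ilen; rewrite /hypo_coef subSn // exprS subSS subn0 factS.
have -> : i%:R ^+ n = i%:R * i%:R ^+ (n - 1) :> R.
  by rewrite -exprS; congr (_ ^+ _); lia.
rewrite !natrM.
have -> : n.+1%:R - i%:R = (n - i).+1%:R :> R by rewrite -natrB ?subSn //; lia.
have i1 : i`!%:R != 0 :> R by rewrite pnatr_eq0 -lt0n fact_gt0.
have i2 : (n - i)`!%:R != 0 :> R by rewrite pnatr_eq0 -lt0n fact_gt0.
have i3 : (n - i).+1%:R != 0 :> R by rewrite pnatr_eq0.
by field; rewrite i1 i2 nat1r i3.
Qed.

(** This is [f_n(0) = 0]. Up to the factor [(-1)^n / n!] the sum is the [n]-th difference of
    [i^(n-1)], whose term [i = 0] vanishes because [n > 1]. *)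
Lemma sum_hypo_coef n : (1 < n)%N -> \sum_(1 <= i < n.+1) hypo_coef n i = 0.
Proof.
move=> n1; have := @alternating_binomial_pow R n (n - 1).
rewrite subn1 ltn_predL (ltnW n1) => /(_ isT) H.
move: H; rewrite -(big_mkord xpredT (fun i : nat => (-1) ^+ i * 'C(n, i)%:R * i%:R ^+ n.-1)).
rewrite big_ltn // expr0n.
have -> : (n.-1 == 0)%N = false by move: n1; case: n => [|[]].
rewrite mulr0 add0r => /(congr1 (fun z => (-1) ^+ n / n`!%:R * z)).
rewrite /= mulr0 mulr_sumr => E; rewrite -[RHS]E; apply: eq_big_nat => i /andP[i1 i2].
rewrite /hypo_coef subn1 -signr_odd oddB; last by lia.
rewrite signr_addb !signr_odd.
have := bin_fact (ltnSE i2) => <-; rewrite !natrM.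
have h1 : i`!%:R != 0 :> R by rewrite pnatr_eq0 -lt0n fact_gt0.
have h2 : (n - i)`!%:R != 0 :> R by rewrite pnatr_eq0 -lt0n fact_gt0.
have h3 : 'C(n, i)%:R != 0 :> R by rewrite pnatr_eq0 -lt0n bin_gt0; lia.
by field; rewrite h1 h2 h3.
Qed.


Lemma is_derive_expN (c x : R) :
  is_derive x 1 (fun x => expR (- (x / c))) (- c^-1 * expR (- (x / c))).
Proof.
have := @is_derive1_comp R expR (fun x => - (x / c)) x _ _ (is_derive_expR _).
move=> /(_ (- c^-1)); rewrite /= => H.
have /H : is_derive x 1 (fun x : R => - (x / c)) (- c^-1).
  have -> : (fun x : R => - (x / c)) = - c^-1 \*: (@id R).
    by apply/funext => y; rewrite [RHS]mulNr mulrC.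
  by apply: is_derive_eq; rewrite /GRing.scale /= mulr1.
by rewrite mulrC.
Qed.

Lemma is_derive_expNM (c x : R) : c != 0 ->
  is_derive x 1 (fun x => c * (1 - expR (- (x / c)))) (expR (- (x / c))).
Proof.
move=> c0.
have D := is_deriveB (is_derive_cst (1 : R) x 1) (is_derive_expN c x).
have DZ := is_deriveZ c D.
by apply: (is_derive_eq DZ); rewrite /GRing.scale /=; field.
Qed.

Lemma is_derive_sum_nat (m k : nat) (f df : nat -> R -> R) (x : R) :
  (forall i, (m <= i < k)%N -> is_derive x 1 (f i) (df i x)) ->
  is_derive x 1 (fun x => \sum_(m <= i < k) f i x) (\sum_(m <= i < k) df i x).
Proof.
have geq j : (j <= m)%N -> is_derive x 1 (fun x => \sum_(m <= i < j) f i x)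
    (\sum_(m <= i < j) df i x).
  move=> jm; under eq_fun do rewrite big_geq //.
  by rewrite big_geq //; exact: is_derive_cst.
elim: k => [|k IH] fd; first exact: geq.
have [mk|km] := leqP m k; last exact: geq.
under eq_fun do rewrite big_nat_recr //=.
rewrite big_nat_recr //=.
apply: is_deriveD; last by apply: fd; rewrite ltnSE //= leqnn.
by apply: IH => // i /andP[mi ik]; apply: fd; rewrite mi ltnW.
Qed.

Lemma is_derive_hypo_pdf n x :
  is_derive x 1 (hypo_pdf n)
    (\sum_(1 <= i < n.+1) hypo_coef n i * (- i%:R^-1 * expR (- (x / i%:R)))).
Proof.
apply: (@is_derive_sum_nat 1 n.+1 (fun i x => hypo_coef n i * expR (- (x / i%:R)))
  (fun i x => hypo_coef n i * (- i%:R^-1 * expR (- (x / i%:R))))) => i _.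
exact: (@is_deriveZ _ _ _ (fun x => expR (- (x / i%:R))) (hypo_coef n i) x 1 _
  (is_derive_expN _ _)).
Qed.

Lemma is_derive_hypo_cdf n x : is_derive x 1 (hypo_cdf n) (hypo_pdf n x).
Proof.
apply: (@is_derive_sum_nat 1 n.+1 (fun i x => hypo_coef n i * (i%:R * (1 - expR (- (x / i%:R)))))
  (fun i x => hypo_coef n i * expR (- (x / i%:R)))) => i /andP[i1 _].
apply: (@is_deriveZ _ _ _ (fun x => (i%:R * (1 - expR (- (x / i%:R))))) (hypo_coef n i) x 1).
have i0 : i%:R != 0 :> R by rewrite pnatr_eq0 -lt0n.
exact: is_derive_expNM.
Qed.

Lemma is_derive_hypo_icdf n x : is_derive x 1 (hypo_icdf n) (hypo_cdf n x).
Proof.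
apply: (@is_derive_sum_nat 1 n.+1
  (fun i x => hypo_coef n i * (i%:R * (x - i%:R * (1 - expR (- (x / i%:R))))))
  (fun i x => hypo_coef n i * (i%:R * (1 - expR (- (x / i%:R)))))) => i /andP[i1 _].
apply: (@is_deriveZ _ _ _ (fun x => (i%:R * (x - i%:R * (1 - expR (- (x / i%:R))))))
  (hypo_coef n i) x 1).
apply: (@is_deriveZ _ _ _ (fun x => ((x - i%:R * (1 - expR (- (x / i%:R)))))) (i%:R) x 1).
have i0 : i%:R != 0 :> R by rewrite pnatr_eq0 -lt0n.
exact: (is_deriveB (is_derive_id x 1) (is_derive_expNM x i0)).
Qed.

Lemma is_derive_within (f df : R -> R) a b : (forall x, is_derive x 1 f (df x)) ->
  {within `[a, b], continuous f}.
Proof.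
move=> fd; apply: continuous_subspaceT => x.
by apply/differentiable_continuous/derivable1_diffP; case: (fd x).
Qed.

(** The recursion on coefficients, summed against an arbitrary [phi] so that it serves for the
    differential equation, for the total mass ([phi = 1]) and for the recursion on [hypo_icdf]. *)
Lemma hypo_coef_sum_rec n (phi : nat -> R) : (0 < n)%N ->
  n.+1%:R * (\sum_(1 <= i < n.+2) hypo_coef n.+1 i * phi i) =
  \sum_(1 <= i < n.+2) hypo_coef n.+1 i * (i%:R * phi i)
  - \sum_(1 <= i < n.+1) hypo_coef n i * (i%:R * phi i).
Proof.
move=> n0; rewrite mulr_sumr. rewrite big_nat_recr //=. rewrite [X in _ = X - _]big_nat_recr //=.
rewrite [RHS]addrAC; congr (_ + _); last by ring.
rewrite -sumrB; apply: eq_big_nat => i /andP[i1 i2].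
apply/eqP; rewrite -subr_eq0; apply/eqP.
transitivity (((n.+1%:R - i%:R) * hypo_coef n.+1 i + i%:R * hypo_coef n i) * phi i).
  by ring.
by rewrite (hypo_coef_rec n0 (ltnSE i2)) addNr mul0r.
Qed.

Lemma hypo_coef11 : hypo_coef 1 1 = 1.
Proof. by rewrite /hypo_coef subnn expr0 expr1n mulr1 invr1 mulr1. Qed.

(* By the recursion, [f_n = hypo_pdf n] satisfies [n f_n' + f_n = f_(n-1)], so that
   [e^(x/n) f_n x] is nondecreasing as soon as [f_(n-1) >= 0]. *)
Lemma hypo_pdf_ge0 n x : (0 < n)%N -> 0 <= x -> 0 <= hypo_pdf n x.
Proof.
case: n => // n _; elim: n x => [|n IH] x x0.
  by rewrite /hypo_pdf big_nat1 hypo_coef11 mul1r expR_ge0.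
set dp := fun x => \sum_(1 <= i < n.+3) hypo_coef n.+2 i * (- i%:R^-1 * expR (- (x / i%:R))).
have ode y : n.+2%:R * dp y = hypo_pdf n.+1 y - hypo_pdf n.+2 y.
  have E m k : \sum_(1 <= i < k) hypo_coef m i * (i%:R * (- i%:R^-1 * expR (- (y / i%:R)))) =
      - \sum_(1 <= i < k) hypo_coef m i * expR (- (y / i%:R)).
    rewrite -sumrN; apply: eq_big_nat => i /andP[i1 _].
    have i0 : i%:R != 0 :> R by rewrite pnatr_eq0 -lt0n.
    by field.
  by rewrite /dp hypo_coef_sum_rec // !E opprK addrC.
pose g y := expR (y / n.+2%:R) * hypo_pdf n.+2 y.
pose dg y := expR (y / n.+2%:R) / n.+2%:R * hypo_pdf n.+1 y.
have gd y : is_derive y 1 g (dg y).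
  have D1 := is_derive_expN (- n.+2%:R) y.
  have D2 := is_deriveM D1 (is_derive_hypo_pdf n.+2 y).
  have -> : g = ((fun x => expR (- (x / - n.+2%:R))) * hypo_pdf n.+2).
    apply/funext => z; transitivity (expR (- (z / - n.+2%:R)) * hypo_pdf n.+2 z) => //.
    by rewrite /g invrN mulrN opprK.
  apply: (is_derive_eq D2); rewrite /GRing.scale /= -/(dp y) /dg invrN mulrN !opprK.
  have := ode y => E.
  have -> : hypo_pdf n.+1 y = n.+2%:R * dp y + hypo_pdf n.+2 y by rewrite E subrK.
  have : n.+2%:R != 0 :> R by rewrite pnatr_eq0.
  by move: (n.+2%:R) => N N0; field.
have g0 : g 0 = 0.
  rewrite /g /hypo_pdf; under eq_bigr do rewrite mul0r oppr0 expR0 mulr1.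
  by rewrite sum_hypo_coef // mulr0.
have [c c0] := MVT_segment x0 (fun x _ => gd x) (is_derive_within gd).
rewrite g0 !subr0 => E.
suff : 0 <= g x by rewrite /g pmulr_rge0 // expR_gt0.
rewrite E mulr_ge0 // mulr_ge0 ?divr_ge0 ?expR_ge0 ?ler0n // IH //.
by move: c0; rewrite in_itv /= => /andP[].
Qed.

Lemma hypo_cdf0 n : hypo_cdf n 0 = 0.
Proof.
rewrite /hypo_cdf big1 // => i _.
by rewrite mul0r oppr0 expR0 subrr !mulr0.
Qed.

Lemma hypo_icdf0 n : hypo_icdf n 0 = 0.
Proof.
rewrite /hypo_icdf big1 // => i _.
by rewrite mul0r oppr0 expR0 !(subrr, mulr0).
Qed.

Lemma hypo_cdf_ndecr n x y : (0 < n)%N -> 0 <= x -> x <= y ->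
  hypo_cdf n x <= hypo_cdf n y.
Proof.
move=> n0 x0 xy; have fd z := is_derive_hypo_cdf n z.
have [c] := MVT_segment xy (fun x _ => fd x) (is_derive_within fd).
rewrite in_itv /= => /andP[xc _] E; rewrite -subr_ge0 E.
apply: mulr_ge0; last by rewrite subr_ge0.
by apply: hypo_pdf_ge0 => //; exact: le_trans xc.
Qed.

Lemma hypo_icdf_bounds n x y : (0 < n)%N -> 0 <= x -> x <= y ->
  hypo_cdf n x * (y - x) <= hypo_icdf n y - hypo_icdf n x <= hypo_cdf n y * (y - x).
Proof.
move=> n0 x0 xy; have fd z := is_derive_hypo_icdf n z.
have [c] := MVT_segment xy (fun x _ => fd x) (is_derive_within fd).
rewrite in_itv /= => /andP[xc cy] ->.
by apply/andP; split; rewrite ler_wpM2r ?subr_ge0 // hypo_cdf_ndecr // (le_trans _ xc).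
Qed.

Lemma hypo_icdf_rec n x : (0 < n)%N ->
  hypo_icdf n.+1 x + n.+1%:R * hypo_cdf n.+1 x = hypo_icdf n x.
Proof.
(* With [phi = 1] the left side is zero, so [hypo_pdf n.+1] and [hypo_pdf n] have the same total
   mass; this matches the terms linear in [x]. *)
move=> n0; have := @hypo_coef_sum_rec n (fun=> 1) n0.
under eq_bigr do rewrite mulr1.
rewrite sum_hypo_coef // mulr0.
under eq_bigr do rewrite mulr1.
under [X in _ - X]eq_bigr do rewrite mulr1.
move=> /esym/eqP; rewrite subr_eq0 => /eqP tot.
rewrite /hypo_cdf hypo_coef_sum_rec // addrA -big_split /=.
have -> : hypo_icdf n x = (\sum_(1 <= i < n.+1) hypo_coef n i * i%:R) * x
   - \sum_(1 <= i < n.+1) hypo_coef n i * (i%:R * (i%:R * (1 - expR (- (x / i%:R))))).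
  by rewrite mulr_suml -sumrB; apply: eq_bigr => i _; ring.
by congr (_ - _); rewrite -tot mulr_suml; apply: eq_bigr => i _; ring.
Qed.

(* If [Z] has this law then [pcdf n x = P (Z <= x)] (for [n > 0]; [pcdf 0] is the
   junk value [0]) and [picdf n x = E (x - Z)_+]. *)
Definition pcdf n x : R := hypo_cdf n (Num.max 0 x).

Definition picdf n x : R :=
  if n is 0%N then Num.max 0 x else hypo_icdf n (Num.max 0 x).

(** With [u_r (z) = picdf r (a - z)], so [u_r' = - pcdf r (a - z)], this makes the value continuous
    at the end of a rising phase. It includes the last phase, since [picdf 0] is the positive
    part. *)
Lemma picdf_rec n x : picdf n.+1 x + n.+1%:R * pcdf n.+1 x = picdf n x.
Proof.
case: n => [|n]; last exact: hypo_icdf_rec.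
rewrite /picdf /pcdf /hypo_icdf /hypo_cdf !big_nat1 hypo_coef11 invr1.
by rewrite !mul1r addrNK.
Qed.

Lemma pcdf_ge0 n x : 0 <= pcdf n.+1 x.
Proof. by rewrite -(hypo_cdf0 n.+1) hypo_cdf_ndecr // le_max lexx. Qed.

Lemma pcdf_ndecr n x y : x <= y -> pcdf n.+1 x <= pcdf n.+1 y.
Proof.
move=> xy; apply: hypo_cdf_ndecr => //; first by rewrite le_max lexx.
by rewrite ge_max !le_max lexx xy orbT.
Qed.

(** Convexity of [picdf], whose derivative [pcdf] is nondecreasing. Left of 0 both functions vanish,
    which reduces the mixed case to the interval from 0 to [y]. *)
Lemma picdf_bounds n x y : x <= y ->
  pcdf n.+1 x * (y - x) <= picdf n.+1 y - picdf n.+1 x <= pcdf n.+1 y * (y - x).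
Proof.
move=> xy; rewrite /picdf /pcdf.
have [x0|x0] := leP 0 x.
  by rewrite (max_r (le_trans x0 xy)); apply: hypo_icdf_bounds.
rewrite hypo_cdf0 hypo_icdf0 mul0r subr0.
have [y0|y0] := leP 0 y; last first.
  by rewrite hypo_cdf0 hypo_icdf0 mul0r lexx.
have := @hypo_icdf_bounds n.+1 0 y isT (lexx _) y0.
rewrite hypo_cdf0 hypo_icdf0 mul0r !subr0 => /andP[-> h] /=.
apply: (le_trans h); rewrite ler_wpM2l //; last by rewrite lerDl oppr_ge0 ltW.
by rewrite -(hypo_cdf0 n.+1) hypo_cdf_ndecr.
Qed.

Lemma picdf_ndecr n x y : x <= y -> picdf n x <= picdf n y.
Proof.
case: n => [|n] xy; first by rewrite /= ge_max !le_max lexx xy orbT.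
rewrite -subr_ge0; have /andP[h _] := @picdf_bounds n x y xy.
by apply: le_trans h; rewrite mulr_ge0 ?subr_ge0 ?pcdf_ge0.
Qed.

Lemma picdf_ge0 n x : 0 <= picdf n x.
Proof.
have : picdf n (Num.min 0 x) <= picdf n x by apply: picdf_ndecr; rewrite ge_min lexx orbT.
suff -> : picdf n (Num.min 0 x) = 0 by [].
have m0 : Num.max 0 (Num.min 0 x) = 0 by apply/max_idPl; rewrite ge_min lexx.
by case: n => [|n]; rewrite /picdf m0 // hypo_icdf0.
Qed.

End Hypoexponential.

Arguments picdf : simpl never.


(** * An automaton following the alternation of minima and maxima *)

Section Machine.
Context (R : realType) (h : R).
Implicit Types (s : nat * R * R) (a e z x : R) (p : nat) (w : nat -> R).

(* State [(p, e, z)]: for [p = 2 r > 0], [e] is the running minimum and the path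
   waits for a rise of [h] above it; for [p = 2 r - 1], [e] is the running maximum
   and the path waits for a fall of [h] below it; [p = 0] is final.  A maximum
   reached in phase [2 r - 1] contributes [r / h] times its height above the
   preceding minimum, minus [h], to [z]. *)
Definition step s x : nat * R * R :=
  let: (p, e, z) := s in
  if p == 0%N then s else
  if odd p then
    if x <= e - h then (p.-1, x, z)
    else (p, Num.max e x, z + (uphalf p)%:R / h * (Num.max e x - e))
  else
    if e + h <= x then (p.-1, x, z + (uphalf p)%:R / h * (x - e - h))
    else (p, Num.min e x, z).

Fixpoint run (n : nat) w (k : nat) : nat * R * R :=
  if k is k'.+1 then step (run n w k') (w k) else (n.*2, w 0%N, 0).

Definition valid n s x : Prop :=
  [/\ (s.1.1 <= n.*2)%N, 0 <= s.2, odd s.1.1 -> s.1.2 - h < x <= s.1.2 &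
      ~~ odd s.1.1 -> s.1.1 != 0%N -> x < s.1.2 + h].

(* The Azema-Yor martingale [u (z) - r / h * u' (z) * (e - x)], with
   [u (z) = picdf r (a - z)] the expected value of the final [(a - z)_+]. *)
Definition value a s x : R :=
  picdf (uphalf s.1.1) (a - s.2) +
  (if odd s.1.1 then
     (uphalf s.1.1)%:R / h * pcdf (uphalf s.1.1) (a - s.2) * (s.1.2 - x)
   else 0).

(** The derivative of [value] in [x], that is, the integrand of the discrete stochastic integral. *)
Definition slope a s : R :=
  if odd s.1.1 then - ((uphalf s.1.1)%:R / h * pcdf (uphalf s.1.1) (a - s.2)) else 0.

(* Decreases at each phase change, and with [u'] along each rising phase: it absorbs
   the errors made by replacing [value] by its linearization. *)
Definition potential C a s : R :=
  2 * C * s.1.1%:R + (if odd s.1.1 then pcdf (uphalf s.1.1) (a - s.2) else 0).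

Hypothesis h_gt0 : 0 < h.

Lemma valid_step n s x y : valid n s x -> valid n (step s y) y.
Proof.
case: s => [[p e] z] [/= pn z0 hu hd].
have [p0|p0] := eqVneq p 0%N; first by subst p; split.
have c0 : 0 <= (uphalf p)%:R / h by rewrite divr_ge0 // ltW.
have pp : (p.-1 <= n.*2)%N by rewrite (leq_trans (leq_pred _)).
case: ifPn => [po|pe].
  case: leP => [ye|ey]; split => //=.
  - by case: p p0 po {hu hd pn c0 pp} => //= p _ /negbTE ->.
  - by rewrite ltrDl.
  - by rewrite addr_ge0 // mulr_ge0 // subr_ge0 le_max lexx.
  - by move=> _; rewrite ltrBlDr gt_max le_max lexx orbT -ltrBlDr ey ltrDl h_gt0.
  - by rewrite po.
case: leP => [ye|ey]; split => //=.
- by rewrite addr_ge0 // mulr_ge0 // -addrA -opprD subr_ge0.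
- by rewrite lexx gtrBl h_gt0.
- by rewrite ltrDl h_gt0.
- by rewrite (negPf pe).
- by move=> _ _; rewrite -ltrBlDr lt_min !ltrBlDr ey ltrDl h_gt0.
Qed.

Lemma valid_run n w k : valid n (run n w k) (w k).
Proof.
elim: k => [|k IH]; last exact: valid_step IH.
by split => //=; rewrite ?odd_double // ltrDl.
Qed.

Section Bounds.
Context (n : nat) (a C B : R).
Hypothesis pcdf_le : forall r y, (r < n)%N -> y <= a -> pcdf r.+1 y <= C.
Hypothesis picdf_le : forall r y, (r <= n)%N -> y <= a -> picdf r y <= B.

Let uphalf_le p : (p <= n.*2)%N -> (uphalf p <= n)%N. Proof. lia. Qed.

Let weight p : (p <= n.*2)%N -> 0 <= (uphalf p)%:R / h <= n%:R / h.
Proof.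
move=> pn; rewrite divr_ge0 ?ler0n ?(ltW h_gt0) //=.
by rewrite ler_wpM2r ?invr_ge0 ?(ltW h_gt0) // ler_nat uphalf_le.
Qed.

Let odd_uphalf p : odd p -> uphalf p = (uphalf p).-1.+1.
Proof. by case: p. Qed.

(** Since [z >= 0], the arguments [a - z] are at most [a]; and [e - x <= h] during a rising phase
    cancels the factor [1 / h]. *)
Lemma value_bound s x : valid n s x -> 0 <= C -> 0 <= value a s x <= B + n%:R * C.
Proof.
case: s => [[p e] z] [/= pn z0 hu hd] C0; rewrite /value /=.
have az : a - z <= a by rewrite gerBl.
have h1 := picdf_le (uphalf_le pn) az.
case: ifPn => [po|_]; last first.
  by rewrite addr0 picdf_ge0 /= (le_trans h1) // lerDl mulr_ge0.
have [r rE] : exists r, uphalf p = r.+1 by exists (uphalf p).-1; exact: odd_uphalf.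
have rn : (r < n)%N by rewrite -rE uphalf_le.
have /andP[ex xe] := hu po.
have /andP[w1 w2] := weight pn.
have v1 := pcdf_le rn az; rewrite -rE in v1.
have v0 : 0 <= pcdf (uphalf p) (a - z) by rewrite rE pcdf_ge0.
rewrite addr_ge0 ?picdf_ge0 //=; last by apply: mulr_ge0; [exact: mulr_ge0|rewrite subr_ge0].
rewrite lerD //.
have -> : n%:R * C = n%:R / h * C * h.
  by rewrite mulrAC mulfVK ?gt_eqF.
apply: ler_pM; [exact: mulr_ge0|by rewrite subr_ge0|exact: ler_pM|lra].
Qed.

Lemma slope_bound s x : valid n s x -> 0 <= C -> `|slope a s| <= n%:R / h * C.
Proof.
case: s => [[p e] z] [/= pn z0 hu hd] C0; rewrite /slope /=.
have az : a - z <= a by rewrite gerBl.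
have /andP[w1 w2] := weight pn.
case: ifPn => [po|_]; last first.
  by rewrite normr0 mulr_ge0 // (le_trans w1).
have [r rE] : exists r, uphalf p = r.+1 by exists (uphalf p).-1; exact: odd_uphalf.
have rn : (r < n)%N by rewrite -rE uphalf_le.
have v1 := pcdf_le rn az; rewrite -rE in v1.
have v0 : 0 <= pcdf (uphalf p) (a - z) by rewrite rE pcdf_ge0.
by rewrite normrN ger0_norm; [exact: ler_pM|exact: mulr_ge0].
Qed.

(** A step is exactly linear except in three cases: an overshoot below [e - h] ending a rising
    phase, a new maximum, where [picdf] is replaced by its tangent, and an overshoot above [e + h]
    starting a rising phase. In each of them the error is at most the weight times [|y - x|] times
    the drop of the potential. *)
Lemma value_step s x y : valid n s x ->
  0 <= potential C a s - potential C a (step s y) /\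
  `|value a (step s y) y - value a s x - slope a s * (y - x)| <=
  n%:R / h * `|y - x| * (potential C a s - potential C a (step s y)).
Proof.
case: s => [[p e] z] [/= pn z0 hu hd].
have [p0|p0] := eqVneq p 0%N.
  rewrite p0 /value /slope /potential /= mul0r !subrr mulr0 normr0.
  by split.
have [r rE] : exists r, uphalf p = r.+1.
  by exists (uphalf p).-1; case: p p0 {pn hu hd}.
have rn : (r < n)%N by rewrite -rE uphalf_le.
have /andP[w1 w2] := weight pn.
have az : a - z <= a by rewrite gerBl.
have v1 := pcdf_le rn az.
have v0 := pcdf_ge0 r (a - z).
have C0 := le_trans v0 v1.
have key A D : 0 <= A <= r.+1%:R / h * `|y - x| * D -> 0 <= D ->
    A <= n%:R / h * `|y - x| * D.
  move=> /andP[A0 AD] D0; apply: (le_trans AD); rewrite ler_wpM2r //.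
  by rewrite ler_wpM2r // -rE.
rewrite rE in w1.
have pE : p%:R = p.-1%:R + 1 :> R by rewrite natr1 prednK // lt0n.
case: ifPn => [po|pe].
  have pe1 : odd p.-1 = false by move: p0 po; clear; lia.
  have p1E : uphalf p.-1 = r by move: po rE; clear; lia.
  have /andP[ex xe] := hu po.
  case: (leP y (e - h)) => [ye|ey].
    rewrite /potential /value /slope /= po rE pe1 p1E pE !addr0.
    have D : 2 * C * (p.-1%:R + 1) + pcdf r.+1 (a - z) - 2 * C * p.-1%:R =
       2 * C + pcdf r.+1 (a - z) by ring.
    rewrite D; split; first by lra.
    apply: key; last by lra.
    (* By [picdf_rec] the two values would match exactly at [y = e - h]; what remains is the
       overshoot [e - h - y], less than [x - y] because [x > e - h]. *)
    rewrite normr_ge0 /= -picdf_rec.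
    set v := pcdf _ _; set u := picdf _ _.
    have -> : u + r.+1%:R * v - (u + r.+1%:R / h * v * (e - x)) - - (r.+1%:R / h * v) * (y - x)
       = - (r.+1%:R / h * v * (e - h - y)).
      by field; rewrite gt_eqF.
    rewrite normrN ger0_norm; last by apply: mulr_ge0; [exact: mulr_ge0|rewrite subr_ge0].
    rewrite -!mulrA [leRHS]mulrA [leLHS]mulrA ler_wpM2l // mulrC ler_pM ?subr_ge0 //.
      by rewrite distrC ler_normr; apply/orP; left; lra.
    by rewrite /v; lra.
  rewrite /potential /value /slope /= po rE.
  set M := Num.max e y.
  have eM : e <= M by rewrite le_max lexx.
  set z' := z + _.
  have zz' : z <= z' by rewrite lerDl mulr_ge0 // subr_ge0.
  have aza : a - z' <= a - z by rewrite lerB.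
  have vv := pcdf_ndecr r aza.
  have D : 2 * C * p%:R + pcdf r.+1 (a - z) - (2 * C * p%:R + pcdf r.+1 (a - z')) =
     pcdf r.+1 (a - z) - pcdf r.+1 (a - z') by ring.
  rewrite D; split; first by lra.
  apply: key; last by lra.
  rewrite normr_ge0 /=.
  (* At a new maximum the tangent error lies between 0 and [(v - v')] times the increase of [z], and
     [v - v'] is precisely the drop of the potential. *)
  have /andP[b1 b2] := picdf_bounds r aza.
  have zz : a - z - (a - z') = r.+1%:R / h * (M - e) by rewrite /z'; ring.
  rewrite zz in b1 b2.
  set v := pcdf r.+1 (a - z) in b2 D vv *; set v' := pcdf _ (a - z') in b1 D vv *.
  set u := picdf r.+1 (a - z) in b1 b2 *; set u' := picdf _ (a - z') in b1 b2 *.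
  have [ye|ye] := leP y e.
    have ME : M = e by apply/max_idPl.
    have zz'E : z' = z by rewrite /z' ME subrr mulr0 addr0.
    have -> : u' = u by rewrite /u' zz'E.
    have -> : v' = v by rewrite /v' zz'E.
    rewrite ME.
    have -> : (u + r.+1%:R / h * v * (e - y) -
          (u + r.+1%:R / h * v * (e - x)) - - (r.+1%:R / h * v) * (y - x)) = 0 by ring.
    by rewrite normr0 subrr mulr0.
  have ME : M = y by apply/max_idPr/ltW.
  rewrite ME in b1 b2 *; rewrite subrr mulr0 addr0.
  have -> : (u' - (u + r.+1%:R / h * v * (e - x)) - - (r.+1%:R / h * v) * (y - x)) =
     u' - u + v * (r.+1%:R / h * (y - e)) by ring.
  rewrite ger0_norm; last by lra.
  apply: (@le_trans _ _ ((v - v') * (r.+1%:R / h * (y - e)))); first by lra.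
  rewrite mulrC ler_wpM2r ?subr_ge0 // ler_wpM2l //.
  by rewrite ler_normr; apply/orP; left; lra.
have xe := hd pe p0.
have po1 : odd p.-1 by move: p0 pe; clear; lia.
have p1E : uphalf p.-1 = r.+1 by move: pe rE; clear; lia.
case: (leP (e + h) y) => [ye|ey]; last first.
  rewrite /potential /value /slope /= (negPf pe) !subrr mul0r subrr normr0 mulr0.
  by split.
rewrite /potential /value /slope /= po1 (negPf pe) p1E rE pE subrr mulr0 !addr0 mul0r subr0.
set z' := z + _.
have zz' : z <= z' by rewrite lerDl mulr_ge0 //; lra.
have aza : a - z' <= a - z by rewrite lerB.
have v1' : pcdf r.+1 (a - z') <= C by apply: le_trans v1; exact: pcdf_ndecr.
(* The factor 2 in [potential] is used here: entering a rising phase adds a [pcdf] term of at most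
   [C], so that a drop of at least [C] is left. *)
have D : 2 * C * (p.-1%:R + 1) - (2 * C * p.-1%:R + pcdf r.+1 (a - z')) =
   2 * C - pcdf r.+1 (a - z') by ring.
rewrite D; split; first by lra.
apply: key; last by lra.
have /andP[b1 b2] := picdf_bounds r aza.
have zz : a - z - (a - z') = r.+1%:R / h * (y - e - h) by rewrite /z'; ring.
rewrite normr_ge0 /= distrC ger0_norm; last by rewrite subr_ge0 picdf_ndecr.
apply: (le_trans b2); rewrite zz mulrC ler_pM //.
- by rewrite mulr_ge0 //; lra.
- rewrite ler_wpM2l //.
  by rewrite ler_normr; apply/orP; left; lra.
- by lra.
Qed.

Lemma potential_ge0 s x : valid n s x -> 0 <= C -> 0 <= potential C a s.
Proof.
case: s => [[p e] z] [/= pn z0 hu hd] C0; rewrite /potential /=.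
rewrite addr_ge0 ?mulr_ge0 //; case: ifPn => // po.
by rewrite (odd_uphalf po) pcdf_ge0.
Qed.

Lemma value_run_telescope w N M : (forall k, (k < N)%N -> `|w k.+1 - w k| <= M) ->
  `|value a (run n w N) (w N) - picdf n a
     - \sum_(k < N) slope a (run n w k) * (w k.+1 - w k)| <=
  n%:R / h * M * (potential C a (run n w 0) - potential C a (run n w N)).
Proof.
elim: N => [|N IH] wM.
  rewrite big_ord0 subrr mulr0 /value /= odd_double addr0 !subr0.
  by rewrite uphalf_double subrr normr0.
have {}IH := IH (fun k kN => wM k (ltnW kN)).
have [d0 st] := @value_step (run n w N) (w N) (w N.+1) (valid_run n w N).
rewrite big_ord_recr /=.
have {}st := le_trans st (ler_wpM2r d0 (ler_wpM2l
  (divr_ge0 (ler0n _ n) (ltW h_gt0)) (wM N (ltnSn N)))).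
set S := \sum_(k < N) _ in IH *; set s := slope _ _ * _ in st *.
set Y := value _ (step _ _) _ in st *; set Y0 := value _ _ _ in IH st *.
have -> : Y - picdf n a - (S + s) = (Y0 - picdf n a - S) + (Y - Y0 - s) by ring.
apply: (le_trans (ler_normD _ _)); apply: (le_trans (lerD IH st)).
by rewrite -mulrDr addrA subrK.
Qed.

(** The largest increment is replaced by something easy to integrate: either [|x| <= eps] or
    [|x| <= x^4 / eps^3]. Fourth powers are needed because the squares of Brownian increments over
    [[0, N]] have a total mean of order [N], which does not vanish with the mesh. *)
Lemma value_run_error w N eps : 0 <= C -> 0 < eps ->
  `|value a (run n w N) (w N) - picdf n a
     - \sum_(k < N) slope a (run n w k) * (w k.+1 - w k)| <=
  n%:R / h * (2 * C * n.*2%:R) *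
    (eps + (\sum_(k < N) (w k.+1 - w k) ^+ 4) / eps ^+ 3).
Proof.
move=> C0 e0; set M := eps + _.
have q0 (i : nat) : 0 <= (w i.+1 - w i) ^+ 4 by rewrite exprn_even_ge0.
have M0 : 0 <= M.
  by rewrite addr_ge0 ?(ltW e0) // divr_ge0 ?exprn_ge0 ?(ltW e0) // sumr_ge0.
have wM k : (k < N)%N -> `|w k.+1 - w k| <= M.
  move=> kN; have : (w k.+1 - w k) ^+ 4 <= \sum_(i < N) (w i.+1 - w i) ^+ 4.
    by rewrite (bigD1 (Ordinal kN)) //= lerDl sumr_ge0.
  rewrite /M; move: (\sum_(i < N) _) => S; move: (w k.+1 - w k) => x xS.
  have [xe|ex] := leP `|x| eps.
    rewrite (le_trans xe) // lerDl divr_ge0 ?exprn_ge0 ?(ltW e0) // (le_trans _ xS) //.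
    by rewrite exprn_even_ge0.
  apply: (@le_trans _ _ (x ^+ 4 / eps ^+ 3)); last first.
    by rewrite ler_wpDl ?(ltW e0) // ler_wpM2r // invr_ge0 exprn_ge0 // ltW.
  rewrite ler_pdivlMr ?exprn_gt0 // -[x ^+ 4]ger0_norm ?exprn_even_ge0 // normrX.
  by rewrite [leRHS]exprS ler_wpM2l // lerXn2r ?nnegrE // ltW.
apply: (le_trans (value_run_telescope wM)).
rewrite [leRHS]mulrAC ler_wpM2l //.
  by rewrite mulr_ge0 // divr_ge0 // ltW.
apply: (@le_trans _ _ (potential C a (run n w 0))).
  by rewrite gerBl (potential_ge0 (valid_run n w N)).
by rewrite /potential /= odd_double addr0.
Qed.

End Bounds.

End Machine.


(** * First rises of a continuous path *)

Section Path.
Context (R : realType) (h : R).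
Implicit Types (w : R -> R) (x y z s m tau u : R) (n k p : nat).

Definition path_continuous w : Prop := {within `[0, +oo[, continuous w}.

Lemma path_continuousN w : path_continuous w -> path_continuous (fun x => - w x).
Proof. by move=> cw x; apply: continuousN; exact: cw. Qed.

Lemma path_continuous_eps w x e : path_continuous w -> 0 <= x -> 0 < e ->
  exists2 d, 0 < d & forall y, 0 <= y -> `|y - x| < d -> `|w y - w x| < e.
Proof.
move=> /subspace_continuousP cw x0 e0.
have /cw : [set` `[0, +oo[] x by rewrite /= in_itv /= x0.
move=> /cvgrPdist_lt /(_ e e0); rewrite /within /= => -[d d0 H].
exists d => // y y0 yd; rewrite distrC; apply: H; last by rewrite in_itv /= y0.
by rewrite /ball /= distrC.
Qed.

Lemma path_continuous_min w x y : path_continuous w -> 0 <= x -> x <= y ->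
  exists2 m, x <= m <= y & forall z, x <= z <= y -> w m <= w z.
Proof.
move=> cw x0 xy.
have [|m] := @EVT_min R w x y xy.
  apply: continuous_subspaceW cw => z /=.
  by rewrite !in_itv /= => /andP[/(le_trans x0) ->].
by rewrite in_itv /= => mxy H; exists m => // z zxy; apply: H; rewrite in_itv.
Qed.

(* No two local extrema of [w], minima of [s1 * w] and [s2 * w] respectively, differ
   by [kappa]; the first one may be at the origin. *)
Definition gap_free w (s1 s2 kappa : R) : Prop :=
  forall x1 x x2 y1 y y2, 0 <= x1 -> x1 <= x -> (x1 < x \/ x = 0) -> x < x2 ->
    x < y -> y1 < y -> y < y2 ->
    (forall z, x1 <= z <= x2 -> s1 * w x <= s1 * w z) ->
    (forall z, y1 <= z <= y2 -> s2 * w y <= s2 * w z) ->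
    w y - w x != kappa.

(* [tau] is the first time after [s] at which [w] is [h] above its minimum over
   [[s, tau]], which is reached at [m]. *)
Definition rise w s m tau : Prop :=
  [/\ s <= m < tau, w tau = w m + h,
      forall x, s <= x <= tau -> w m <= w x &
      forall y x, s <= y -> y <= x -> x < tau -> w x - w y < h].

(** The property of the starting time of each phase that turns the minimum over the phase into a
    local minimum of the path even if it is reached at [s], as [gap_free] requires. *)
Definition left_min w s : Prop :=
  exists s', [/\ 0 <= s', s' <= s, s' < s \/ s = 0 &
                 forall x, s' <= x <= s -> w s <= w x].

Hypothesis h_gt0 : 0 < h.

(** [tau] is the infimum of the times at which a rise of [h] has been completed, and [m] a minimum
    point over [[s, tau]]. Continuity at [tau] excludes both [w tau < w m + h] and
    [w tau > w m + h]. *)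
Lemma exists_rise w s : path_continuous w -> 0 <= s ->
  (exists y x, [/\ s <= y, y <= x & h <= w x - w y]) ->
  exists m tau, rise w s m tau.
Proof.
move=> cw s0 [y0 [x0 [sy0 yx0 wyx0]]].
pose A := [set x | exists2 y, s <= y <= x & h <= w x - w y].
have A0 : A x0 by exists y0 => //; rewrite sy0.
have As : lbound A s by move=> x [y /andP[sy yx] _]; exact: le_trans yx.
have infA : has_inf A by split; [exists x0|exists s].
pose tau := inf A.
have stau : s <= tau by apply: lb_le_inf => //; exists x0.
have tau0 : 0 <= tau by exact: le_trans stau.
have before y x : s <= y -> y <= x -> x < tau -> w x - w y < h.
  move=> sy yx xt; rewrite ltNge; apply/negP => hw.
  have : tau <= x by apply: ge_inf; [exists s|exists y => //; rewrite sy].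
  by rewrite leNgt xt.
have [m /andP[sm mt] mmin] := path_continuous_min cw s0 stau.
have m0 : 0 <= m by exact: le_trans sm.
have ge : h <= w tau - w m.
  rewrite leNgt; apply/negP => lt.
  (* If the rise starts before [tau] its height is below [w tau - w m + e]; if it starts after
     [tau], below [2 e]. A third of the deficit keeps both below [h]. *)
  pose e := (h - (w tau - w m)) / 3.
  have e0 : 0 < e by rewrite divr_gt0 // subr_gt0.
  have wm : w m <= w tau by apply: mmin; rewrite stau lexx.
  have [d d0 H] := path_continuous_eps cw tau0 e0.
  have [x Ax xd] := inf_adherent d0 infA.
  have tx : tau <= x by apply: ge_inf => //; exists s.
  case: Ax => y /andP[sy yx] hw.
  have wx : `|w x - w tau| < e.
    by apply: H; [exact: le_trans tx|rewrite ger0_norm ?subr_ge0 // ltrBlDl].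
  have [yt|ty] := leP y tau.
    have := mmin y; rewrite sy yt => /(_ isT) wy.
    by move: wx; rewrite ltr_distl /e => /andP[]; lra.
  have wy : `|w y - w tau| < e.
    apply: H; first exact: le_trans (ltW ty).
    by rewrite ger0_norm ?subr_ge0 ?(ltW ty) // ltrBlDl (le_lt_trans yx).
  by move: wx wy; rewrite !ltr_distl /e => /andP[? ?] /andP[? ?]; lra.
have mt' : m < tau.
  by rewrite lt_neqAle mt andbT; apply/eqP => E; move: ge; rewrite E subrr leNgt h_gt0.
exists m, tau; split => //; first by rewrite sm.
apply/eqP; rewrite eq_le; apply/andP; split; last by lra.
rewrite leNgt; apply/negP => gt.
have e0 : 0 < w tau - (w m + h) by lra.
have [d d0 H] := path_continuous_eps cw tau0 e0.
pose x := Num.max m (tau - d / 2).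
have xt : x < tau by rewrite gt_max mt' /=; lra.
have mx : m <= x by rewrite le_max lexx.
have := before m x sm mx xt.
have : `|w x - w tau| < w tau - (w m + h).
  apply: H; first exact: le_trans mx.
  rewrite distrC ger0_norm ?subr_ge0 ?(ltW xt) //.
  have : tau - d / 2 <= x by rewrite le_max lexx orbT.
  lra.
by rewrite ltr_distl => /andP[]; lra.
Qed.

Lemma rise_le w s m tau x : rise w s m tau -> m <= x <= tau -> w x <= w tau.
Proof.
move=> [/andP[sm mt] wt _ H] /andP[mx]; rewrite le_eqVlt => /orP[/eqP -> //|xt].
by have := H m x sm mx xt; rewrite wt; lra.
Qed.

Lemma rise_left_min w s m tau : 0 <= s -> rise w s m tau ->
  left_min (fun x => - w x) tau.
Proof.
move=> s0 r; have [/andP[sm mt] _ _ _] := r; exists m; split.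
- exact: le_trans sm.
- exact: ltW.
- by left.
- by move=> x mxt; rewrite lerN2; exact: rise_le r mxt.
Qed.

(* Otherwise [tau] would be a local maximum at height exactly [h] above the local
   minimum [m]. *)
Lemma rise_strict w s m tau d : 0 <= s -> rise w s m tau -> left_min w s ->
  gap_free w 1 (-1) h -> 0 < d -> exists2 x, tau < x < tau + d & w tau < w x.
Proof.
move=> s0 r [s' [s'0 s's s'lt s'min]] gf d0; apply: contrapT => /forall2NP H.
have [/andP[sm mt] wt mmin _] := r.
have le x : tau < x < tau + d -> w x <= w tau.
  by move=> xd; case: (H x) => // /negP; rewrite -leNgt.
have m0 : 0 <= m by exact: le_trans sm.
have m1 : s' <= m by exact: le_trans sm.
have m2 : s' < m \/ m = 0.
  case: s'lt => [s'lt|s0']; first by left; exact: lt_le_trans sm.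
  move: m0; rewrite le_eqVlt => /orP[/eqP <-|m0]; first by right.
  by left; apply: le_lt_trans m0; rewrite -s0'.
have := gf s' m tau m tau (tau + d / 2) s'0 m1 m2 mt mt mt.
have td : tau < tau + d / 2 by lra.
move=> /(_ td); case/(_ _ _)/negP => //.
- move=> z /andP[s'z zt]; rewrite !mul1r.
  have [sz|zs] := leP s z; first by apply: mmin; rewrite sz.
  have h1 : w m <= w s by apply: mmin; rewrite lexx (le_trans sm) // ltW.
  by apply: (le_trans h1); apply: s'min; rewrite s'z ltW.
- move=> z /andP[mz zt]; rewrite !mulN1r lerN2.
  have [zt'|tz] := leP z tau; first by apply: (rise_le r); rewrite mz.
  by apply: le; rewrite tz; lra.
- by rewrite wt addrC addKr.
Qed.

Lemma grid_point u x : 0 < u -> 0 <= x -> exists k : nat, x < k%:R * u <= x + u.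
Proof.
move=> u0 x0; have xu : 0 <= x / u by rewrite divr_ge0 // ltW.
have /andP[k1 k2] := truncn_itv xu; exists (Num.truncn (x / u)).+1.
rewrite -ltr_pdivrMr // k2 /= -natr1 mulrDl mul1r lerD2r.
by rewrite -ler_pdivlMr.
Qed.

(** The samples cannot complete a rise before [tau], since a rise of the samples is one of [w]. They
    complete one soon after: strict crossing gives a point [xs] just after [tau] with
    [w xs > w tau], and samples near [m] and [xs] differ by at least [h]. The index [k1] is that of
    the first crossing. *)
Lemma grid_rise w s m tau d : path_continuous w -> 0 <= s -> rise w s m tau ->
  (forall e, 0 < e -> exists2 x, tau < x < tau + e & w tau < w x) -> 0 < d ->
  exists2 eta, 0 < eta & forall u k0, 0 < u -> u < eta ->
    s <= k0%:R * u <= s + eta ->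
    exists k1, [/\ (k0 < k1)%N, tau <= k1%:R * u <= tau + d,
      forall i j, (k0 <= i)%N -> (i <= j)%N -> (j < k1)%N ->
        w (j%:R * u) - w (i%:R * u) < h,
      (exists2 i, (k0 <= i <= k1)%N & h <= w (k1%:R * u) - w (i%:R * u)) &
      `|w (k1%:R * u) - w tau| <= d /\
      forall e, (forall i, (k0 <= i < k1)%N -> e <= w (i%:R * u)) ->
        (exists2 i, (k0 <= i < k1)%N & e = w (i%:R * u)) -> `|e - w m| <= d].
Proof.
move=> cw s0 [/andP[sm mt] wt mmin before] strict d0.
have m0 : 0 <= m by exact: le_trans sm.
have tau0 : 0 <= tau by exact: le_trans (ltW mt).
(* Staying within [h] of [w tau = w m + h] keeps the samples after [tau] above [w m], so that the
   sampled minimum is not below the true one. *)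
have dh0 : 0 < Num.min d h by rewrite lt_min d0.
have [d1 d10 Htau] := path_continuous_eps cw tau0 dh0.
have dd0 : 0 < Num.min d d1 by rewrite lt_min d0.
have [xs /andP[txs xsd] wxs] := strict _ dd0.
have xs0 : 0 <= xs by exact: le_trans (ltW txs).
pose e := Num.min ((w xs - w tau) / 2) d.
have e0 : 0 < e by rewrite lt_min d0 andbT divr_gt0 // subr_gt0.
have [dm dm0 Hm] := path_continuous_eps cw m0 e0.
have [ds ds0 Hs] := path_continuous_eps cw xs0 e0.
have e1 : e <= (w xs - w tau) / 2 by rewrite ge_min lexx.
have e2 : e <= d by rewrite ge_min lexx orbT.
pose eta := Num.min (Num.min dm ds) (Num.min (tau - m) (tau + Num.min d d1 - xs)) / 2.
have eta0 : 0 < eta.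
  by rewrite divr_gt0 // !lt_min dm0 ds0 !subr_gt0 mt xsd.
have [eta1 eta2 eta3 eta4] : [/\ 2 * eta <= dm, 2 * eta <= ds, 2 * eta <= tau - m &
    2 * eta <= tau + Num.min d d1 - xs].
  have -> : 2 * eta = Num.min (Num.min dm ds) (Num.min (tau - m) (tau + Num.min d d1 - xs)).
    by rewrite /eta mulrC divfK.
  by split; rewrite !ge_min lexx ?orbT.
have md1 : Num.min d d1 <= d by rewrite ge_min lexx.
have md2 : Num.min d d1 <= d1 by rewrite ge_min lexx orbT.
exists eta => // u k0 u0 ueta /andP[sk0 k0s].
pose W i := w (i%:R * u).
have mono i j : (i%:R * u <= j%:R * u) = (i <= j)%N by rewrite ler_pM2r // ler_nat.
have [js /andP[js1 js2]] := grid_point u0 xs0.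
(* The sampled phase may begin after [m], since [k0 u] can exceed [s]; then [k0] itself is a grid
   index close enough to [m]. *)
have [im /andP[im1 im2] /andP[im3 im4]] : exists2 im : nat,
    (k0 <= im)%N && true & m <= im%:R * u <= m + eta.
  have [mk0|k0m] := leP m (k0%:R * u).
    by exists k0; rewrite ?leqnn // mk0 (le_trans k0s) // lerD2r.
  have [im /andP[h1 h2]] := grid_point u0 m0.
  exists im; first by rewrite andbT -mono (le_trans (ltW k0m)) // ltW.
  by rewrite ltW //= (le_trans h2) // lerD2l ltW.
have Wjs : `|W js - w xs| < e.
  apply: Hs; first exact: le_trans (ltW js1).
  by rewrite gtr0_norm ?subr_gt0 //; lra.
have Wim : `|W im - w m| < e.
  apply: Hm; first exact: le_trans im3.
  by rewrite ger0_norm ?subr_ge0 //; lra.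
have imjs : (im <= js)%N by rewrite -mono; lra.
pose crossing k := (k0 <= k)%N && [exists i : 'I_k.+1, (k0 <= i)%N && (h <= W k - W i)].
have crossP k : reflect ((k0 <= k)%N /\ exists2 i, (k0 <= i <= k)%N & h <= W k - W i) (crossing k).
  apply: (iffP andP) => -[-> H]; split => //.
    have [i /andP[k0i hi]] := existsP H.
    by exists i => //; rewrite k0i /= -ltnS ltn_ord.
  have [i /andP[k0i ik] hi] := H; apply/existsP.
  by exists (Ordinal (ik : (i < k.+1)%N)); rewrite k0i.
have exc : exists k, crossing k.
  exists js; apply/crossP; split; first exact: leq_trans imjs.
  exists im; first by rewrite im1.
  by move: Wjs Wim; rewrite !ltr_distl => /andP[? ?] /andP[? ?]; lra.
have [k1 /crossP[k01 [i1 /andP[i1a i1b] hi1]] k1min] := ex_minnP exc.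
have k1js : (k1 <= js)%N.
  apply: k1min; apply/crossP; split; first exact: leq_trans imjs.
  exists im; first by rewrite im1.
  by move: Wjs Wim; rewrite !ltr_distl => /andP[? ?] /andP[? ?]; lra.
have tk1 : tau <= k1%:R * u.
  rewrite leNgt; apply/negP => lt.
  suff : W k1 - W i1 < h by rewrite ltNge hi1.
  by apply: before => //; rewrite ?mono // (le_trans sk0) // mono.
have k1d : k1%:R * u <= tau + (Num.min d d1 - eta).
  have : k1%:R * u <= js%:R * u by rewrite mono.
  lra.
have near i : (i <= k1)%N -> tau <= i%:R * u -> `|W i - w tau| < Num.min d h.
  move=> ik ti; apply: Htau; first exact: le_trans ti.
  have : i%:R * u <= k1%:R * u by rewrite mono.
  by rewrite ger0_norm ?subr_ge0 //; lra.
exists k1; split.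
- rewrite ltn_neqAle k01 andbT; apply/eqP => E; move: hi1.
  have -> : i1 = k1 by apply/eqP; rewrite eqn_leq i1b -E i1a.
  by rewrite subrr leNgt h_gt0.
- by rewrite tk1 /=; lra.
- move=> i j k0i ij jk; rewrite ltNge; apply/negP => hij.
  have : (k1 <= j)%N.
    by apply: k1min; apply/crossP; split; [exact: leq_trans ij|exists i => //; rewrite k0i].
  by rewrite leqNgt jk.
- by exists i1 => //; rewrite i1a.
- split.
    by have := near k1 (leqnn _) tk1; rewrite lt_min => /andP[/ltW].
  move=> ee eemin [i /andP[k0i ik] eei].
  have imk1 : (im < k1)%N.
    rewrite ltnNge -mono -ltNge; apply: lt_le_trans tk1; lra.
  have u1 : ee <= W im by apply: eemin; rewrite im1.
  have l1 : w m <= ee.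
    rewrite eei; have [ti|it] := leP tau (i%:R * u); last first.
      by apply: mmin; rewrite (ltW it) andbT (le_trans sk0) // mono.
    have := near i (ltnW ik) ti; rewrite lt_min => /andP[_].
    by rewrite ltr_distl wt => /andP[? ?]; rewrite -/(W i); lra.
  rewrite ger0_norm ?subr_ge0 //.
  by move: Wim; rewrite ltr_distl => /andP[? ?]; lra.
Qed.

End Path.


(** * Phases of the automaton fed with the samples of a path *)

Section Phases.
Context (R : realType) (h : R).
Hypothesis h_gt0 : 0 < h.
Implicit Types (w : R -> R) (W : nat -> R) (x y z s m tau u : R) (n k p : nat).

(** A first crossing of the samples is a transition of the automaton: before [k1] no sample is [h]
    above the running minimum. The minimum [e] excludes the index [k1]. *)
Lemma run_down n W p k0 k1 z : run h n W k0 = (p, W k0, z) -> ~~ odd p -> p != 0%N ->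
  (k0 < k1)%N ->
  (forall i j, (k0 <= i)%N -> (i <= j)%N -> (j < k1)%N -> W j - W i < h) ->
  (exists2 i, (k0 <= i <= k1)%N & h <= W k1 - W i) ->
  exists e, [/\ forall i, (k0 <= i < k1)%N -> e <= W i,
    exists2 i, (k0 <= i < k1)%N & e = W i &
    run h n W k1 = (p.-1, W k1, z + (uphalf p)%:R / h * (W k1 - e - h))].
Proof.
move=> st po p0 k01 nc [i0 /andP[ki0 ik0] hi0].
have aux k : (k0 <= k)%N -> (k < k1)%N -> exists e,
    [/\ forall i, (k0 <= i <= k)%N -> e <= W i,
    exists2 i, (k0 <= i <= k)%N & e = W i & run h n W k = (p, e, z)].
  elim: k => [|k IH] k0k kk1.
    move: k0k st; rewrite leqn0 => /eqP -> st; exists (W 0%N); split => //.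
      by move=> i; rewrite leqn0 => /eqP ->.
    by exists 0%N.
  move: k0k; rewrite leq_eqVlt => /orP[/eqP E|k0k].
    exists (W k0); rewrite -E; split => //; last by exists k0; rewrite ?leqnn.
    by move=> i; rewrite -eqn_leq => /eqP ->.
  have [e [e1 [i2 /andP[i2a i2b] e2] e3]] := IH k0k (ltnW kk1).
  exists (Num.min e (W k.+1)); split.
  - move=> i /andP[k0i]; rewrite leq_eqVlt => /orP[/eqP ->|ik].
      by rewrite ge_min lexx orbT.
    by rewrite ge_min e1 // k0i.
  - have [_|_] := leP e (W k.+1).
      by exists i2 => //; rewrite i2a leqW.
    by exists k.+1 => //; rewrite leqW // leqnn.
  - rewrite [LHS]/= e3 /step (negPf p0) (negPf po).
    have : W k.+1 - W i2 < h by apply: nc => //; rewrite leqW.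
    by rewrite -e2 ltrBlDl ltNge => /negbTE ->.
case: k1 k01 nc i0 ki0 ik0 hi0 aux => // k k0k nc i0 ki0 ik0 hi0 aux.
have [e [e1 e2 e3]] := aux k k0k (ltnSn k).
exists e; split => //.
rewrite [LHS]/= e3 /step (negPf p0) (negPf po).
suff -> : e + h <= W k.+1 by [].
move: ik0; rewrite leq_eqVlt => /orP[/eqP E|ik].
  by move: hi0; rewrite E subrr leNgt h_gt0.
by have := e1 i0; rewrite ki0 -ltnS ik => /(_ isT); lra.
Qed.

(** Mirror image of [run_down], phrased with [- W] to match [grid_rise] applied to [- w]; thus [- e]
    is the running maximum. *)
Lemma run_up n W p k0 k1 z : run h n W k0 = (p, W k0, z) -> odd p -> (k0 < k1)%N ->
  (forall i j, (k0 <= i)%N -> (i <= j)%N -> (j < k1)%N -> - W j - - W i < h) ->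
  (exists2 i, (k0 <= i <= k1)%N & h <= - W k1 - - W i) ->
  exists e, [/\ forall i, (k0 <= i < k1)%N -> e <= - W i,
    exists2 i, (k0 <= i < k1)%N & e = - W i &
    run h n W k1 = (p.-1, W k1, z + (uphalf p)%:R / h * (- e - W k0))].
Proof.
move=> st po k01 nc [i0 /andP[ki0 ik0] hi0].
have p0 : p != 0%N by case: p po {st}.
have aux k : (k0 <= k)%N -> (k < k1)%N -> exists e,
    [/\ forall i, (k0 <= i <= k)%N -> e <= - W i,
    exists2 i, (k0 <= i <= k)%N & e = - W i &
    run h n W k = (p, - e, z + (uphalf p)%:R / h * (- e - W k0))].
  elim: k => [|k IH] k0k kk1.
    move: k0k st; rewrite leqn0 => /eqP -> st; exists (- W 0%N); split.
    - by move=> i; rewrite leqn0 => /eqP ->.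
    - by exists 0%N.
    - by rewrite opprK subrr mulr0 addr0.
  move: k0k; rewrite leq_eqVlt => /orP[/eqP E|k0k].
    exists (- W k0); rewrite -E; split; last by rewrite opprK subrr mulr0 addr0.
      by move=> i; rewrite -eqn_leq => /eqP ->.
    by exists k0; rewrite ?leqnn.
  have [e [e1 [i2 /andP[i2a i2b] e2] e3]] := IH k0k (ltnW kk1).
  exists (Num.min e (- W k.+1)); split.
  - move=> i /andP[k0i]; rewrite leq_eqVlt => /orP[/eqP ->|ik].
      by rewrite ge_min lexx orbT.
    by rewrite ge_min e1 // k0i.
  - have [_|_] := leP e (- W k.+1).
      by exists i2 => //; rewrite i2a leqW.
    by exists k.+1 => //; rewrite leqW // leqnn.
  - rewrite [LHS]/= e3 /step (negPf p0) po.
    have : - W k.+1 - - W i2 < h by apply: nc => //; rewrite leqW.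
    rewrite -e2 => lt; have /negbTE -> : ~~ (W k.+1 <= - e - h) by rewrite -ltNge; lra.
    have -> : Num.max (- e) (W k.+1) = - Num.min e (- W k.+1).
      by rewrite oppr_min opprK.
    by congr (_, _, _); rewrite -addrA -mulrDr; congr (_ + _ * _); ring.
case: k1 k01 nc i0 ki0 ik0 hi0 aux => // k k0k nc i0 ki0 ik0 hi0 aux.
have [e [e1 e2 e3]] := aux k k0k (ltnSn k).
exists e; split => //.
rewrite [LHS]/= e3 /step (negPf p0) po.
suff -> : W k.+1 <= - e - h by [].
move: ik0; rewrite leq_eqVlt => /orP[/eqP E|ik].
  by move: hi0; rewrite E subrr leNgt h_gt0.
by have := e1 i0; rewrite ki0 -ltnS ik => /(_ isT); lra.
Qed.

Definition sampling w N k : R := w (k%:R * 2^-1 ^+ N).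

(** The extremum stored in the state equals the current sample, which says that phase [p] is just
    beginning: for fine meshes this happens shortly after time [s], with accumulated excess close to
    [z]. *)
Definition run_near n w p s z : Prop :=
  forall d, 0 < d -> exists N0, forall N, (N0 <= N)%N -> exists k z',
    [/\ s <= k%:R * 2^-1 ^+ N <= s + d, `|z' - z| <= d &
        run h n (sampling w N) k = (p, sampling w N k, z')].

Lemma mesh_small d : 0 < d -> exists N0, forall N, (N0 <= N)%N -> 2^-1 ^+ N < d :> R.
Proof.
move=> d0; have : (fun N => 2^-1 ^+ N : R) @ \oo --> (0 : R).
  by apply: cvg_expr; rewrite ger0_norm ?invr_ge0 // invf_lt1 // ltr1n.
move=> /cvgrPdist_lt /(_ d d0) [N0 _ H]; exists N0 => N N0N.
by have := H N N0N; rewrite sub0r normrN ger0_norm // exprn_ge0 // invr_ge0.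
Qed.

Lemma run_near_start n w : run_near n w n.*2 0 0.
Proof.
move=> d d0; exists 0%N => N _; exists 0%N, 0; split => //.
- by rewrite mul0r lexx add0r ltW.
- by rewrite subrr normr0 ltW.
Qed.

(** The excess added at this transition is proportional to the overshoot [W k1 - e - h], which tends
    to 0 because the sample tends to [w tau = w m + h] and [e] to [w m]. *)
Lemma run_near_down n w p s z m tau : path_continuous w -> 0 <= s -> run_near n w p s z ->
  ~~ odd p -> p != 0%N -> left_min w s -> gap_free w 1 (-1) h -> rise h w s m tau ->
  run_near n w p.-1 tau z.
Proof.
move=> cw s0 near po p0 lm gf r d d0.
set c := (uphalf p)%:R / h; have c0 : 0 <= c by rewrite divr_ge0 // ltW.
(* Chosen so that [d' + 2 c d' <= d]: one error on [z] and two on the samples. *)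
pose d' := d / (4 * (c + 1)).
have d'0 : 0 < d' by rewrite divr_gt0 // mulr_gt0 // ltr_wpDl.
have dE : d' * (4 * (c + 1)) = d by rewrite divfK // gt_eqF // mulr_gt0 // ltr_wpDl.
have cd' : 0 <= c * d' by rewrite mulr_ge0 // ltW.
have d'd : d' <= d / 2 by lra.
have [eta eta0 G] := grid_rise h_gt0 cw s0 r (fun e => @rise_strict _ _ _ _ _ _ e s0 r lm gf) d'0.
have eta'0 : 0 < Num.min eta d' by rewrite lt_min eta0.
have [N1 H1] := near _ eta'0; have [N2 H2] := mesh_small eta0.
exists (maxn N1 N2) => N; rewrite geq_max => /andP[/H1 [k0 [z0 [/andP[sk ks] z0z st]]] /H2 ueta].
have u0 : 0 < 2^-1 ^+ N :> R by rewrite exprn_gt0 // invr_gt0.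
have [|k1 [k01 tk1 nc cr [wk1 em]]] := G _ k0 u0 ueta.
  by rewrite sk (le_trans ks) // lerD2l ge_min lexx.
have [e [e1 e2 e3]] := run_down st po p0 k01 nc cr.
have /ler_normlP[em1 em2] := em e e1 e2.
have [_ wt _ _] := r.
exists k1, (z0 + c * (sampling w N k1 - e - h)); split => //.
  by case/andP: tk1 => -> tk1; rewrite (le_trans tk1) // lerD2l; lra.
have /ler_normlP[w1 w2] := wk1.
have -> : z0 + c * (sampling w N k1 - e - h) - z =
   (z0 - z) + c * ((sampling w N k1 - w tau) - (e - w m)) by rewrite wt; ring.
apply: (le_trans (ler_normD _ _)); rewrite normrM (ger0_norm c0).
have z0z' : `|z0 - z| <= d' by rewrite (le_trans z0z) // ge_min lexx orbT.
have : c * `|sampling w N k1 - w tau - (e - w m)| <= c * (d' + d').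
  rewrite ler_wpM2l //; apply: (le_trans (ler_normB _ _)).
  by rewrite lerD //; exact: em.
move: z0z'; lra.
Qed.

(** Here [m] is the maximum point of [w] in the phase, so [w m - w s] is its height above the level
    at which the phase began. *)
Lemma run_near_up n w p s z m tau : path_continuous w -> 0 <= s -> run_near n w p s z ->
  odd p -> left_min (fun x => - w x) s -> gap_free w (-1) 1 (- h) ->
  rise h (fun x => - w x) s m tau ->
  run_near n w p.-1 tau (z + (uphalf p)%:R / h * (w m - w s)).
Proof.
move=> cw s0 near po lm gf r d d0.
have gf' : gap_free (fun x => - w x) 1 (-1) h.
  move=> x1 x x2 y1 y y2 h1 h2 h3 h4 h5 h6 h7 h8 h9.
  have : w y - w x != - h.
    apply: (gf x1 x x2 y1 y y2) => //.
      by move=> t /h8; rewrite !mul1r !mulN1r.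
    by move=> t /h9; rewrite !mul1r !mulN1r !opprK.
  by apply: contra => /eqP <-; apply/eqP; ring.
set c := (uphalf p)%:R / h; have c0 : 0 <= c by rewrite divr_ge0 // ltW.
pose d' := d / (4 * (c + 1)).
have d'0 : 0 < d' by rewrite divr_gt0 // mulr_gt0 // ltr_wpDl.
have dE : d' * (4 * (c + 1)) = d by rewrite divfK // gt_eqF // mulr_gt0 // ltr_wpDl.
have cd' : 0 <= c * d' by rewrite mulr_ge0 // ltW.
have d'd : d' <= d / 2 by lra.
have cw' := path_continuousN cw.
have [eta eta0 G] := grid_rise h_gt0 cw' s0 r (fun e => @rise_strict _ _ _ _ _ _ e s0 r lm gf') d'0.
have [ds ds0 Hs] := path_continuous_eps cw s0 d'0.
have eta'0 : 0 < Num.min eta (Num.min (ds / 2) d').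
  by rewrite !lt_min eta0 d'0 divr_gt0.
have [N1 H1] := near _ eta'0; have [N2 H2] := mesh_small eta0.
exists (maxn N1 N2) => N; rewrite geq_max => /andP[/H1 [k0 [z0 [/andP[sk ks] z0z st]]] /H2 ueta].
have u0 : 0 < 2^-1 ^+ N :> R by rewrite exprn_gt0 // invr_gt0.
have m1 : Num.min eta (Num.min (ds / 2) d') <= eta by rewrite ge_min lexx.
have m2 : Num.min eta (Num.min (ds / 2) d') <= ds / 2 by rewrite !ge_min lexx orbT.
have m3 : Num.min eta (Num.min (ds / 2) d') <= d' by rewrite !ge_min lexx !orbT.
have [|k1 [k01 tk1 nc cr [wk1 em]]] := G _ k0 u0 ueta.
  by rewrite sk (le_trans ks) // lerD2l.
have [e [e1 e2 e3]] := run_up st po k01 nc cr.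
have em1 := em e e1 e2.
exists k1, (z0 + c * (- e - sampling w N k0)); split => //.
  by case/andP: tk1 => -> tk1; rewrite (le_trans tk1) // lerD2l; lra.
have ws : `|sampling w N k0 - w s| < d'.
  apply: Hs; first exact: le_trans sk.
  by rewrite ger0_norm ?subr_ge0 //; lra.
have -> : z0 + c * (- e - sampling w N k0) - (z + c * (w m - w s)) =
   (z0 - z) + c * (- (sampling w N k0 - w s) - (e - - w m)) by ring.
apply: (le_trans (ler_normD _ _)); rewrite normrM (ger0_norm c0).
have z0z' : `|z0 - z| <= d' by rewrite (le_trans z0z).
have : c * `|- (sampling w N k0 - w s) - (e - - w m)| <= c * (d' + d').
  rewrite ler_wpM2l //; apply: (le_trans (ler_normB _ _)).
  by rewrite normrN lerD // ltW.
move: z0z'; lra.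
Qed.

Lemma run_done n W k k' z e : run h n W k = (0%N, e, z) -> (k <= k')%N ->
  run h n W k' = (0%N, e, z).
Proof.
move=> st; elim: k' => [|k' IH]; first by rewrite leqn0 => /eqP k0; rewrite -st k0.
by rewrite leq_eqVlt => /orP[/eqP <- //|kk']; rewrite /= IH.
Qed.

(** [N 2^N] steps of length [2^-N] lead to time [N], eventually beyond [s + 1], and the final state
    is absorbing. *)
Lemma run_near_done n w s z d : run_near n w 0 s z -> 0 < d ->
  exists N0, forall N, (N0 <= N)%N ->
    (run h n (sampling w N) (N * 2 ^ N)).1.1 = 0%N /\
    `|(run h n (sampling w N) (N * 2 ^ N)).2 - z| <= d.
Proof.
move=> near d0; have d'0 : 0 < Num.min d 1 by rewrite lt_min d0 ltr01.
have [N1 H1] := near _ d'0.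
exists (maxn N1 (Num.truncn (s + 1)).+1) => N; rewrite geq_max => /andP[/H1].
move=> [k [z' [/andP[sk ks] zz st]]] N2.
suff kN : (k <= N * 2 ^ N)%N.
  by rewrite (run_done st kN); split => //=; rewrite (le_trans zz) // ge_min lexx.
have u0 : 0 < 2^-1 ^+ N :> R by rewrite exprn_gt0 // invr_gt0.
rewrite -(ler_nat R) -(ler_pM2r u0) natrM natrX -mulrA -exprMn mulfV ?pnatr_eq0 //.
rewrite expr1n mulr1 (le_trans ks) //; apply: (@le_trans _ _ (s + 1)).
  by rewrite lerD2l ge_min lexx orbT.
by apply: le_trans (ltW (truncnS_gt (s + 1))) _; rewrite ler_nat.
Qed.

End Phases.


(** * Stable points of a path *)

Section StablePoints.
Context (R : realType) (t : R).
Hypothesis t_gt1 : 1 < t.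
Let h_gt0 : 0 < ln t. Proof. exact: ln_gt0. Qed.
Implicit Types (w : R -> R) (x y z l r s m tau : R) (n k p i : nat).

Lemma rise_is_r w s m tau : rise (ln t) w s m tau -> is_r w t m tau.
Proof.
move=> [/andP[sm mt] wt _ before]; split; first by rewrite /= wt.
move=> x /= [mx wx]; rewrite leNgt; apply/negP => xt.
by have := before m x sm (ltW mx) xt; lra.
Qed.

(** No rise of [ln t] is completed before [tau], so [[l, r]] contains [m] and [w x = w m]. If [x]
    and [m] were distinct they would be two local minima at the same height. *)
Lemma stable_rise w s m tau l x r : 0 <= s -> rise (ln t) w s m tau ->
  gap_free w 1 1 0 -> s <= x <= tau -> 0 <= l -> l < x -> x < r ->
  w x + ln t <= w l -> w x + ln t <= w r -> (forall z, l <= z <= r -> w x <= w z) ->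
  x = m.
Proof.
move=> s0 [/andP[sm mt] wt mmin before] gf /andP[sx xt] l0 lx xr wl wr xmin.
have mx : w m <= w x by apply: mmin; rewrite sx.
case: (ltgtP x m) => // [xm|xm].
  have mr : m < r.
    rewrite ltNge; apply/negP => rm.
    have := before x r sx (ltW xr) (le_lt_trans rm mt); lra.
  have wxm : w x = w m.
    by apply/eqP; rewrite eq_le mx xmin // (ltW mr) andbT (le_trans (ltW lx)) // ltW.
  have /(_ _ _)/eqP[] := gf l x m x m r l0 (ltW lx) (or_introl lx) xm xm xm mr.
  - move=> z /andP[lz zm]; rewrite !mul1r; apply: xmin.
    by rewrite lz (le_trans zm) // ltW.
  - move=> z /andP[xz zr]; rewrite !mul1r -wxm; apply: xmin.
    by rewrite (le_trans (ltW lx)).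
  - by rewrite wxm subrr.
have lm : l < m.
  rewrite ltNge; apply/negP => ml.
  have := before m l sm ml (lt_le_trans lx xt); lra.
have wxm : w x = w m.
  by apply/eqP; rewrite eq_le mx xmin // (ltW lm) /= ltW // (lt_trans xm).
have /(_ _ _)/eqP[] := gf l m x m x r l0 (ltW lm) (or_introl lm) xm xm xm xr.
- move=> z /andP[lz zm]; rewrite !mul1r -wxm; apply: xmin.
  by rewrite lz (le_trans zm) // ltW.
- move=> z /andP[mz zr]; rewrite !mul1r; apply: xmin.
  by rewrite zr andbT (le_trans (ltW lm)).
- by rewrite wxm subrr.
Qed.

(** Neither place is possible for [l]: after [tau] no fall of [ln t] is completed before [sigma]; on
    [[m, tau)] one has [w < w m + ln t = w tau < w x + ln t]; and if [l < m] then [[l, x]] contains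
    [m], where [w m < w x]. *)
Lemma not_stable_fall w s m tau M sigma l x :
  rise (ln t) w s m tau -> rise (ln t) (fun x => - w x) tau M sigma ->
  tau < x < sigma -> l < x -> w x + ln t <= w l ->
  (forall z, l <= z <= x -> w x <= w z) -> False.
Proof.
move=> [/andP[sm mt] wt mmin before] [_ _ _ before'] /andP[tx xs] lx wl xmin.
have b1 := before' tau x (lexx _) (ltW tx) xs.
have [tl|lt] := leP tau l.
  have b2 := before' l x tl (ltW lx) xs; lra.
have [ml|lm] := leP m l.
  have := before m l sm ml lt; lra.
have : w x <= w m by apply: xmin; rewrite (ltW lm) ltW // (lt_trans mt).
lra.
Qed.

Lemma largest_crossing w m M : path_continuous w -> 0 <= M -> M < m ->
  w m + ln t <= w M -> exists l, is_l w t m l /\ M <= l.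
Proof.
move=> cw M0 Mm wM.
pose A := [set x | [/\ 0 <= x, x < m & w m + ln t <= w x]].
have AM : A M by [].
have supA : has_sup A by split; [exists M | exists m => x [_ /ltW]].
have Ml : M <= sup A by apply: ub_le_sup => //; exists m => x [_ /ltW].
have l0 := le_trans M0 Ml.
have lm : sup A <= m by apply: ge_sup; [exists M | move=> x [_ /ltW]].
have wl : w m + ln t <= w (sup A).
  rewrite leNgt; apply/negP => lt.
  have gap : 0 < w m + ln t - w (sup A) by rewrite subr_gt0.
  have [d d0 H] := path_continuous_eps cw l0 gap.
  have [x Ax xl] := sup_adherent d0 supA; have [x0 xm wx] := Ax.
  have xs : x <= sup A by apply: ub_le_sup => //; exists m => y [_ /ltW].
  have := H x x0; rewrite distrC ger0_norm ?subr_ge0 // ltrBlDr -ltrBlDl.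
  have -> : sup A - d < x by [].
  by rewrite ltr_distl => /(_ isT) /andP[_]; lra.
exists (sup A); split => //; split.
  split => //; rewrite lt_neqAle lm andbT; apply/eqP => E; move: wl.
  by rewrite E gerDl leNgt h_gt0.
by move=> x Ax; apply: ub_le_sup => //; exists m => y [_ /ltW].
Qed.

(** * Cycles: a wait on [[s i, tau i]] with minimum at [m i], then a rising phase until [s i.+1]
    with maximum at [M i] *)

Section Cycles.
Context (w : R -> R) (s m tau M : nat -> R).
Hypothesis cw : path_continuous w.
Hypothesis gf : gap_free w 1 1 0.
Hypothesis s_0 : s 0%N = 0.
Hypothesis up : forall i, rise (ln t) w (s i) (m i) (tau i).
Hypothesis down : forall i, rise (ln t) (fun x => - w x) (tau i) (M i) (s i.+1).

Let sm i : s i <= m i. Proof. by have [/andP[]] := up i. Qed.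
Let mt i : m i < tau i. Proof. by have [/andP[]] := up i. Qed.
Let tM i : tau i <= M i. Proof. by have [/andP[]] := down i. Qed.
Let Ms i : M i < s i.+1. Proof. by have [/andP[]] := down i. Qed.
Let s_ge0 i : 0 <= s i.
Proof.
elim: i => [|i IH]; first by rewrite s_0.
exact: le_trans (le_trans (le_trans IH (sm i)) (ltW (mt i))) (le_trans (tM i) (ltW (Ms i))).
Qed.

Lemma cycle_height i : w (s i.+1) = w (M i) - ln t.
Proof. by have [_ E _ _] := down i; rewrite -[LHS]opprK E opprD opprK. Qed.

Lemma first_stable_cycle : first_stable w t (m 0%N).
Proof.
have [_ wt mmin before] := up 0%N; rewrite s_0 in mmin before.
have m0 : 0 <= m 0%N by rewrite -s_0.
split.
  split => //; exists (tau 0%N); first exact: rise_is_r (up 0%N).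
  split; first by exists (m 0%N) => //=; rewrite in_itv /= m0 ltW.
  by move=> _ [x /= + <-]; rewrite in_itv /= => /mmin.
move=> x [x0 [r [[/= xr wr] rmin] [_ xmin]]].
rewrite leNgt; apply/negP => xm.
have xmin' z : 0 <= z <= r -> w x <= w z.
  by move=> zr; apply: xmin; exists z => //=; rewrite in_itv.
have mx : w (m 0%N) <= w x by apply: mmin; rewrite x0 ltW // (lt_trans xm).
have mr : m 0%N < r.
  rewrite ltNge; apply/negP => rm.
  have := before x r x0 (ltW xr) (le_lt_trans rm (mt 0%N)); lra.
have wxm : w x = w (m 0%N).
  by apply/eqP; rewrite eq_le mx xmin' // m0 ltW.
(* The competitor may be the origin, which has no left neighbourhood; this is the case [x = 0] of
   [gap_free]. *)
have x01 : 0 < x \/ x = 0.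
  by move: x0; rewrite le_eqVlt => /orP[/eqP <-|]; [right|left].
have /(_ _ _)/eqP[] := gf (lexx 0) x0 x01 xm xm xm mr.
- move=> z /andP[z0 zm]; rewrite !mul1r; apply: xmin'.
  by rewrite z0 (le_trans zm) // ltW.
- move=> z /andP[xz zr]; rewrite !mul1r -wxm; apply: xmin'.
  by rewrite (le_trans x0).
- by rewrite wxm subrr.
Qed.

(** [w (M i) = w (s i.+1) + ln t >= w (m i.+1) + ln t], so [l(t, m i.+1)] is not to the left of
    [M i]; and from [M i] to [s i.+1] the path stays above [w (M i) - ln t]. *)
Lemma stable_cycle i : stable w t (m i).
Proof.
case: i => [|i]; first by left; exact: first_stable_cycle.
have [f|nf] := pselect (first_stable w t (m i.+1)); [by left|right].
have m0 : 0 <= m i.+1 by exact: le_trans (s_ge0 _) (sm _).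
split => //.
have M0 : 0 <= M i by exact: le_trans (s_ge0 i) (le_trans (sm i) (le_trans (ltW (mt i)) (tM i))).
have [_ wt mmin before] := up i.+1.
have [_ _ _ before'] := down i.
have ws : w (m i.+1) <= w (s i.+1).
  by apply: mmin; rewrite lexx (le_trans (sm _)) // ltW.
have [l [il Ml]] : exists l, is_l w t (m i.+1) l /\ M i <= l.
  apply: largest_crossing => //; first exact: lt_le_trans (Ms i) (sm _).
  by move: ws; rewrite cycle_height; lra.
exists l, (tau i.+1); split => //; first exact: rise_is_r (up _).
have [[l0 lm _] _] := il.
split; first by exists (m i.+1) => //=; rewrite in_itv /= !ltW.
move=> _ [z /= + <-]; rewrite in_itv /= => /andP[lz zt].
have [sz|zs] := leP (s i.+1) z; first by apply: mmin; rewrite sz.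
have := before' (M i) z (tM i) (le_trans Ml lz) zs.
by move: ws; rewrite cycle_height; lra.
Qed.

Lemma locate_cycle k x : 0 <= x -> x < s k ->
  exists2 i, (i < k)%N & s i <= x < s i.+1.
Proof.
move=> x0; elim: k => [|k IH]; first by rewrite s_0 ltNge x0.
have [xk _|kx xk] := ltP x (s k); last by exists k => //; rewrite kx.
by have [i ik H] := IH xk; exists i => //; rewrite ltnS ltnW.
Qed.

Lemma stable_is_cycle k x : stable w t x -> x <= m k -> exists2 i, (i <= k)%N & x = m i.
Proof.
move=> [[fx1 fx2] _|[x0 _ [l [r [[[l0 lx wl] _] [[/= xr wr] _] [_ xmin]]]]] xk].
  exists 0%N => //; have [fm1 fm2] := first_stable_cycle.
  by apply/eqP; rewrite eq_le fx2 // fm2.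
have xmin' z : l <= z <= r -> w x <= w z.
  by move=> zr; apply: xmin; exists z => //=; rewrite in_itv.
have xs : x < s k.+1.
  exact: le_lt_trans xk (lt_trans (mt k) (le_lt_trans (tM k) (Ms k))).
have [i ik /andP[six xsi]] := locate_cycle x0 xs.
exists i => //; have [xt|tx] := leP x (tau i).
  apply: (@stable_rise w (s i) (m i) (tau i) l x r) => //.
  by rewrite six.
exfalso; apply: (@not_stable_fall w (s i) (m i) (tau i) (M i) (s i.+1) l x) => //.
  by rewrite tx.
by move=> z /andP[lz zx]; apply: xmin'; rewrite lz (le_trans zx) // ltW.
Qed.

(** Up to [tau i] the path is below [w (tau i)]; in the rising phase [M i] is the maximum; after
    [s i.+1] the next rise is unfinished, so the path is below [w (s i.+1) + ln t = w (M i)]. *)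
Lemma argmax_cycle i : is_argmax w (m i) (m i.+1) (M i).
Proof.
split; first by rewrite (lt_le_trans (mt i) (tM i)) (lt_le_trans (Ms i) (sm _)).
move=> x /andP[mx xm].
have [_ _ Mmax _] := down i.
have tle : w (tau i) <= w (M i).
  by rewrite -lerN2; apply: Mmax; rewrite lexx (le_trans (tM i)) // ltW.
have [xt|tx] := leP x (tau i).
  by apply: le_trans tle; apply: (rise_le (up i)); rewrite (ltW mx).
have [xs|sx] := leP x (s i.+1).
  by rewrite -lerN2; apply: Mmax; rewrite (ltW tx).
have [_ _ _ before] := up i.+1.
have := before (s i.+1) x (lexx _) (ltW sx) (lt_trans xm (mt _)).
by rewrite cycle_height; lra.
Qed.

(** As [w (tau j) = w (m j) + ln t], each term is [n - j] times the normalized height minus one; the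
    subtracted weights add up to the shift [gamma (gamma - 1) / 2], with [gamma = n + 1]. *)
Definition cycle_sum n i : R :=
  \sum_(j < i) (n - j)%:R / ln t * (w (M j) - w (tau j)).

Lemma is_zeta_cycle n :
  is_zeta n.+1 t w (cycle_sum n n + (n.+1 * (n.+1 - 1))%:R / 2).
Proof.
exists (fun i => m i.-1), (fun i => M i.-1); split.
- split.
  + case=> // i _ /=; exact: lt_trans (lt_le_trans (mt i) (tM i)) (lt_le_trans (Ms i) (sm _)).
  + by move=> i _; exact: stable_cycle.
  + by move=> x sx /(stable_is_cycle sx)[i ik ->]; exists i.+1.
- by case=> // i _; exact: argmax_cycle.
- rewrite /cycle_sum -(big_mkord xpredT (fun j => (n - j)%:R / ln t * (w (M j) - w (tau j)))).
  rewrite big_add1 /=.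
  have -> : (n.+1 * (n.+1 - 1))%:R / 2 = \sum_(0 <= j < n) (n - j)%:R :> R.
    rewrite big_nat_rev /= add0n subn1 /=.
    have -> : \sum_(0 <= i < n) (n - (n - i.+1))%:R = \sum_(0 <= i < n) i.+1%:R :> R.
      by apply: eq_big_nat => i /andP[_ iN]; rewrite subKn.
    elim: n => [|k IH]; first by rewrite big_geq // muln0 mul0r.
    rewrite big_nat_recr //= -IH !natrM -(natr1 k.+1).
    by field.
  rewrite -big_split /=; apply: eq_big_nat => j _; rewrite subSS.
  have [_ -> _ _] := up j.
  by field; rewrite gt_eqF.
Qed.

Hypothesis gf1 : gap_free w 1 (-1) (ln t).
Hypothesis gf2 : gap_free w (-1) 1 (- ln t).

Lemma left_min_cycle i : left_min w (s i).
Proof.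
case: i => [|i].
  exists 0; rewrite s_0; split => //; first by right.
  by move=> x; rewrite -eq_le => /eqP ->.
have [] := rise_left_min _ (down i).
  exact: le_trans (s_ge0 i) (le_trans (sm i) (ltW (mt i))).
move=> s' [h1 h2 h3 h4]; exists s'; split => // x /h4.
by rewrite !opprK.
Qed.

Lemma run_near_cycle n i : (i <= n)%N ->
  run_near (ln t) n w (n - i).*2 (s i) (cycle_sum n i).
Proof.
elim: i => [|i IH] iN; first by rewrite subn0 s_0 /cycle_sum big_ord0; exact: run_near_start.
have := run_near_down h_gt0 cw (s_ge0 i) (IH (ltnW iN)).
rewrite odd_double => /(_ _ _ isT); have -> : (n - i).*2 != 0%N by lia.
move=> /(_ _ _ isT (left_min_cycle i) gf1 (up i)) near.
have t0 : 0 <= tau i by exact: le_trans (s_ge0 i) (le_trans (sm i) (ltW (mt i))).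
have := run_near_up h_gt0 cw t0 near.
have -> : odd (n - i).*2.-1 by lia.
move=> /(_ _ _ isT (rise_left_min (s_ge0 i) (up i)) gf2 (down i)).
have -> : (n - i).*2.-1.-1 = (n - i.+1).*2 by lia.
have -> : uphalf (n - i).*2.-1 = (n - i)%N by lia.
by rewrite /cycle_sum big_ord_recr.
Qed.

End Cycles.

Definition oscillates w : Prop := forall s, 0 <= s ->
  (exists y x, [/\ s <= y, y <= x & ln t <= w x - w y]) /\
  (exists y x, [/\ s <= y, y <= x & ln t <= w y - w x]).

Lemma path_zeta w n : path_continuous w -> oscillates w ->
  gap_free w 1 1 0 -> gap_free w 1 (-1) (ln t) -> gap_free w (-1) 1 (- ln t) ->
  exists2 z, is_zeta n.+1 t w (z + (n.+1 * (n.+1 - 1))%:R / 2) &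
    forall d, 0 < d -> exists N0, forall N, (N0 <= N)%N ->
      (run (ln t) n (sampling w N) (N * 2 ^ N)).1.1 = 0%N /\
      `|(run (ln t) n (sampling w N) (N * 2 ^ N)).2 - z| <= d.
Proof.
move=> cw osc gf gf1 gf2.
(* [f s] lists the four times of the cycle that starts at [s], with a default for [s < 0]; iterating
   its last component gives all cycles. *)
have /choice[f fP] : forall s, exists q : R * R * R * R, 0 <= s ->
    rise (ln t) w s q.1.1.1 q.1.1.2 /\
    rise (ln t) (fun x => - w x) q.1.1.2 q.1.2 q.2.
  move=> s; have [s0|s0] := leP 0 s; last by exists (0, 0, 0, 0).
  have [m [tau r]] := exists_rise h_gt0 cw s0 (osc s s0).1.
  have t0 : 0 <= tau.
    by have [/andP[sm mt] _ _ _] := r; exact: le_trans s0 (le_trans sm (ltW mt)).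
  have [|M [sigma r']] := exists_rise h_gt0 (path_continuousN cw) t0.
    have [_ [y [x [h1 h2 h3]]]] := osc tau t0.
    by exists y, x; split => //; rewrite opprK addrC.
  by exists (m, tau, M, sigma).
pose s i := iter i (fun s => (f s).2) 0.
have s0 i : 0 <= s i.
  elim: i => [|i IH] //=; have [[/andP[a1 a2] _ _ _] [/andP[a3 a4] _ _ _]] := fP _ IH.
  exact: le_trans (le_trans (le_trans IH a1) (ltW a2)) (le_trans a3 (ltW a4)).
have up i := (fP _ (s0 i)).1.
have down i := (fP _ (s0 i)).2.
have near := @run_near_cycle w s (fun i => (f (s i)).1.1.1) (fun i => (f (s i)).1.1.2)
  (fun i => (f (s i)).1.2) cw erefl up down gf1 gf2 n n (leqnn n).
rewrite subnn in near.
exists (cycle_sum w (fun i => (f (s i)).1.1.2) (fun i => (f (s i)).1.2) n n).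
  exact: (@is_zeta_cycle w s (fun i => (f (s i)).1.1.1) (fun i => (f (s i)).1.1.2)
  (fun i => (f (s i)).1.2) cw gf erefl up down n).
by move=> d d0; exact: run_near_done near d0.
Qed.

End StablePoints.


(** * Gaussian increments and independence *)

Section LebesgueDensity.
Context (R : realType).
Local Notation mu := (@lebesgue_measure R).
Local Open Scope ereal_scope.

Lemma ge0_integral_oppr (f : R -> \bar R) : measurable_fun setT f -> (forall x, 0 <= f x) ->
  \int[mu]_x f (- x)%R = \int[mu]_x f x.
Proof.
move=> mf f0.
have mN : measurable_fun setT (-%R : measurableTypeR R -> measurableTypeR R).
  by move=> mD B mB; exact: (oppr_measurable mD mB).
have := @ge0_integral_pushforward _ _ _ _ _ _ mN mu setT f measurableT mf (fun x _ => f0 x).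
rewrite preimage_setT => <-.
by apply: eq_measure_integral => A mA _; exact: lebesgue_measureN.
Qed.

End LebesgueDensity.

Section Density.
Context d (T : measurableType d) (R : realType) (mu nu : {measure set T -> \bar R}).
Local Open Scope ereal_scope.

Import HBNNSimple.

Lemma ge0_integral_density (p : T -> R) (f : T -> \bar R) :
  measurable_fun setT p -> (forall x, 0 <= p x)%R ->
  (forall B, measurable B -> nu B = \int[mu]_(x in B) (p x)%:E) ->
  measurable_fun setT f -> (forall x, 0 <= f x) ->
  \int[nu]_x f x = \int[mu]_x (f x * (p x)%:E).
Proof.
move=> mp p0 nuE mf f0.
pose f_ := nnsfun_approx measurableT mf.
have mpE : measurable_fun setT (EFin \o p) by exact/measurable_EFinP.
transitivity (limn (fun n => \int[nu]_x (f_ n x)%:E)).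
  rewrite -monotone_convergence //.
  - by apply: eq_integral => y _; apply/esym/cvg_lim => //; exact: cvg_nnsfun_approx.
  - by move=> n; exact/measurable_EFinP/measurable_funP.
  - by move=> n y _; rewrite lee_fin.
  - by move=> y _ m n mn; rewrite lee_fin; exact/lefP/nd_nnsfun_approx.
transitivity (limn (fun n => \int[mu]_x ((f_ n x)%:E * (p x)%:E))); last first.
  rewrite -monotone_convergence //.
  - apply: eq_integral => y _; apply/cvg_lim => //.
    by apply: cvgeZr => //; exact: cvg_nnsfun_approx.
  - by move=> n; apply: emeasurable_funM => //; exact/measurable_EFinP/measurable_funP.
  - by move=> n y _; rewrite mule_ge0 ?lee_fin.
  - move=> y _ m n mn; rewrite lee_wpmul2r ?lee_fin //.
    exact/lefP/nd_nnsfun_approx.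
congr (limn _); apply/funext => n.
rewrite integralT_nnsfun sintegralE.
have E x : (f_ n x)%:E * (p x)%:E =
    \sum_(r \in range (f_ n)) ((r * \1_(f_ n @^-1` [set r]) x)%:E * (p x)%:E).
  rewrite fimfunE -fsumEFin // ge0_mule_fsuml // => r.
  by rewrite EFinM nnfun_muleindic_ge0.
under [RHS]eq_integral do rewrite E.
rewrite ge0_integral_fsum //; last 2 first.
- move=> r; apply: emeasurable_funM => //.
  by apply/measurable_EFinP; apply: measurable_funM => //; exact: measurable_indic.
- move=> r x _; apply: mule_ge0; last by rewrite lee_fin.
  by rewrite EFinM nnfun_muleindic_ge0.
apply: eq_fsbigr => r _.
transitivity (\int[mu]_x (r%:E * ((p x)%:E * (\1_(f_ n @^-1` [set r]) x)%:E))); last first.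
  by apply: eq_integral => x _; rewrite EFinM -muleA [(_%:E * (p x)%:E)]muleC.
have [r0|r0] := leP 0%R r.
  rewrite ge0_integralZl ?lee_fin //; last 2 first.
  - by apply: emeasurable_funM => //; apply/measurable_EFinP; exact: measurable_indic.
  - by move=> x _; rewrite mule_ge0 ?lee_fin.
  congr (_ * _); rewrite nuE //; rewrite integral_mkcond; apply: eq_integral => x _.
  by rewrite restrict_EFin /= -EFinM patchE indicE; case: ifP => _; rewrite ?mulr1 ?mulr0.
have -> : f_ n @^-1` [set r] = set0 by apply: preimage_nnfun0.
rewrite measure0 mule0; apply/esym; apply: integral0_eq => x _.
by rewrite indic0 !mule0.
Qed.

End Density.


Section Gaussian.
Context d (T : measurableType d) (R : realType) (P : probability T R).
Context (xi : {RV P >-> R}) (s : R).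
Local Notation mu := (@lebesgue_measure R).
Local Open Scope ereal_scope.
Hypothesis s_gt0 : (0 < s)%R.
Hypothesis xi_law : forall B : set R, measurable B -> P (xi @^-1` B) = normal_prob 0 s B.

Let s_neq0 : s != 0%R. Proof. by rewrite gt_eqF. Qed.

Lemma gaussian_integral (f : R -> \bar R) : measurable_fun setT f -> (forall x, 0 <= f x) ->
  \int[P]_om f (xi om) = \int[mu]_x (f x * (normal_pdf 0 s x)%:E).
Proof.
move=> mf f0.
have mxi : measurable_fun setT (xi : T -> measurableTypeR R).
  by move=> mD B mB; have := @measurable_funPT _ _ _ _ xi measurableT B mB.
pose xi' : {mfun T >-> measurableTypeR R} :=
  HB.pack (xi : T -> measurableTypeR R) (isMeasurableFun.Build _ _ _ _ _ mxi).
have mf' : measurable_fun [set: measurableTypeR R] f by move=> mD B mB; exact: (mf mD B mB).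
have := @ge0_integral_pushforward _ _ _ (measurableTypeR R) R xi mxi P setT f
  measurableT mf' (fun x _ => f0 x).
rewrite preimage_setT => <-.
exact: (@ge0_integral_density _ (measurableTypeR R) R mu (pushforward P xi')
  (normal_pdf 0 s) f (measurable_normal_pdf 0 s) (normal_pdf_ge0 0 s) xi_law mf' f0).
Qed.

Lemma normal_pdf0N x : normal_pdf 0 s (- x) = normal_pdf 0 s x :> R.
Proof.
by rewrite !normal_pdfE // /= /normal_fun !subr0 sqrrN.
Qed.

(** Mean zero, stated with nonnegative integrals so that it makes sense before integrability is
    known. *)
Lemma gaussian_posneg :
  \int[P]_om (Num.max (xi om) 0)%:E = \int[P]_om (Num.max (- xi om) 0)%:E.
Proof.
have m1 : measurable_fun setT (fun x : R => (Num.max x 0)%:E).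
  by apply/measurable_EFinP; apply: measurable_maxr => //; exact: measurable_id.
have m2 : measurable_fun setT (fun x : R => (Num.max (- x) 0)%:E).
  by apply/measurable_EFinP; apply: measurable_maxr => //; exact: oppr_measurable.
rewrite (gaussian_integral m1); last by move=> x; rewrite lee_fin le_max lexx orbT.
rewrite (gaussian_integral m2); last by move=> x; rewrite lee_fin le_max lexx orbT.
rewrite -[LHS]ge0_integral_oppr.
- by apply: eq_integral => x _; rewrite normal_pdf0N.
- apply: emeasurable_funM => //.
  by apply/measurable_EFinP; exact: measurable_normal_pdf.
- move=> x; rewrite mule_ge0 ?lee_fin ?normal_pdf_ge0 //.
  by rewrite le_max lexx orbT.
Qed.

(** Domination by a wider Gaussian density, of known integral, gives a fourth moment of order [s^4].
    The constant is 16 from [x^4 = 16 s^4 q^2], times 4 from [q^2 e^(-q) <= 4], times the ratio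
    [sqrt 2] of the peaks. *)
Lemma normal_pdf_fourth x :
  (x ^+ 4 * normal_pdf 0 s x <=
   64 * Num.sqrt 2 * s ^+ 4 * normal_pdf 0 (Num.sqrt 2 * s) x)%R.
Proof.
have s20 : (0 < Num.sqrt 2 * s :> R)%R by rewrite mulr_gt0 // sqrtr_gt0.
rewrite !normal_pdfE ?gt_eqF // /= /normal_fun /normal_peak !subr0.
have E : Num.sqrt ((Num.sqrt 2 * s) ^+ 2 * pi *+ 2) =
    (Num.sqrt 2 * Num.sqrt (s ^+ 2 * pi *+ 2))%R :> R.
  by rewrite exprMn sqr_sqrtr // -mulrA -mulrnAr sqrtrM.
rewrite E invfM.
have p0 : (0 < Num.sqrt (s ^+ 2 * pi *+ 2) :> R)%R.
  by rewrite sqrtr_gt0 pmulrn_lgt0 // mulr_gt0 ?pi_gt0 // exprn_gt0.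
set k := Num.sqrt (s ^+ 2 * pi *+ 2) in p0 *.
pose q : R := (x ^+ 2 / (4 * s ^+ 2))%R.
have q0 : (0 <= q)%R by rewrite divr_ge0 ?sqr_ge0 // mulr_ge0 // sqr_ge0.
(* With [q = x^2 / (4 s^2)]: [x^4 e^(- 2 q) = 16 s^4 q^2 e^(- 2 q) <= 64 s^4 e^(- q)]. *)
have -> : (- x ^+ 2 / (s ^+ 2 *+ 2) = - q - q)%R.
  by rewrite /q -mulr_natr; field.
have -> : (- x ^+ 2 / ((Num.sqrt 2 * s) ^+ 2 *+ 2) = - q)%R.
  by rewrite /q exprMn sqr_sqrtr // -mulr_natr; field.
have -> : (x ^+ 4 = 16 * s ^+ 4 * q ^+ 2)%R.
  by rewrite /q; field.
rewrite expRD.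
have qe : (q ^+ 2 * expR (- q) <= 4)%R.
  have h : (q / 2 <= expR (q / 2))%R.
    by apply: le_trans (expR_ge1Dx (q / 2)); rewrite lerDr.
  have h2 : ((q / 2) ^+ 2 <= expR q)%R.
    rewrite [X in (_ <= expR X)%R](splitr q) expRD -expr2.
    by apply: lerXn2r => //; rewrite nnegrE ?expR_ge0 // divr_ge0.
  rewrite expRN ler_pdivrMr ?expR_gt0 //.
  have -> : (q ^+ 2 = 4 * (q / 2) ^+ 2)%R by field.
  by rewrite ler_wpM2l.
have r0 : (0 < Num.sqrt 2 :> R)%R by rewrite sqrtr_gt0.
have -> : (16 * s ^+ 4 * q ^+ 2 * (k^-1 * (expR (- q) * expR (- q))) =
   (16 * s ^+ 4 * k^-1 * expR (- q)) * (q ^+ 2 * expR (- q)))%R by ring.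
have -> : (64 * Num.sqrt 2 * s ^+ 4 * ((Num.sqrt 2)^-1 * k^-1 * expR (- q)) =
   (16 * s ^+ 4 * k^-1 * expR (- q)) * 4)%R.
  by field; rewrite !gt_eqF.
rewrite ler_wpM2l // mulr_ge0 ?expR_ge0 // mulr_ge0 ?invr_ge0 ?(ltW p0) //.
by rewrite mulr_ge0 // exprn_even_ge0.
Qed.

Lemma gaussian_fourth :
  \int[P]_om ((xi om) ^+ 4)%:E <= (64 * Num.sqrt 2 * s ^+ 4)%:E.
Proof.
have m4 : measurable_fun setT (fun x : R => (x ^+ 4)%:E).
  by apply/measurable_EFinP; exact: exprn_measurable.
rewrite (gaussian_integral m4); last by move=> x; rewrite lee_fin exprn_even_ge0.
have c0 : (0 <= 64 * Num.sqrt 2 * s ^+ 4 :> R)%R.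
  by apply: mulr_ge0; [apply: mulr_ge0; rewrite ?sqrtr_ge0|rewrite exprn_even_ge0].
apply: (@le_trans _ _ (\int[mu]_x ((64 * Num.sqrt 2 * s ^+ 4)%:E *
   (normal_pdf 0 (Num.sqrt 2 * s) x)%:E))).
  apply: ge0_le_integral => //.
  - by move=> x _; rewrite mule_ge0 // lee_fin ?exprn_even_ge0 ?normal_pdf_ge0.
  - apply: emeasurable_funM => //.
    by apply/measurable_EFinP; exact: measurable_normal_pdf.
  - apply: emeasurable_funM => //.
    by apply/measurable_EFinP; exact: measurable_normal_pdf.
  - by move=> x _; rewrite -!EFinM lee_fin normal_pdf_fourth.
rewrite ge0_integralZl //.
- by rewrite integral_normal_pdf mule1.
- by apply/measurable_EFinP; exact: measurable_normal_pdf.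
- by move=> x _; rewrite lee_fin normal_pdf_ge0.
Qed.

Lemma gaussian_small (c e : R) : (0 <= e)%R ->
  P (xi @^-1` `[(c - e)%R, (c + e)%R]) <= (normal_peak s * (2 * e))%:E.
Proof.
move=> e0; rewrite xi_law // /normal_prob.
apply: (@le_trans _ _ (\int[mu]_(x in `[(c - e)%R, (c + e)%R]) (normal_peak s)%:E)).
  apply: ge0_le_integral => //.
  - by move=> x _; rewrite lee_fin normal_pdf_ge0.
  - apply: measurable_funTS; apply/measurable_EFinP; exact: measurable_normal_pdf.
  - by move=> x _; rewrite lee_fin normal_pdf_ub.
rewrite integral_cst //= lebesgue_measure_itv /=.
case: ifPn => _; last by rewrite mule0 lee_fin mulr_ge0 ?normal_peak_ge0 // mulr_ge0.
by rewrite -EFinB -EFinM lee_fin; apply: ler_wpM2l; [exact: normal_peak_ge0|lra].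
Qed.

Lemma gaussian_interval_gt0 (a : R) : 0 < P (xi @^-1` `[a, (a + 1)%R]).
Proof.
rewrite xi_law // /normal_prob.
pose m := normal_pdf 0 s (`|a| + 1)%R.
apply: (@lt_le_trans _ _ (\int[mu]_(x in `[a, (a + 1)%R]) m%:E)).
  rewrite integral_cst //= lebesgue_measure_itv /= lte_fin ltrDl ltr01 -EFinB -EFinM lte_fin.
  rewrite addrAC subrr add0r mulr1 /m normal_pdfE // /= mulr_gt0 ?expR_gt0 //.
  exact: normal_peak_gt0.
apply: ge0_le_integral => //.
- by move=> x _; rewrite lee_fin normal_pdf_ge0.
- apply: measurable_funTS; apply/measurable_EFinP; exact: measurable_normal_pdf.
- move=> x /=; rewrite in_itv /= => /andP[ax xa]; rewrite lee_fin /m !normal_pdfE //.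
  rewrite ler_wpM2l ?normal_peak_ge0 // /normal_fun !subr0 ler_expR !mulNr lerN2.
  rewrite ler_wpM2r ?invr_ge0 ?mulrn_wge0 ?sqr_ge0 //.
  rewrite -[leLHS]real_normK ?num_real // lerXn2r ?nnegrE ?addr_ge0 //.
  rewrite ler_norml; have := ler_norm a; have := ler_norm (- a); rewrite normrN; lra.
Qed.

End Gaussian.


Section Independence.
Context d (T : measurableType d) (R : realType) (P : probability T R).
Local Open Scope ereal_scope.

(* These cylinders generate the sigma-algebra of the [X i] with [i != j]. *)
Definition off_cylinders n (X : 'I_n -> T -> R) (j : 'I_n) : set (set T) :=
  [set A | exists2 B : 'I_n -> set R, (forall i, measurable (B i)) /\ B j = setT &
     A = \bigcap_(i in [set: 'I_n]) (X i @^-1` B i)].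

Section Cylinders.
Context (n : nat) (X : 'I_n -> T -> R) (j : 'I_n).
Hypothesis mX : forall i, measurable_fun setT (X i).
Hypothesis indep : mutually_independent P X.

Let mpre i (B : set R) : measurable B -> measurable (X i @^-1` B).
Proof. by move=> mB; rewrite -[_ @^-1` _]setTI; exact: mX. Qed.

(** For fixed [D], both sides are finite measures in [A] that agree on the cylinders, a class stable
    under intersection. *)
Lemma off_cylinders_indep A D : <<s off_cylinders X j >> A -> measurable D ->
  P (A `&` X j @^-1` D) = P A * P (X j @^-1` D).
Proof.
move=> sA mD; have mE := mpre j mD; set E := X j @^-1` D in mE *.
have PE : P E = (fine (P E))%:E by rewrite fineK // fin_num_measure.
have r0 : (0 <= fine (P E))%R by rewrite fine_ge0.
pose m1 : {measure set T -> \bar R} := mrestr P mE.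
pose m2 : {measure set T -> \bar R} := mscale (NngNum r0) P.
have cylT : off_cylinders X j setT.
  exists (fun=> setT) => //; apply/seteqP; split => //.
have m1E B : m1 B = P (B `&` E) by [].
have m2E B : m2 B = P E * P B by rewrite PE.
suff : m1 A = m2 A by rewrite m1E m2E muleC.
apply: (@g_sigma_algebra_measure_unique _ _ _ (off_cylinders X j) _ (fun=> setT)) => //.
- move=> _ [B [mB _] ->]; apply: fin_bigcap_measurable => // i _; exact: mpre.
- by apply/seteqP; split => // x _; exists 0%N.
- move=> _ _ [B [mB Bj] ->] [C [mC Cj] ->]; exists (fun i => B i `&` C i).
    by split; [move=> i; exact: measurableI | rewrite Bj Cj setTI].
  apply/seteqP; split => [x [h1 h2] i _|x h].
    by split; [exact: h1|exact: h2].
  by split => i _; have [] := h i I.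
- move=> _ [B [mB Bj] ->]; rewrite m1E m2E.
  pose C i := if i == j then D else B i.
  have mC i : measurable (C i) by rewrite /C; case: ifP.
  have -> : \bigcap_(i in [set: 'I_n]) X i @^-1` B i `&` E =
      \bigcap_(i in [set: 'I_n]) X i @^-1` C i.
    apply/seteqP; split => [x [h1 h2] i _|x h].
      by rewrite /C; case: eqP => [->//|_]; exact: h1.
    split; last by have := h j I; rewrite /C eqxx.
    move=> i _; have := h i I; rewrite /C; case: eqP => [->|//].
    by rewrite Bj.
  rewrite !indep // (bigD1 j) //= [in RHS](bigD1 j) //= /C eqxx Bj preimage_setT.
  rewrite probability_setT mul1e; congr (_ * _).
  by apply: eq_bigr => i /negbTE ->.
- by move=> k; rewrite /m1 /mrestr /= (le_lt_trans (probability_le1 _ _)) ?ltry // setTI.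
Qed.

Lemma off_cylinders_measurable i : i != j ->
  @measurable_fun _ _ (g_sigma_algebraType (off_cylinders X j)) R setT (X i).
Proof.
move=> ij _ B mB; rewrite setTI; apply: sub_sigma_algebra.
exists (fun k => if k == i then B else setT).
  by split; [move=> k; case: ifP|rewrite eq_sym (negbTE ij)].
apply/seteqP; split => [x h k _|x h]; last by have := h i I; rewrite eqxx.
by case: eqP => [->|].
Qed.

Lemma off_cylinders_sub (f : T -> R) :
  @measurable_fun _ _ (g_sigma_algebraType (off_cylinders X j)) R setT f ->
  measurable_fun setT f.
Proof.
move=> mf _ B mB; have := mf measurableT B mB; apply: smallest_sub.
  exact: sigma_algebra_measurable.
move=> _ [C [mC _] ->]; apply: fin_bigcap_measurable => // i _; exact: mpre.
Qed.

End Cylinders.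

Section Pair.
Context (X xi : {RV P >-> R}).
Hypothesis indep : forall A B : set R, measurable A -> measurable B ->
  P (X @^-1` A `&` xi @^-1` B) = P (X @^-1` A) * P (xi @^-1` B).

Let pair : T -> R * R := fun om => (X om, xi om).
Let mpair : measurable_fun setT pair.
Proof. exact: measurable_fun_pair. Qed.
Let pairRV : {RV P >-> (R * R)%type} := HB.pack pair (isMeasurableFun.Build _ _ _ _ _ mpair).

Let joint (S : set (R * R)) : measurable S ->
  (distribution P X \x distribution P xi) S = P (pair @^-1` S).
Proof.
move=> mS; have := @product_measure_unique _ _ R R R (distribution P X) (distribution P xi)
  (distribution P pairRV).
by apply => // A B mA mB; exact: indep.
Qed.

Lemma indep_integral (f g : R -> \bar R) : measurable_fun setT f -> measurable_fun setT g ->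
  (forall x, 0 <= f x) -> (forall x, 0 <= g x) ->
  \int[P]_om (f (X om) * g (xi om)) = (\int[P]_om f (X om)) * (\int[P]_om g (xi om)).
Proof.
move=> mf mg f0 g0.
pose F (z : R * R) := f z.1 * g z.2.
have mF : measurable_fun setT F.
  by apply: emeasurable_funM; apply: measurableT_comp.
have F0 z : 0 <= F z by rewrite mule_ge0.
have Ig0 : 0 <= \int[P]_om g (xi om) by apply: integral_ge0.
transitivity (\int[distribution P pairRV]_z F z).
  by rewrite (ge0_integral_distribution pairRV mF F0).
transitivity (\int[distribution P X \x distribution P xi]_z F z).
  by apply: eq_measure_integral => S mS _; exact: (esym (joint mS)).
rewrite fubini_tonelli1 //.
rewrite -(ge0_integral_distribution X mf f0) -ge0_integralZr //; last first.
apply: eq_integral => x _; rewrite /fubini_F /F /=.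
rewrite ge0_integralZl //.
by rewrite -(ge0_integral_distribution xi mg g0).
Qed.

(** By independence, the products of [X] with the positive and negative parts of [xi] have the same
    finite mean. [X] is rewritten as [max X 0] because [indep_integral] takes functions that are
    nonnegative on the whole line. *)
Lemma indep_mean0 c : (forall om, 0 <= X om <= c)%R ->
  \int[P]_om (Num.max (xi om) 0)%:E = \int[P]_om (Num.max (- xi om) 0)%:E ->
  \int[P]_om (Num.max (xi om) 0)%:E < +oo ->
  P.-integrable setT (fun om => (X om * xi om)%:E) /\ \int[P]_om (X om * xi om)%:E = 0.
Proof.
move=> Xc eqn fin.
have mp : measurable_fun setT (fun x : R => (Num.max x 0)%:E).
  by apply/measurable_EFinP; apply: measurable_maxr => //; exact: measurable_id.
have mn : measurable_fun setT (fun x : R => (Num.max (- x) 0)%:E).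
  by apply/measurable_EFinP; apply: measurable_maxr => //; exact: oppr_measurable.
have mX : measurable_fun setT (fun x : R => (Num.max x 0)%:E) by [].
have max0 (x : R) : 0 <= (Num.max x 0)%:E by rewrite lee_fin le_max lexx orbT.
have Ep := indep_integral mX mp max0 max0.
have En := indep_integral mX mn max0 (fun x => max0 (- x)%R).
have XE om : Num.max (X om) 0%R = X om by apply/max_idPl; case/andP: (Xc om).
have EX : \int[P]_om (Num.max (X om) 0)%:E < +oo.
  apply: (@le_lt_trans _ _ (\int[P]_om c%:E)); last first.
    by rewrite integral_cst //= probability_setT mule1 ltry.
  apply: ge0_le_integral => //.
  - by apply: (measurableT_comp mX).
  - by move=> om _; rewrite lee_fin XE; case/andP: (Xc om).
have lt (a b : \bar R) : 0 <= a -> 0 <= b -> a < +oo -> b < +oo -> a * b < +oo.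
  by move=> a0 b0 aoo boo; apply: lte_mul_pinfty => //; rewrite ge0_fin_numE.
have ip : P.-integrable setT (fun om => (X om)%:E * (Num.max (xi om) 0)%:E).
  apply/integrableP; split.
    by apply: emeasurable_funM; [exact/measurable_EFinP|apply: (measurableT_comp mp)].
  rewrite (eq_integral (fun om => (Num.max (X om) 0)%:E * (Num.max (xi om) 0)%:E)).
    by rewrite Ep; apply: lt => //; apply: integral_ge0.
  by move=> om _; rewrite -{1}XE gee0_abs // mule_ge0.
have im : P.-integrable setT (fun om => (X om)%:E * (Num.max (- xi om) 0)%:E).
  apply/integrableP; split.
    apply: emeasurable_funM; first exact/measurable_EFinP.
    by apply: (measurableT_comp mn).
  rewrite (eq_integral (fun om => (Num.max (X om) 0)%:E * (Num.max (- xi om) 0)%:E)).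
    by rewrite En -eqn; apply: lt => //; apply: integral_ge0.
  by move=> om _; rewrite -{1}XE gee0_abs // mule_ge0.
have E om : (X om * xi om)%:E =
    (X om)%:E * (Num.max (xi om) 0)%:E - (X om)%:E * (Num.max (- xi om) 0)%:E.
  rewrite -!EFinM -EFinB -mulrBr; congr (_ * _)%:E.
  by case: (leP (xi om) 0%R) => h; case: (leP (- xi om)%R 0%R) => h'; lra.
split.
  by apply: eq_integrable (integrableB _ ip im) => // om _; rewrite E.
under eq_integral do rewrite E.
rewrite integralB //.
have -> : \int[P]_om ((X om)%:E * (Num.max (xi om) 0)%:E) =
   \int[P]_om ((X om)%:E * (Num.max (- xi om) 0)%:E).
  transitivity (\int[P]_om ((Num.max (X om) 0)%:E * (Num.max (xi om) 0)%:E)).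
    by apply: eq_integral => om _; rewrite XE.
  rewrite Ep eqn -En.
  by apply: eq_integral => om _; rewrite XE.
by rewrite subee // integrable_fin_num.
Qed.

(** The joint law is a product, so the bound follows by fixing the value of [X]: a Gaussian density
    is at most its peak, and the admissible interval has length [2 e]. *)
Lemma indep_gaussian_small (s kappa e : R) : (0 < s)%R -> (0 <= e)%R ->
  (forall B : set R, measurable B -> P (xi @^-1` B) = normal_prob 0 s B) ->
  P [set om | (`|X om + xi om - kappa| <= e)%R] <= (normal_peak s * (2 * e))%:E.
Proof.
move=> s0 e0 law.
pose S : set (R * R) := [set z | (`|z.1 + z.2 - kappa| <= e)%R].
have mS : measurable S.
  have mf : measurable_fun setT (fun z : R * R => `|z.1 + z.2 - kappa|%R).
    apply: measurableT_comp => //; apply: measurable_funB => //.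
    exact: measurable_funD.
  have := mf measurableT `]-oo, e]%classic (measurable_itv _); rewrite setTI.
  by congr (measurable _); apply/seteqP; split => z; rewrite /S /= in_itv.
have -> : [set om | (`|X om + xi om - kappa| <= e)%R] = pair @^-1` S by [].
rewrite -joint //.
apply: (@le_trans _ _ (\int[distribution P X]_x (normal_peak s * (2 * e))%:E)); last first.
  by rewrite integral_cst //= probability_setT mule1.
apply: ge0_le_integral => //.
- by apply: measurable_fun_xsection.
- move=> x _.
  have := gaussian_small s0 law (kappa - x)%R e0; congr (_ <= _).
  rewrite /distribution /pushforward /=; congr (P _).
  apply/seteqP; split => om /=; rewrite in_itv /= /xsection /= inE /S /=.
    by move=> /andP[h1 h2]; rewrite ler_norml; lra.
  by rewrite ler_norml => /andP[h1 h2]; apply/andP; split; lra.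
Qed.

End Pair.

End Independence.


(** * The discretized martingale *)

Section MeasurableRun.
Context (R : realType).

Lemma measurable_fun_nat_case d d' (T1 : measurableType d) (T2 : measurableType d')
    (p : T1 -> nat) (f : nat -> T1 -> T2) :
  measurable_fun setT p -> (forall j, measurable_fun setT (f j)) ->
  measurable_fun setT (fun x => f (p x) x).
Proof.
move=> mp mf _ B mB; rewrite setTI.
have -> : (fun x => f (p x) x) @^-1` B = \bigcup_j (p @^-1` [set j] `&` f j @^-1` B).
  apply/seteqP; split => [x h|x [j _ [/= pj h]]]; first by exists (p x).
  by rewrite /= pj.
apply: bigcupT_measurable => j; apply: measurableI.
  by rewrite -[_ @^-1` _]setTI; apply: mp.
by rewrite -[_ @^-1` _]setTI; apply: mf.
Qed.

Lemma measurable_picdf n : measurable_fun setT (@picdf R n).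
Proof. by apply: nondecreasing_measurable => // x y; exact: picdf_ndecr. Qed.

Lemma measurable_pcdf n : measurable_fun setT (@pcdf R n).
Proof.
case: n => [|n]; last by apply: nondecreasing_measurable => // x y; exact: pcdf_ndecr.
rewrite (_ : @pcdf R 0 = cst 0); first exact: measurable_cst.
by apply/funext => x; rewrite /pcdf /hypo_cdf big_geq.
Qed.

Context d (T : measurableType d) (h a : R) (n : nat).

Let mifle d' (T2 : measurableType d') (x y : T -> R) (f g : T -> T2) :
  measurable_fun setT x -> measurable_fun setT y ->
  measurable_fun setT f -> measurable_fun setT g ->
  measurable_fun setT (fun om => if x om <= y om then f om else g om).
Proof. by move=> mx my mf mg; apply: measurable_fun_ifT => //; exact: measurable_fun_ler. Qed.

Lemma measurable_step (p : T -> nat) (e z x : T -> R) :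
  measurable_fun setT p -> measurable_fun setT e -> measurable_fun setT z ->
  measurable_fun setT x ->
  [/\ measurable_fun setT (fun om => (step h (p om, e om, z om) (x om)).1.1),
      measurable_fun setT (fun om => (step h (p om, e om, z om) (x om)).1.2) &
      measurable_fun setT (fun om => (step h (p om, e om, z om) (x om)).2)].
Proof.
move=> mp me mz mx.
have meh : measurable_fun setT (fun om => e om - h) by exact: measurable_funB.
have meh' : measurable_fun setT (fun om => e om + h) by exact: measurable_funD.
have mM : measurable_fun setT (fun om => Num.max (e om) (x om)) by exact: measurable_maxr.
have mm : measurable_fun setT (fun om => Num.min (e om) (x om)) by exact: measurable_minr.
split.
- apply: (@measurable_fun_nat_case _ _ _ _ p
    (fun j om => (step h (j, e om, z om) (x om)).1.1)) => // j.
  have [->|j0] := eqVneq j 0%N; first exact: measurable_cst.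
  have [oj|oj] := boolP (odd j).
    rewrite (_ : (fun om => _) = fun om => if x om <= e om - h then j.-1 else j).
      by apply: mifle => //; exact: measurable_cst.
    by apply/funext => om; rewrite /= (negbTE j0) oj; case: ifP.
  rewrite (_ : (fun om => _) = fun om => if e om + h <= x om then j.-1 else j).
    by apply: mifle => //; exact: measurable_cst.
  by apply/funext => om; rewrite /= (negbTE j0) (negbTE oj); case: ifP.
- apply: (@measurable_fun_nat_case _ _ _ _ p
    (fun j om => (step h (j, e om, z om) (x om)).1.2)) => // j.
  have [->|j0] := eqVneq j 0%N; first exact: me.
  have [oj|oj] := boolP (odd j).
    rewrite (_ : (fun om => _) =
        fun om => if x om <= e om - h then x om else Num.max (e om) (x om)).
      by apply: mifle.
    by apply/funext => om; rewrite /= (negbTE j0) oj; case: ifP.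
  rewrite (_ : (fun om => _) = fun om => if e om + h <= x om then x om else Num.min (e om) (x om)).
    by apply: mifle.
  by apply/funext => om; rewrite /= (negbTE j0) (negbTE oj); case: ifP.
- apply: (@measurable_fun_nat_case _ _ _ _ p
    (fun j om => (step h (j, e om, z om) (x om)).2)) => // j.
  have [->|j0] := eqVneq j 0%N; first exact: mz.
  have [oj|oj] := boolP (odd j).
    rewrite (_ : (fun om => _) = fun om => if x om <= e om - h then z om else
        z om + (uphalf j)%:R / h * (Num.max (e om) (x om) - e om)).
      apply: mifle => //; apply: measurable_funD => //; apply: measurable_funM => //.
      exact: measurable_funB.
    by apply/funext => om; rewrite /= (negbTE j0) oj; case: ifP.
  rewrite (_ : (fun om => _) = fun om => if e om + h <= x om then
      z om + (uphalf j)%:R / h * (x om - e om - h) else z om).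
    apply: mifle => //; apply: measurable_funD => //; apply: measurable_funM => //.
    by apply: measurable_funB => //; exact: measurable_funB.
  by apply/funext => om; rewrite /= (negbTE j0) (negbTE oj); case: ifP.
Qed.

Lemma measurable_run (w : T -> nat -> R) k :
  (forall i, (i <= k)%N -> measurable_fun setT (w ^~ i)) ->
  [/\ measurable_fun setT (fun om => (run h n (w om) k).1.1),
      measurable_fun setT (fun om => (run h n (w om) k).1.2) &
      measurable_fun setT (fun om => (run h n (w om) k).2)].
Proof.
elim: k => [|k IH] mw.
  by split; [exact: measurable_cst | exact: mw | exact: measurable_cst].
have [m1 m2 m3] := IH (fun i ik => mw i (leqW ik)).
have [s1 s2 s3] := measurable_step m1 m2 m3 (mw k.+1 (leqnn _)).
have E om : (((run h n (w om) k).1.1, (run h n (w om) k).1.2), (run h n (w om) k).2) =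
  run h n (w om) k by case: (run h n (w om) k) => [[]].
split.
- by move: s1; under eq_fun do rewrite E.
- by move: s2; under eq_fun do rewrite E.
- by move: s3; under eq_fun do rewrite E.
Qed.

Lemma measurable_slope_run (w : T -> nat -> R) k :
  (forall i, (i <= k)%N -> measurable_fun setT (w ^~ i)) ->
  measurable_fun setT (fun om => slope h a (run h n (w om) k)).
Proof.
move=> mw; have [m1 m2 m3] := measurable_run mw.
apply: (@measurable_fun_nat_case _ _ _ _ (fun om => (run h n (w om) k).1.1)
  (fun j om => if odd j then - ((uphalf j)%:R / h * pcdf (uphalf j) (a - (run h n (w om) k).2))
     else 0)) => // j.
case: (odd j); last exact: measurable_cst.
apply: measurableT_comp => //.
apply: measurable_funM => //; apply: (measurableT_comp (measurable_pcdf _)).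
exact: measurable_funB.
Qed.

Lemma measurable_value_run (w : T -> nat -> R) k :
  (forall i, (i <= k)%N -> measurable_fun setT (w ^~ i)) ->
  measurable_fun setT (fun om => value h a (run h n (w om) k) (w om k)).
Proof.
move=> mw; have [m1 m2 m3] := measurable_run mw.
apply: (@measurable_fun_nat_case _ _ _ _ (fun om => (run h n (w om) k).1.1)
  (fun j om => picdf (uphalf j) (a - (run h n (w om) k).2) + if odd j then
     ((uphalf j)%:R / h * pcdf (uphalf j) (a - (run h n (w om) k).2)
       * ((run h n (w om) k).1.2 - w om k)) else 0)) => // j.
have maz : measurable_fun setT (fun om => a - (run h n (w om) k).2).
  exact: measurable_funB.
apply: measurable_funD; first exact: (measurableT_comp (measurable_picdf _)).
case: (odd j); last exact: measurable_cst.
apply: measurable_funM.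
  by apply: measurable_funM => //; exact: (measurableT_comp (measurable_pcdf _)).
by apply: measurable_funB => //; exact: mw.
Qed.

End MeasurableRun.

Section ExpectedValue.
Context d (T : measurableType d) (R : realType) (P : probability T R).
Context (W : R -> {RV P >-> R}) (sigma h : R) (n : nat).
Hypothesis sigma_gt0 : 0 < sigma.
Hypothesis h_gt0 : 0 < h.
Hypothesis incr : independent_increments W.
Hypothesis gauss : gaussian_increments sigma W.

Definition walk (u : R) (om : T) (k : nat) : R := W (k%:R * u) om - W 0 om.

(* [slope] at time [k] only depends on the increments before [k], so that the discrete
   stochastic integral of [slope] has mean [0]. *)
Lemma expected_value_error (a C B u eps : R) (N : nat) :
  (forall r y, (r < n)%N -> y <= a -> pcdf r.+1 y <= C) ->
  (forall r y, (r <= n)%N -> y <= a -> picdf r y <= B) ->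
  0 <= C -> 0 < u -> 0 < eps ->
  (`| \int[P]_om (value h a (run h n (walk u om) N) (walk u om N))%:E - (picdf n a)%:E | <=
   (n%:R / h * (2 * C * n.*2%:R) *
    (eps + N%:R * (64 * Num.sqrt 2 * (sigma * Num.sqrt u) ^+ 4) / eps ^+ 3))%:E)%E.
Proof.
move=> hC hB C0 u0 eps0.
pose s i : R := i%:R * u.
have s0 : s 0%N = 0 by rewrite /s mul0r.
have ss i : s i < s i.+1 by rewrite ltr_pM2r // ltr_nat.
pose X (i : 'I_N) om := W (s i.+1) om - W (s i) om.
have mX i : measurable_fun setT (X i) by apply: measurable_funB.
have indep : mutually_independent P X.
  by apply: incr => [|i _]; [rewrite s0|exact: ss].
have mwalk k : measurable_fun setT (fun om => walk u om k) by apply: measurable_funB.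
have wE k (kN : (k < N)%N) om : walk u om k.+1 - walk u om k = X (Ordinal kN) om.
  by rewrite /walk /X /s /=; ring.
have lawX (i : 'I_N) (D : set R) : measurable D ->
    P (X i @^-1` D) = normal_prob 0 (sigma * Num.sqrt u) D.
  move=> mD; have si0 : 0 <= s i by rewrite mulr_ge0 // ltW.
  have := gauss si0 (ss i) mD.
  by have -> : s i.+1 - s i = u by rewrite /s -natr1; ring.
have su0 : 0 < sigma * Num.sqrt u by rewrite mulr_gt0 // sqrtr_gt0.
pose xi i : {RV P >-> R} := mfun_Sub (mem_set (mX i)).
have lawxi i (D : set R) : measurable D ->
    P (xi i @^-1` D) = normal_prob 0 (sigma * Num.sqrt u) D by exact: lawX.
have fourth i := gaussian_fourth su0 (lawxi i).
have posneg i := gaussian_posneg su0 (lawxi i).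
(* Finiteness comes from [max x 0 <= 1 + x^4] and the fourth moment. *)
have posfin i : (\int[P]_om (Num.max (xi i om) 0)%:E < +oo)%E.
  apply: (@le_lt_trans _ _ (\int[P]_om (1 + (xi i om) ^+ 4)%:E)%E).
    apply: ge0_le_integral => //.
    - by move=> om _; rewrite lee_fin le_max lexx orbT.
    - by apply/measurable_EFinP; exact: measurable_maxr.
    - by apply/measurable_EFinP; apply: measurable_funD => //; exact: measurable_funX.
    - move=> om _; rewrite lee_fin ge_max; move: (xi i om) => x.
      have x4 : 0 <= x ^+ 4 by rewrite exprn_even_ge0.
      rewrite addr_ge0 // andbT; have [x1|x1] := leP x 1; first by rewrite (le_trans x1) // lerDl.
      by rewrite ler_wpDl // -[leLHS]expr1; apply: ler_weXn2l => //; exact: ltW.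
  under eq_integral do rewrite EFinD.
  rewrite ge0_integralD //.
  - rewrite integral_cst //= probability_setT mule1 lte_add_pinfty ?ltry //.
    exact: le_lt_trans (fourth i) (ltry _).
  - by move=> om _; rewrite lee_fin exprn_even_ge0.
  - by apply/measurable_EFinP; exact: measurable_funX.
pose Y om := value h a (run h n (walk u om) N) (walk u om N).
have mY : measurable_fun setT Y by apply: measurable_value_run => i _; exact: mwalk.
have vr om k := valid_run h_gt0 n (walk u om) k.
have Yb om : 0 <= Y om <= B + n%:R * C := value_bound h_gt0 hC hB (vr om N) C0.
have bint (f : T -> R) c : measurable_fun setT f -> (forall om, `|f om| <= c) ->
    P.-integrable setT (EFin \o f).
  move=> mf fc; apply/integrableP; split; first exact/measurable_EFinP.
  apply: (@le_lt_trans _ _ (\int[P]_om c%:E)%E).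
    apply: ge0_le_integral => //.
    - by apply: measurableT_comp => //; exact/measurable_EFinP.
    - by move=> om _; rewrite /= lee_fin.
  by rewrite integral_cst //= probability_setT mule1 ltry.
have iY : P.-integrable setT (EFin \o Y).
  by apply: (bint _ (B + n%:R * C)) => // om; rewrite ger0_norm; case/andP: (Yb om).
pose H (k : 'I_N) om := slope h a (run h n (walk u om) k).
have Hle0 k om : 0 <= - H k om <= n%:R / h * C.
  have := slope_bound h_gt0 hC (vr om k) C0; rewrite -/(H k om) => Hb.
  have H0 : H k om <= 0.
    rewrite /H /slope; case: ifP => // po; rewrite oppr_le0 mulr_ge0 //.
      by rewrite divr_ge0 // ltW.
    by case: (run _ _ _ _).1.1 po => // m _; exact: pcdf_ge0.
  by rewrite oppr_ge0 H0 -ler0_norm.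
have HX (k : 'I_N) : P.-integrable setT (fun om => (- H k om * X k om)%:E) /\
    (\int[P]_om (- H k om * X k om)%:E = 0)%E.
  (* Up to time [k] the walk is a sum of increments of index less than [k], hence measurable for the
     cylinders that avoid [X k]. *)
  have mwk i : (i <= k)%N -> @measurable_fun _ _ (g_sigma_algebraType (off_cylinders X k)) R
      setT (fun om => walk u om i).
    elim: i => [|i IH] ik.
      rewrite (_ : (fun om => _) = cst 0); first exact: measurable_cst.
      by apply/funext => om; rewrite /walk mul0r subrr.
    have iN : (i < N)%N by exact: ltn_trans ik (ltn_ord k).
    rewrite (_ : (fun om => _) = (fun om => walk u om i + X (Ordinal iN) om)); last first.
      by apply/funext => om; rewrite -wE addrC subrK.
    apply: measurable_funD; first exact: IH (ltnW ik).
    by apply: off_cylinders_measurable; rewrite -val_eqE /= neq_ltn ik.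
  have mH : @measurable_fun _ _ (g_sigma_algebraType (off_cylinders X k)) R setT
      (fun om => - H k om).
    by apply: measurableT_comp => //; apply: measurable_slope_run; exact: mwk.
  have mH' := off_cylinders_sub mX mH.
  pose HH : {RV P >-> R} := mfun_Sub (mem_set mH').
  apply: (@indep_mean0 _ _ _ _ HH (xi k) _ (n%:R / h * C)).
  - move=> A D mA mD; apply: (off_cylinders_indep mX indep) => //.
    by have := mH measurableT A mA; rewrite setTI.
  - exact: Hle0.
  - exact: posneg.
  - exact: posfin.
pose S om := \sum_(k < N) (- H k om * X k om).
have iS : P.-integrable setT (EFin \o S).
  rewrite (_ : EFin \o S = fun om => (\sum_(k < N) (- H k om * X k om)%:E)%E).
    by apply: integrable_sum => // k _; case: (HX k).
  by apply/funext => om; rewrite /S /= sumEFin.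
have S0 : (\int[P]_om (S om)%:E = 0)%E.
  under eq_integral do rewrite /S -sumEFin.
  rewrite integral_sum //; last by move=> k; case: (HX k).
  by rewrite big1 // => k _; case: (HX k).
have iYG : P.-integrable setT (EFin \o (fun om => Y om - picdf n a)).
  apply: (eq_integrable _ (EFin \o Y \- cst (picdf n a)%:E)%E) => //.
  by apply: integrableB => //; exact: finite_measure_integrable_cst.
(* [S] is minus the discrete stochastic integral. Having mean zero, it may be inserted, and the
   integrand becomes the error bounded by [value_run_error]. *)
have -> : (\int[P]_om (Y om)%:E - (picdf n a)%:E = \int[P]_om (Y om - picdf n a + S om)%:E)%E.
  under [RHS]eq_integral do rewrite EFinD.
  rewrite integralD // S0 adde0.
  under [RHS]eq_integral do rewrite EFinB.
  rewrite integralB //; last exact: finite_measure_integrable_cst.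
  by rewrite integral_cst //= probability_setT mule1.
set K := n%:R / h * _.
have K0 : 0 <= K by rewrite mulr_ge0 ?divr_ge0 ?mulr_ge0 // ltW.
have mX4 : measurable_fun setT (fun om => \sum_(k < N) (X k om) ^+ 4).
  by apply: measurable_sum => k; exact: measurable_funX.
apply: le_trans (le_abse_integral _ _ _) _ => //.
  by apply/measurable_EFinP; apply: measurable_funD;
    [apply: measurable_funB | apply/measurable_EFinP; case/integrableP: iS].
apply: (@le_trans _ _ (\int[P]_om (K * eps + K / eps ^+ 3 * \sum_(k < N) (X k om) ^+ 4)%:E)%E).
  apply: ge0_le_integral => //.
  - apply: measurableT_comp => //; apply/measurable_EFinP; apply: measurable_funD.
      exact: measurable_funB.
    by apply/measurable_EFinP; case/integrableP: iS.
  - by apply/measurable_EFinP; apply: measurable_funD => //; exact: measurable_funM.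
  move=> om _; rewrite /= lee_fin.
  have := value_run_error h_gt0 hC (walk u om) N C0 eps0.
  have -> : \sum_(k < N) slope h a (run h n (walk u om) k)
      * (walk u om k.+1 - walk u om k) = - S om.
    rewrite /S -sumrN; apply: eq_bigr => k _; rewrite (wE _ (ltn_ord k)) mulNr opprK.
    by congr (_ * X _ _); exact: val_inj.
  have -> : \sum_(k < N) (walk u om k.+1 - walk u om k) ^+ 4 = \sum_(k < N) X k om ^+ 4.
    apply: eq_bigr => k _; rewrite (wE _ (ltn_ord k)).
    by congr (X _ _ ^+ _); exact: val_inj.
  rewrite opprK => h1; apply: (le_trans h1); rewrite -/K mulrDr lerD2l.
  by rewrite mulrA mulrAC.
under eq_integral do rewrite EFinD.
rewrite ge0_integralD //; last 3 first.
- by move=> om _; rewrite lee_fin mulr_ge0 // ltW.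
- move=> om _; rewrite lee_fin mulr_ge0 //; first by rewrite divr_ge0 ?exprn_ge0 ?(ltW eps0).
  by rewrite sumr_ge0 // => k _; rewrite exprn_even_ge0.
- by apply/measurable_EFinP; exact: measurable_funM.
under [X in (_ + X <= _)%E]eq_integral do rewrite EFinM.
rewrite integral_cst //= probability_setT mule1 ge0_integralZl //; last 3 first.
- exact/measurable_EFinP.
- by move=> om _; rewrite lee_fin sumr_ge0 // => k _; rewrite exprn_even_ge0.
- by rewrite lee_fin divr_ge0 ?exprn_ge0 // ltW.
under eq_integral do rewrite -sumEFin.
rewrite ge0_integral_sum //; last 2 first.
- by move=> k; apply/measurable_EFinP; exact: measurable_funX.
- by move=> k om _; rewrite lee_fin exprn_even_ge0.
rewrite mulrDr EFinD leeD2l //.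
have -> : K * (N%:R * (64 * Num.sqrt 2 * (sigma * Num.sqrt u) ^+ 4) / eps ^+ 3) =
   K / eps ^+ 3 * (\sum_(k < N) (64 * Num.sqrt 2 * (sigma * Num.sqrt u) ^+ 4)).
  by rewrite sumr_const card_ord -[_ *+ N]mulr_natl; ring.
rewrite [leRHS]EFinM lee_wpmul2l ?lee_fin ?divr_ge0 ?exprn_ge0 ?(ltW eps0) //.
by rewrite -sumEFin lee_sum // => k _; exact: fourth.
Qed.

End ExpectedValue.


(** * Almost sure properties of the paths *)

Fixpoint running_min (R : realType) (f : nat -> R) (k : nat) : R :=
  if k is k'.+1 then Num.min (running_min f k') (f k) else f 0%N.

Section RunningMin.
Context (R : realType).
Implicit Types (f g : nat -> R).

Lemma running_min_le f k i : (i <= k)%N -> running_min f k <= f i.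
Proof.
elim: k => [|k IH]; first by rewrite leqn0 => /eqP ->.
rewrite leq_eqVlt => /orP[/eqP ->|ik] /=; first by rewrite ge_min lexx orbT.
by rewrite ge_min IH.
Qed.

Lemma le_running_min f k c : (forall i, (i <= k)%N -> c <= f i) -> c <= running_min f k.
Proof.
elim: k => [|k IH] cf /=; first exact: cf.
by rewrite le_min IH ?cf // => i ik; apply: cf; exact: leqW.
Qed.

Lemma running_minD f c k : running_min (fun i => f i + c) k = running_min f k + c.
Proof. by elim: k => [//|k IH] /=; rewrite IH addr_minl. Qed.

Lemma eq_running_min f g k : (forall i, (i <= k)%N -> f i = g i) ->
  running_min f k = running_min g k.
Proof.
elim: k => [|k IH] fg /=; first exact: fg.
by rewrite IH ?fg // => i ik; apply: fg; exact: leqW.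
Qed.

Lemma measurable_running_min d (T : measurableType d) (f : T -> nat -> R) k :
  (forall i, (i <= k)%N -> measurable_fun setT (f ^~ i)) ->
  measurable_fun setT (fun om => running_min (f om) k).
Proof.
elim: k => [|k IH] mf /=; first exact: mf.
by apply: measurable_minr; [apply: IH => i ik; apply: mf; exact: leqW|exact: mf].
Qed.

End RunningMin.

Section RationalGaps.
Context (R : realType).
Implicit Types (w : R -> R) (a b c d : R).

(** The gap for minima over two fixed intervals; with rational endpoints only countably many such
    events have to be excluded. *)
Definition extrema_gap w (s1 s2 kappa a b c d : R) : Prop := exists x y,
  [/\ a <= x <= b, c <= y <= d, forall z, a <= z <= b -> s1 * w x <= s1 * w z,
      forall z, c <= z <= d -> s2 * w y <= s2 * w z & w y - w x = kappa].

Lemma rat_gap_free w s1 s2 kappa :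
  (forall qa qb qc qd : rat, 0 <= ratr qa :> R -> ratr qa < ratr qb :> R ->
     ratr qb < ratr qc :> R -> ratr qc < ratr qd :> R ->
     ~ extrema_gap w s1 s2 kappa (ratr qa) (ratr qb) (ratr qc) (ratr qd)) ->
  gap_free w s1 s2 kappa.
Proof.
move=> H x1 x x2 y1 y y2 x10 x1x x1lt xx2 xy y1y yy2 minx miny.
apply/eqP => E.
(* If [x = 0] there is no room on the left, and the rational 0 itself is the left endpoint. *)
have [qa /andP[a1 a2] a0] : exists2 qa : rat, x1 <= ratr qa <= x & 0 <= ratr qa :> R.
  case: x1lt => [lt|x0].
    have [q] := rat_in_itvoo lt; rewrite in_itv /= => /andP[h1 h2].
    by exists q; rewrite ?(ltW h1) ?(ltW h2) // (le_trans x10) // ltW.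
  exists 0; rewrite rmorph0 // x0 lexx andbT.
  by rewrite -x0.
have mx : x < Num.min x2 ((x + y) / 2) by rewrite lt_min xx2 midf_lt.
have my : Num.max y1 ((x + y) / 2) < y by rewrite gt_max y1y midf_lt.
have [qb] := rat_in_itvoo mx; rewrite in_itv /= lt_min => /and3P[b1 b2 b3].
have [qc] := rat_in_itvoo my; rewrite in_itv /= gt_max => /andP[/andP[c1 c2] c3].
have [qd] := rat_in_itvoo yy2; rewrite in_itv /= => /andP[d1 d2].
apply: (H qa qb qc qd) => //.
- exact: le_lt_trans b1.
- exact: lt_trans c2.
- exact: lt_trans d1.
exists x, y; split => //.
- by rewrite a2 ltW.
- by rewrite !ltW.
- move=> z /andP[z1 z2]; apply: minx; rewrite (le_trans a1) //=.
  by rewrite (le_trans z2) // ltW.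
- move=> z /andP[z1 z2]; apply: miny; rewrite (le_trans (ltW c1)) //=.
  by rewrite (le_trans z2) // ltW.
Qed.

(** Grid minima are measurable in the sample point and, by continuity, approach the true minimum:
    some grid point lies within one mesh of [x]. *)
Lemma running_min_cvg w a b x (s e : R) : path_continuous w -> 0 <= a -> a < b ->
  a <= x <= b -> (forall z, a <= z <= b -> s * w x <= s * w z) -> 0 < e ->
  exists M, forall m, (M <= m)%N ->
    `|running_min (fun i => s * w (a + (b - a) * (i%:R / m.+1%:R))) m.+1 - s * w x| <= e.
Proof.
move=> cw a0 ab /andP[ax xb] minx e0.
have x0 : 0 <= x by exact: le_trans ax.
pose e' := e / (`|s| + 1).
have s0 : 0 < `|s| + 1 by rewrite ltr_wpDl.
have e'0 : 0 < e' by rewrite divr_gt0.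
have [d d0 Hd] := path_continuous_eps cw x0 e'0.
have ba0 : 0 < b - a by rewrite subr_gt0.
exists (Num.truncn ((b - a) / d)) => m Mm.
have m0 : 0 < m.+1%:R :> R by rewrite ltr0n.
have mesh : (b - a) / m.+1%:R < d.
  rewrite ltr_pdivrMr // mulrC -ltr_pdivrMr //.
  by apply: lt_le_trans (truncnS_gt _) _; rewrite ler_nat ltnS.
pose g i : R := a + (b - a) * (i%:R / m.+1%:R).
have gin i : (i <= m.+1)%N -> a <= g i <= b.
  move=> im; rewrite /g lerDl mulr_ge0 ?(ltW ba0) ?divr_ge0 //=.
  rewrite -lerBrDl ger_pMr // ler_pdivrMr // mul1r ler_nat //.
have low : s * w x <= running_min (fun i => s * w (g i)) m.+1.
  by apply: le_running_min => i im; apply: minx; exact: gin.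
rewrite ger0_norm ?subr_ge0 //.
have q0 : 0 <= (x - a) / (b - a) * m.+1%:R.
  by rewrite mulr_ge0 // divr_ge0 ?subr_ge0 // ltW.
have /andP[j1 j2] := truncn_itv q0.
set j := Num.truncn _ in j1 j2.
have jm : (j <= m.+1)%N.
  rewrite -(ler_nat R); apply: (le_trans j1); rewrite ger_pMl // ler_pdivrMr // mul1r.
  by rewrite lerD2r.
have gj : `|g j - x| < d.
  apply: le_lt_trans mesh.
  have -> : g j - x = (b - a) / m.+1%:R * (j%:R - (x - a) / (b - a) * m.+1%:R).
    by rewrite /g; field; rewrite gt_eqF //= gt_eqF.
  rewrite normrM ger0_norm; last by rewrite divr_ge0 // ltW.
  rewrite ler_piMr //; first by rewrite divr_ge0 // ltW.
  by rewrite ler_norml; move: j1 j2; rewrite -natr1; lra.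
have gj0 : 0 <= g j by have /andP[h _] := gin j jm; exact: le_trans h.
have := Hd _ gj0 gj => wj.
rewrite lerBlDr (le_trans (running_min_le (fun i => s * w (g i)) jm)) //.
rewrite -lerBlDr -mulrBr (le_trans (ler_norm _)) // normrM.
apply: (@le_trans _ _ (`|s| * e')); first by rewrite ler_wpM2l // ltW.
have -> : e = (`|s| + 1) * e' by rewrite /e' mulrC divfK // gt_eqF.
by rewrite ler_wpM2r ?(ltW e'0) // lerDl.
Qed.

End RationalGaps.

Section AlmostSure.
Context d (T : measurableType d) (R : realType) (P : probability T R).
Context (W : R -> {RV P >-> R}) (sigma : R).
Hypothesis sigma_gt0 : 0 < sigma.
Hypothesis incr : independent_increments W.
Hypothesis gauss : gaussian_increments sigma W.

Lemma negligible_le (N : set T) :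
  (forall e, 0 < e -> exists2 A, measurable A /\ N `<=` A & (P A <= e%:E)%E) ->
  P.-negligible N.
Proof.
move=> H; have /choice[A HA] : forall k : nat, exists A,
    [/\ measurable A, N `<=` A & (P A <= (k.+1%:R^-1)%:E)%E].
  by move=> k; have [|A [mA NA] PA] := H (k.+1%:R^-1); [rewrite invr_gt0|exists A].
have mA : measurable (\bigcap_k A k).
  by apply: bigcapT_measurable => k; case: (HA k).
exists (\bigcap_k A k); split => //; last by move=> x Nx k _; case: (HA k) => _ NA _; exact: NA.
apply/eqP; rewrite eq_le measure_ge0 andbT; apply/lee_addgt0Pr => e e0; rewrite add0e.
pose k := Num.truncn (e^-1).
have [mk _ Pk] := HA k.
apply: (@le_trans _ _ (P (A k))).
  by apply: le_measure; rewrite ?inE // => x Ax; exact: (Ax k I).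
apply: (le_trans Pk); rewrite lee_fin invf_ple ?posrE //.
exact/ltW/truncnS_gt.
Qed.

Section Increments.
Context (n : nat) (s : nat -> R).
Hypothesis s_0 : 0 <= s 0%N.
Hypothesis s_lt : forall i, (i < n)%N -> s i < s i.+1.

Let X (i : 'I_n) om := W (s i.+1) om - W (s i) om.

Let mX i : measurable_fun setT (X i). Proof. exact: measurable_funB. Qed.

Let indep : mutually_independent P X. Proof. exact: incr. Qed.

Let s_ge0 i : (i <= n)%N -> 0 <= s i.
Proof.
elim: i => [//|i IH] lt; apply: le_trans (IH (ltnW lt)) _; exact/ltW/s_lt.
Qed.

Let lawX i (D : set R) : measurable D ->
  P (X i @^-1` D) = normal_prob 0 (sigma * Num.sqrt (s i.+1 - s i)) D.
Proof. by move=> mD; have := gauss (s_ge0 (ltnW (ltn_ord i))) (s_lt (ltn_ord i)) mD. Qed.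

Lemma measurable_off_increment (j : 'I_n) i k : (i + k <= n)%N ->
  (forall l, (i <= l < i + k)%N -> l != j) ->
  @measurable_fun _ _ (g_sigma_algebraType (off_cylinders X j)) R setT
    (fun om => W (s (i + k)) om - W (s i) om).
Proof.
elim: k => [|k IH] ikn nj.
  rewrite addn0 (_ : (fun om => _) = cst 0); first exact: measurable_cst.
  by apply/funext => om; rewrite subrr.
have ik : (i + k < n)%N by rewrite addnS in ikn.
rewrite (_ : (fun om => _) =
    (fun om => (W (s (i + k)) om - W (s i) om) + X (Ordinal ik) om)); last first.
  by apply/funext => om; rewrite addnS /X /=; ring.
apply: measurable_funD.
  apply: IH; first exact: ltnW.
  by move=> l /andP[il lk]; apply: nj; rewrite il addnS ltnS ltnW.
apply: off_cylinders_measurable; rewrite -val_eqE /=.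
by apply: nj; rewrite leq_addr addnS ltnS /=.
Qed.

Lemma off_increment_small (j : 'I_n) (f : T -> R) (kappa e : R) : 0 <= e ->
  @measurable_fun _ _ (g_sigma_algebraType (off_cylinders X j)) R setT f ->
  (P [set om | (`|f om + X j om - kappa| <= e)%R] <=
   (normal_peak (sigma * Num.sqrt (s j.+1 - s j)) * (2 * e))%:E)%E.
Proof.
move=> e0 mf; have mf' := off_cylinders_sub mX mf.
pose F : {RV P >-> R} := mfun_Sub (mem_set mf').
pose xi : {RV P >-> R} := mfun_Sub (mem_set (mX j)).
apply: (@indep_gaussian_small _ _ _ _ F xi _ (sigma * Num.sqrt (s j.+1 - s j))) => //.
- move=> A D mA mD; apply: (off_cylinders_indep mX indep) => //.
  by have := mf measurableT A mA; rewrite setTI.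
- by rewrite mulr_gt0 // sqrtr_gt0 subr_gt0 s_lt.
- by move=> D mD; exact: lawX.
Qed.

Lemma avoid_interval (a p : R) :
  (forall i, (i < n)%N -> s i.+1 - s i = 1) ->
  normal_prob 0 sigma `[a, a + 1]%classic = p%:E ->
  P (\bigcap_(i in [set: 'I_n]) (X i @^-1` (~` `[a, a + 1]))) = ((1 - p) ^+ n)%:E.
Proof.
move=> s1 pE; rewrite indep; last by move=> i; apply: measurableC.
rewrite (eq_bigr (fun=> (1 - p)%:E)); last first.
  move=> i _; rewrite -[_ @^-1` _]/(~` (X i @^-1` `[a, a + 1]%classic)).
  rewrite probability_setC; last by rewrite -[_ @^-1` _]setTI; exact: mX.
  by rewrite lawX // s1 // sqrtr1 mulr1 pE.
rewrite prodEFin; congr (_%:E).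
by rewrite prodr_const card_ord.
Qed.

End Increments.

(** The unit increments after time [J] are independent and each falls in [[a, a + 1]] with the same
    probability [p > 0]; the first [n] of them all miss it with probability [(1 - p)^n]. *)
Lemma ae_increment_hits (a : R) (J : nat) :
  {ae P, forall om, exists2 j, (J <= j)%N &
     a <= W j.+1%:R om - W j%:R om <= a + 1}.
Proof.
pose p := fine (normal_prob 0 sigma `[a, a + 1]%classic).
have s1 : (sigma * Num.sqrt (1 - 0) = sigma)%R by rewrite subr0 sqrtr1 mulr1.
have lawW (D : set R) : measurable D ->
    P ((fun om => W 1 om - W 0 om) @^-1` D) = normal_prob 0 sigma D.
  by move=> mD; have := gauss (lexx 0) ltr01 mD; rewrite s1.
have mW : measurable_fun setT (fun om => W 1 om - W 0 om) by exact: measurable_funB.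
pose xi : {RV P >-> R} := mfun_Sub (mem_set mW).
have pE : normal_prob 0 sigma `[a, a + 1]%classic = p%:E.
  by rewrite /p fineK // fin_num_measure.
have p0 : 0 < p.
  have := gaussian_interval_gt0 (xi := xi) sigma_gt0 lawW a.
  by rewrite lawW // pE lte_fin.
have p1 : p <= 1 by rewrite -lee_fin -pE probability_le1.
rewrite /almost_everywhere.
apply: negligible_le => e e0.
have q0 : 0 <= 1 - p by rewrite subr_ge0.
have q1 : `|1 - p| < 1 by rewrite ger0_norm // gtrBl.
have /cvgrPdist_lt /(_ e e0) [n _ Hn] := cvg_expr q1.
have := Hn n (leqnn n); rewrite sub0r normrN ger0_norm ?exprn_ge0 // => qn.
pose s i : R := (J + i)%:R.
have ss i : s i.+1 - s i = 1 by rewrite /s addnS -natr1 addrC addKr.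
have sl i : (i < n)%N -> s i < s i.+1 by move=> _; rewrite -subr_gt0 ss.
have s0 : 0 <= s 0%N by [].
have E := @avoid_interval n s s0 sl a p (fun i _ => ss i) pE.
exists (\bigcap_(i in [set: 'I_n])
   ((fun om => W (s i.+1) om - W (s i) om) @^-1` (~` `[a, a + 1]%classic))).
  split.
    apply: fin_bigcap_measurable => // i _; rewrite -[_ @^-1` _]setTI.
    apply: (measurable_funB _ _) => //; exact: measurableC.
  move=> om /= H i _ /=; rewrite in_itv /= => h; apply: H.
  by exists (J + i)%N; [exact: leq_addr|rewrite -addnS].
by rewrite E lee_fin ltW.
Qed.

Lemma ae_oscillates t : 1 < t -> {ae P, forall om, oscillates t (fun x => W x om)}.
Proof.
move=> t1; have h0 : 0 < ln t by exact: ln_gt0.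
have H1 := ae_foralln (fun J => ae_increment_hits (ln t) J).
(* The interval [[- ln t - 1, - ln t]] provides falls of at least [ln t]. *)
have H2 := ae_foralln (fun J => ae_increment_hits (- ln t - 1) J).
apply: filterS (filterI H1 H2) => om [U D] s s0.
pose J := (Num.truncn s).+1; have sJ j : (J <= j)%N -> s <= j%:R.
  by move=> Jj; apply: le_trans (ltW (truncnS_gt s)) _; rewrite ler_nat.
split.
  have [j /sJ sj /andP[h1 _]] := U J.
  by exists j%:R, j.+1%:R; split => //; rewrite ler_nat.
have [j /sJ sj /andP[_ h2]] := D J.
by exists j%:R, j.+1%:R; split => //; [rewrite ler_nat|lra].
Qed.

(* The difference of the two extrema is the Gaussian increment [W c - W b] plus a
   variable that is independent of it. *)
Lemma extrema_gap_negligible (s1 s2 kappa a b c e : R) :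
  `|s1| = 1 -> `|s2| = 1 -> 0 <= a -> a < b -> b < c -> c < e ->
  P.-negligible [set om | path_continuous (fun x => W x om) /\
    extrema_gap (fun x => W x om) s1 s2 kappa a b c e].
Proof.
move=> n1 n2 a0 ab bc ce.
have s11 : s1 * s1 = 1 by rewrite -expr2 -real_normK ?num_real // n1 expr1n.
have s21 : s2 * s2 = 1 by rewrite -expr2 -real_normK ?num_real // n2 expr1n.
apply: negligible_le => eps eps0.
have sbc : 0 < sigma * Num.sqrt (c - b) by rewrite mulr_gt0 // sqrtr_gt0 subr_gt0.
set pk := normal_peak (sigma * Num.sqrt (c - b)).
have pk0 : 0 < pk by rewrite normal_peak_gt0 // gt_eqF.
pose eta := eps / (2 * pk).
have eta0 : 0 < eta by rewrite divr_gt0 // mulr_gt0.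
pose ga m i : R := a + (b - a) * (i%:R / m.+1%:R).
pose gc m i : R := c + (e - c) * (i%:R / m.+1%:R).
pose D m om := s2 * running_min (fun i => s2 * W (gc m i) om) m.+1
             - s1 * running_min (fun i => s1 * W (ga m i) om) m.+1.
pose F m := [set om | `|D m om - kappa| <= eta].
have mD m : measurable_fun setT (D m).
  apply: measurable_funB; apply: measurable_funM => //;
  by apply: measurable_running_min => i _; exact: measurable_funM.
have mF m : measurable (F m).
  have mf : measurable_fun setT (fun om => `|D m om - kappa|).
    by apply: measurableT_comp => //; exact: measurable_funB.
  have := mf measurableT `]-oo, eta]%classic (measurable_itv _); rewrite setTI.
  by congr (measurable _); apply/seteqP; split => z; rewrite /F /= in_itv.
have PF m : (P (F m) <= eps%:E)%E.
  (* The grids of [[a, b]] and [[c, e]], of [m + 2] points each, put end to end: increment number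
     [m.+1] is exactly [W c - W b]. *)
  pose s i : R := if (i <= m.+1)%N then ga m i else gc m (i - m.+2)%N.
  have m0 : 0 < m.+1%:R :> R by rewrite ltr0n.
  have sb : s m.+1 = b by rewrite /s leqnn /ga divff ?gt_eqF // mulr1 addrC subrK.
  have sc : s m.+2 = c by rewrite /s ltnn subnn /gc mul0r mulr0 addr0.
  have sl i : (i < (m.+1 + m.+2))%N -> s i < s i.+1.
    move=> im; have [im1|] := ltnP i m.+1.
      rewrite /s (ltnW im1) im1 /ga ltrD2l ltr_pM2l ?subr_gt0 //.
      by rewrite ltr_pM2r ?invr_gt0 // ltr_nat.
    rewrite leq_eqVlt => /orP[/eqP <-|mi]; first by rewrite sb sc.
    have -> : s i = gc m (i - m.+2)%N by rewrite /s leqNgt mi.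
    have -> : s i.+1 = gc m (i - m.+2).+1.
      by rewrite /s leqNgt ltnS (ltnW mi) /= subSn.
    rewrite /gc ltrD2l ltr_pM2l ?subr_gt0 //.
    by rewrite ltr_pM2r ?invr_gt0 // ltr_nat.
  have s0 : 0 <= s 0%N by rewrite /s /ga mul0r mulr0 addr0.
  have jlt : (m.+1 < m.+1 + m.+2)%N by rewrite addnS ltnS leq_addr.
  pose j := Ordinal jlt.
  (* The minima are measured relative to [W c] and [W b], hence [f] depends only on the other
     increments; as [s1] and [s2] have square one, adding [W c - W b] restores [D m]. *)
  pose f om := s2 * running_min (fun i => s2 * (W (s (m.+2 + i)%N) om - W (s m.+2) om)) m.+1
             - s1 * running_min (fun i => s1 * (W (s i) om - W (s m.+1) om)) m.+1.
  have := @off_increment_small _ s s0 sl j f kappa eta (ltW eta0).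
  rewrite /= sb sc -/pk.
  have -> : pk * (2 * eta) = eps by rewrite /eta; field; rewrite gt_eqF.
  have -> : [set om | `|f om + (W c om - W b om) - kappa| <= eta] = F m.
    suff fD om : f om + (W c om - W b om) = D m om.
      by apply/seteqP; split => om; rewrite /F /= fD.
    rewrite /f /D.
    rewrite (@eq_running_min _ (fun i => s2 * (W (s (m.+2 + i)%N) om - W (s m.+2) om))
      (fun i => s2 * W (gc m i) om + - (s2 * W c om))); last first.
      by move=> i _; rewrite sc /s leqNgt leq_addr /= addKn; ring.
    rewrite (@eq_running_min _ (fun i => s1 * (W (s i) om - W (s m.+1) om))
      (fun i => s1 * W (ga m i) om + - (s1 * W b om))); last first.
      by move=> i im; rewrite sb /s im; ring.
    rewrite !running_minD.
    set x := running_min _ _; set y := running_min _ _; set u := W c om; set v := W b om.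
    have -> : s2 * (x - s2 * u) - s1 * (y - s1 * v) + (u - v) =
      s2 * x - s1 * y - (s2 * s2) * u + (s1 * s1) * v + (u - v) by ring.
    by rewrite s11 s21; ring.
  apply; apply: measurable_funB; apply: measurable_funM => //;
    apply: measurable_running_min => i im; apply: measurable_funM => //.
    apply: measurable_off_increment => //; first by rewrite [leqRHS]addnC leq_add2l.
    by move=> l /andP[l1 _]; rewrite neq_ltn l1 orbT.
  rewrite (_ : (fun om => _) = (fun om => - (W (s (i + (m.+1 - i))%N) om - W (s i) om))).
    apply: measurableT_comp => //; apply: measurable_off_increment => //.
      by rewrite subnKC // leq_addr.
    by move=> l; rewrite subnKC // => /andP[_ l2]; rewrite neq_ltn l2.
  by apply/funext => om; rewrite subnKC // opprB.
(* On the event considered the grid minima converge, so [F m] holds for all large [m]: the event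
   lies in the lower limit of the [F m], of probability at most [eps] by continuity from below. *)
pose G k := \bigcap_(m in [set m | (k <= m)%N]) F m.
have mG k : measurable (G k).
  by apply: bigcap_measurable => //; exists k => /=.
have mU : measurable (\bigcup_k G k) by exact: bigcupT_measurable.
exists (\bigcup_k G k); first split => //.
  move=> om [cw [x [y [/andP[ax xb] /andP[cy ye] xmin ymin E]]]].
  have eta2 : 0 < eta / 2 by rewrite divr_gt0.
  have [|M1 H1] := running_min_cvg cw a0 ab _ xmin eta2; first by rewrite ax.
  have c0 : 0 <= c by rewrite (le_trans a0) // ltW // (lt_trans ab).
  have [|M2 H2] := running_min_cvg cw c0 ce _ ymin eta2; first by rewrite cy.
  exists (maxn M1 M2) => // m; rewrite /= geq_max => /andP[/H1 m1 /H2 m2].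
  rewrite /F /= /D.
  set r2 := running_min _ _ in m2 *; set r1 := running_min _ _ in m1 *.
  have -> : s2 * r2 - s1 * r1 - kappa = s2 * (r2 - s2 * W y om) - s1 * (r1 - s1 * W x om).
    rewrite -E !mulrBr [s2 * (s2 * _)]mulrA [s1 * (s1 * _)]mulrA s11 s21 !mul1r; ring.
  rewrite (le_trans (ler_normB _ _)) // !normrM n1 n2 !mul1r.
  by move: m1 m2; lra.
have ndG : nondecreasing_seq G.
  move=> i k ik; apply/subsetPset => om H l kl; apply: H.
  by rewrite /= (leq_trans ik).
have := nondecreasing_cvg_mu (mu := P) mG mU ndG => cvgP.
rewrite -(cvg_lim _ cvgP) //; apply: lime_le; first by apply/cvg_ex; exists (P (\bigcup_k G k)).
apply: nearW => k /=; apply: le_trans (PF k).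
by apply: le_measure; rewrite ?inE // => om H; exact: (H k (leqnn k)).
Qed.

Lemma ae_gap_free (s1 s2 kappa : R) : `|s1| = 1 -> `|s2| = 1 ->
  {ae P, forall om, path_continuous (fun x => W x om)} ->
  {ae P, forall om, gap_free (fun x => W x om) s1 s2 kappa}.
Proof.
move=> n1 n2 aec.
pose Q (k : nat) om :=
  if (unpickle k : option (rat * rat * rat * rat)) is Some (qa, qb, qc, qd) then
   0 <= ratr qa :> R -> ratr qa < ratr qb :> R -> ratr qb < ratr qc :> R ->
   ratr qc < ratr qd :> R -> ~ (path_continuous (fun x => W x om) /\
   extrema_gap (fun x => W x om) s1 s2 kappa (ratr qa) (ratr qb) (ratr qc) (ratr qd)) else True.
have HQ : {ae P, forall om, forall k, Q k om}.
  apply: ae_foralln => k; rewrite /Q; case: (unpickle k) => [[[[qa qb] qc] qd]|]; last exact: aeW.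
  have [a0|a0] := boolP (0 <= ratr qa :> R); last by apply: aeW.
  have [ab|ab] := boolP (ratr qa < ratr qb :> R); last by apply: aeW.
  have [bc|bc] := boolP (ratr qb < ratr qc :> R); last by apply: aeW.
  have [cd|cd] := boolP (ratr qc < ratr qd :> R); last by apply: aeW.
  have := extrema_gap_negligible kappa n1 n2 a0 ab bc cd.
  by apply: negligibleS => om /= H; apply: contrapT => H'; apply: H => _ _ _ _.
apply: filterS (filterI aec HQ) => om [cw HQom].
apply: rat_gap_free => qa qb qc qd a0 ab bc cd H.
have := HQom (pickle (qa, qb, qc, qd)); rewrite /Q pickleK.
by apply.
Qed.

End AlmostSure.


(** * The limit law *)

Section DensityLaw.
Context (R : realType) (n : nat).
Local Notation mu := (@lebesgue_measure R).
Local Notation f := (@f_density R n.+2).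

Lemma f_densityE x : f x = if x < 0 then 0 else hypo_pdf n.+1 x.
Proof.
by rewrite /f_density /hypo_pdf; case: ifP => // _; apply: eq_bigr => i _.
Qed.

Lemma f_density_ge0 x : 0 <= f x.
Proof. by rewrite f_densityE; case: ltP => // x0; exact: hypo_pdf_ge0. Qed.

Lemma continuous_hypo_pdf k : continuous (@hypo_pdf R k).
Proof.
move=> x; apply/differentiable_continuous/derivable1_diffP.
by case: (is_derive_hypo_pdf k x).
Qed.

Lemma continuous_hypo_cdf k : continuous (@hypo_cdf R k).
Proof.
move=> x; apply/differentiable_continuous/derivable1_diffP.
by case: (is_derive_hypo_cdf k x).
Qed.

Lemma measurable_f_density : measurable_fun setT f.
Proof.
rewrite (_ : f = fun x => if x < 0 then 0 else hypo_pdf n.+1 x); last first.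
  by apply/funext => x; rewrite f_densityE.
apply: measurable_fun_ifT => //; first exact: measurable_fun_ltr.
by apply: continuous_measurable_fun; exact: continuous_hypo_pdf.
Qed.

Lemma integral_f_density a :
  (\int[mu]_(x in `]-oo, a[) (f x)%:E = (pcdf n.+1 a)%:E)%E.
Proof.
have mf : measurable_fun setT (EFin \o f) by apply/measurable_EFinP; exact: measurable_f_density.
have f0 x : (0 <= (f x)%:E)%E by rewrite lee_fin f_density_ge0.
have neg b : b <= 0 -> (\int[mu]_(x in `]-oo, b[) (f x)%:E = 0)%E.
  move=> b0; apply: integral0_eq => x; rewrite /= in_itv /= => xb.
  by rewrite f_densityE (lt_le_trans xb).
have [a0|a0] := leP a 0; first by rewrite neg // /pcdf max_l // hypo_cdf0.
rewrite (@itv_bndbnd_setU _ _ _ (BLeft 0)) // ?bnd_simp ?ltW //.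
rewrite ge0_integral_setU //; last 2 first.
- exact: measurable_funTS.
- apply/disj_setPS => x [] /=; rewrite !in_itv /= => x0 /andP[].
  by rewrite leNgt x0.
rewrite neg // add0e integral_itv_bndo_bndc; last exact: measurable_funTS.
transitivity (\int[mu]_(x in `[0%R, a]) (hypo_pdf n.+1 x)%:E)%E.
  apply: eq_integral => x; rewrite inE /= in_itv /= => /andP[x0 _].
  by rewrite f_densityE ltNge x0.
rewrite (@continuous_FTC2 _ _ (hypo_cdf n.+1) 0 a a0).
- by rewrite hypo_cdf0 sube0 /pcdf max_r // ltW.
- by apply: continuous_subspaceT; exact: continuous_hypo_pdf.
- split.
  + by move=> x _; case: (is_derive_hypo_cdf n.+1 x).
  + by apply: cvg_at_right_filter; exact: continuous_hypo_cdf.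
  + by apply: cvg_at_left_filter; exact: continuous_hypo_cdf.
- by move=> x _; rewrite derive1E; case: (is_derive_hypo_cdf n.+1 x).
Qed.

Definition density_law (V : set R) : \bar R := (\int[mu]_(x in V) (f x)%:E)%E.

Let density_law0 : density_law set0 = 0%E.
Proof. exact: integral_set0. Qed.

Let density_law_ge0 A : (0 <= density_law A)%E.
Proof. by apply: integral_ge0 => x _; rewrite lee_fin f_density_ge0. Qed.

Let density_law_sigma_additive : semi_sigma_additive density_law.
Proof.
move=> A mA tA mUA; rewrite /density_law ge0_integral_bigcup //.
- by apply: is_cvg_ereal_nneg_natsum_cond => k _ _; exact: density_law_ge0.
- by apply: measurable_funTS; apply/measurable_EFinP; exact: measurable_f_density.
- by move=> x _; rewrite lee_fin f_density_ge0.
Qed.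

HB.instance Definition _ := isMeasure.Build _ _ _
  density_law density_law0 density_law_ge0 density_law_sigma_additive.

Lemma law_of_cdf (m : {measure set R -> \bar R}) :
  (forall a, m `]-oo, a[%classic = (pcdf n.+1 a)%:E) ->
  forall B, measurable B -> m B = density_law B.
Proof.
move=> mE B mB.
have mB1 : (@ocitv R).-sigma.-measurable B := mB.
have mB' : <<s @RGenInftyO.G R >> B by move: mB1; rewrite RGenInftyO.measurableE.
apply: (@g_sigma_algebra_measure_unique _ _ _ (@RGenInftyO.G R) _
  (fun k => `]-oo, k%:R[%classic)) => //.
- by move=> _ [x ->]; exact: measurable_itv.
- by move=> k; exists k%:R.
- apply/seteqP; split => // x _; exists (Num.truncn x).+1 => //=.
  by rewrite in_itv /= truncnS_gt.
- move=> _ _ [x ->] [y ->]; exists (Num.min x y).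
  by apply/seteqP; split => z /=; rewrite !in_itv /= lt_min => /andP.
- by move=> _ [x ->]; rewrite mE; exact/esym/integral_f_density.
- by move=> k; rewrite mE ltry.
Qed.

End DensityLaw.


(** [N 2^-N] is the order of the sum of the fourth moments: [N 2^N] increments, each contributing
    [2^(-2N)]. *)
Lemma mul_mesh_cvg (R : realType) (e : R) : 0 < e ->
  exists N0, forall N, (N0 <= N)%N -> N%:R * 2^-1 ^+ N <= e.
Proof.
move=> e0; exists (Num.truncn (2 / e)).+1 => N N0.
have sq k : (k ^ 2 <= 2 ^ k.+1)%N.
  elim: k => [//|[//|[//|[//|k]]] IH].
  rewrite expnS; apply: leq_trans (leq_mul (leqnn 2) IH).
  by rewrite -!mulnn; nia.
have N1 : 2 / e <= N%:R.
  by apply: le_trans (ltW (truncnS_gt _)) _; rewrite ler_nat.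
have N2 : 0 < N%:R :> R by apply: lt_le_trans N1; rewrite divr_gt0.
have p0 : 0 < 2 ^+ N :> R by rewrite exprn_gt0.
rewrite exprVn ler_pdivrMr // -(ler_pM2l N2).
apply: (@le_trans _ _ (2 * 2 ^+ N)).
  by rewrite -expr2 -exprS -!natrX ler_nat sq.
rewrite mulrA ler_wpM2r ?(ltW p0) //.
by rewrite ler_pdivrMr // in N1.
Qed.

(** * The excess as a random variable, and its expectations *)

Section Limit.
Context d (T : measurableType d) (R : realType) (P : probability T R).
Context (W : R -> {RV P >-> R}) (sigma : R) (n : nat).
Hypothesis sigma_gt0 : 0 < sigma.
Hypothesis hW : brownian_motion sigma W.

Let incr : independent_increments W. Proof. by case: hW. Qed.
Let gauss : gaussian_increments sigma W. Proof. by case: hW. Qed.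

Local Notation steps N := (N * 2 ^ N)%N.
Local Notation mesh N := (2^-1 ^+ N : R).

Let mwalk u k : measurable_fun setT (fun om => walk W u om k).
Proof. exact: measurable_funB. Qed.

(** An upper limit is measurable and defined at every sample point; almost surely it is a true
    limit, equal to the excess of the path. *)
Definition excess (t : R) (om : T) : R :=
  fine (limn_esup (fun N => ((run (ln t) n (walk W (mesh N) om) (steps N)).2)%:E)).

Lemma measurable_excess t : measurable_fun setT (excess t).
Proof.
apply: (measurableT_comp (fine_measurable measurableT)).
apply: measurable_fun_limn_esup => N; apply/measurable_EFinP.
by have [_ _ m3] := @measurable_run R _ T (ln t) n _ (steps N)
  (fun i _ => mwalk (mesh N) i).
Qed.

Lemma ae_excess t : 1 < t -> {ae P, forall om,
  is_zeta n.+1 t (fun x => W x om) (excess t om + (n.+1 * (n.+1 - 1))%:R / 2) /\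
  forall e, 0 < e -> exists N0, forall N, (N0 <= N)%N ->
    (run (ln t) n (walk W (mesh N) om) (steps N)).1.1 = 0%N /\
    `|(run (ln t) n (walk W (mesh N) om) (steps N)).2 - excess t om| <= e}.
Proof.
move=> t1; have [W0 _ _ cW] := hW.
have n1 : `|1| = 1 :> R by rewrite normr1.
have nN1 : `|-1| = 1 :> R by rewrite normrN1.
have osc := ae_oscillates sigma_gt0 incr gauss t1.
have g0 := ae_gap_free sigma_gt0 incr gauss 0 n1 n1 cW.
have g1 := ae_gap_free sigma_gt0 incr gauss (ln t) n1 nN1 cW.
have g2 := ae_gap_free sigma_gt0 incr gauss (- ln t) nN1 n1 cW.
apply: filterS (filterI W0 (filterI cW (filterI osc (filterI g0 (filterI g1 g2))))).
move=> om [w0 [cw [oscw [g0w [g1w g2w]]]]].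
have [z zeta_z zc] := path_zeta t1 n cw oscw g0w g1w g2w.
have wE N : walk W (mesh N) om = sampling (fun x => W x om) N.
  by apply/funext => k; rewrite /walk w0 subr0.
have zE : excess t om = z.
  rewrite /excess.
  have cv : (fun N => (run (ln t) n (walk W (mesh N) om) (steps N)).2) @ \oo --> z.
    apply/cvgrPdist_le => e e0; have [N0 H] := zc e e0; exists N0 => //= N N0N.
    by rewrite distrC wE; have [] := H N N0N.
  have cvE : (fun N => ((run (ln t) n (walk W (mesh N) om) (steps N)).2)%:E) @ \oo --> z%:E.
    by apply: cvg_EFin; [exact: nearW|exact: cv].
  have [_ ->] := cvg_limn_einf_sup cvE.
  by [].
rewrite zE; split => // e e0; have [N0 H] := zc e e0; exists N0 => N N0N.
by rewrite wE; exact: H.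
Qed.

(** Once the automaton is in its final state, the value is [(a - z)_+], a function of [z] with
    Lipschitz constant 1. *)
Lemma ae_excess_value t a : 1 < t -> {ae P, forall om, setT om ->
  (fun N => (value (ln t) a (run (ln t) n (walk W (mesh N) om) (steps N))
     (walk W (mesh N) om (steps N)))%:E) @ \oo --> (picdf 0 (a - excess t om))%:E}.
Proof.
move=> t1; apply: filterS (ae_excess t1) => om [_ cv] _.
apply: cvg_EFin; first exact: nearW.
apply/cvgrPdist_le => e e0; have [N0 H] := cv e e0; exists N0 => //= N N0N.
have [p0 zz] := H N N0N.
rewrite /value p0 /= addr0; set z := (run _ _ _ _).2 in zz *.
set Z := excess t om in zz *; rewrite /picdf.
apply: le_trans zz; rewrite ler_norml.
have := ler_norm (z - Z); have := ler_norm (Z - z); rewrite -[`|Z - z|]distrC => h1 h2.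
by case: (leP 0 (a - Z)) => ?; case: (leP 0 (a - z)) => ?; apply/andP; split; lra.
Qed.

Lemma expected_excess t a : 1 < t ->
  (\int[P]_om (picdf 0 (a - excess t om))%:E = (picdf n a)%:E)%E.
Proof.
move=> t1; have h0 : 0 < ln t by exact: ln_gt0.
pose C : R := \sum_(r < n) pcdf r.+1 a.
pose B : R := \sum_(r < n.+1) picdf r a.
have hC r y : (r < n)%N -> y <= a -> pcdf r.+1 y <= C.
  move=> rn ya; apply: (le_trans (pcdf_ndecr r ya)).
  by rewrite /C (bigD1 (Ordinal rn)) //= lerDl sumr_ge0 // => i _; exact: pcdf_ge0.
have hB r y : (r <= n)%N -> y <= a -> picdf r y <= B.
  move=> rn ya; apply: (le_trans (picdf_ndecr r ya)).
  rewrite /B (bigD1 (Ordinal (rn : (r < n.+1)%N))) //= lerDl sumr_ge0 // => i _.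
  exact: picdf_ge0.
have C0 : 0 <= C by apply: sumr_ge0 => i _; exact: pcdf_ge0.
pose Y N om := value (ln t) a (run (ln t) n (walk W (mesh N) om) (steps N))
     (walk W (mesh N) om (steps N)).
have mY N : measurable_fun setT (EFin \o Y N).
  by apply/measurable_EFinP; apply: measurable_value_run => i _; exact: mwalk.
have Yb N om : `|Y N om| <= B + n%:R * C.
  have /andP[h1 h2] := value_bound h0 hC hB (valid_run h0 n (walk W (mesh N) om) (steps N)) C0.
  by rewrite ger0_norm.
have mZ : measurable_fun setT (fun om => (picdf 0 (a - excess t om))%:E).
  have mB : measurable_fun setT (fun om => a - excess t om).
    by apply: measurable_funB => //; exact: measurable_excess.
  by apply/measurable_EFinP; exact: (measurableT_comp (@measurable_picdf R 0) mB).
have [_ _ cvY] := @dominated_convergence _ T R P setT measurableT (fun N => EFin \o Y N)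
  (fun om => (picdf 0 (a - excess t om))%:E) (cst (B + n%:R * C)%:E) mY mZ
  (ae_excess_value a t1) (finite_measure_integrable_cst P _ measurableT)
  (aeW _ (fun om N _ => Yb N om)).
have err e : 0 < e -> exists N0, forall N, (N0 <= N)%N ->
    (`| \int[P]_om (Y N om)%:E - (picdf n a)%:E | <= e%:E)%E.
  move=> e0.
  pose K := n%:R / ln t * (2 * C * n.*2%:R).
  have K0 : 0 <= K by rewrite /K mulr_ge0 ?divr_ge0 ?mulr_ge0 // ltW.
  (* The error bound is [K (eps + A N 2^-N)]. With [N] so large that the second term is at most
     [eps], it is at most [2 K eps <= e]. *)
  pose eps := e / (2 * (K + 1)).
  have K1 : 0 < K + 1 by rewrite ltr_wpDl.
  have eps0 : 0 < eps by rewrite divr_gt0 // mulr_gt0.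
  have e3 : 0 < eps ^+ 3 by rewrite exprn_gt0.
  pose A := 64 * Num.sqrt 2 * sigma ^+ 4 / eps ^+ 3.
  have A0 : 0 <= A.
    by rewrite /A divr_ge0 ?(ltW e3) // mulr_ge0 ?exprn_even_ge0 // mulr_ge0 // sqrtr_ge0.
  have q0 : 0 < eps / (A + 1) by rewrite divr_gt0 // ltr_wpDl.
  have [N0 HN] := mul_mesh_cvg q0; exists N0 => N N0N.
  have u0 : 0 < mesh N by rewrite exprn_gt0 // invr_gt0.
  have := expected_value_error sigma_gt0 h0 incr gauss (steps N) hC hB C0 u0 eps0.
  move=> /le_trans; apply; rewrite lee_fin -/K.
  have -> : (steps N)%:R * (64 * Num.sqrt 2 * (sigma * Num.sqrt (mesh N)) ^+ 4) / eps ^+ 3 =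
      A * (N%:R * mesh N).
    rewrite exprMn [Num.sqrt _ ^+ 4](exprM _ 2 2) sqr_sqrtr ?(ltW u0) // natrM natrX.
    have -> : (mesh N) ^+ 2 = mesh N / 2 ^+ N by rewrite expr2 [X in _ * X]exprVn.
    have p2 : 2 ^+ N != 0 :> R by rewrite expf_neq0.
    by rewrite /A; move: (mesh N) (2 ^+ N : R) p2 => x y y0; field; rewrite y0 gt_eqF.
  have : A * (N%:R * mesh N) <= eps.
    apply: (@le_trans _ _ (A * (eps / (A + 1)))); first by rewrite ler_wpM2l // HN.
    by rewrite mulrA ler_pdivrMr ?ltr_wpDl // mulrDr mulr1 mulrC lerDl ltW.
  move=> Ae; apply: (@le_trans _ _ (K * (eps + eps))).
    by rewrite ler_wpM2l // lerD2l.
  have -> : e = (K + 1) * (eps + eps).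
    by rewrite /eps; field; rewrite gt_eqF.
  by rewrite ler_wpM2r ?addr_ge0 ?(ltW eps0) // lerDl.
have fin N : (\int[P]_om (Y N om)%:E \is a fin_num)%E.
  rewrite -[X in X \is a fin_num]/(\int[P]_om ((EFin \o Y N) om))%E.
  apply: integrable_fin_num => //; apply/integrableP; split => //.
  apply: (@le_lt_trans _ _ (\int[P]_om (B + n%:R * C)%:E)%E).
    apply: ge0_le_integral => //.
    - by apply: measurableT_comp.
    - by move=> om _; rewrite /= lee_fin Yb.
  by rewrite integral_cst //= probability_setT mule1 ltry.
have cvG : (fun N => \int[P]_om (Y N om)%:E)%E @ \oo --> (picdf n a)%:E.
  apply: cvg_EFin; first exact: nearW.
  apply/cvgrPdist_le => e e0; have [N0 H] := err e e0; exists N0 => //= N N0N.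
  have := H N N0N; rewrite -(fineK (fin N)) -EFinB abse_EFin lee_fin distrC.
  by rewrite fineK.
exact: cvg_unique cvY cvG.
Qed.

End Limit.


(* [E (a - Z)_+] is convex in [a] and its difference quotients bracket [P (Z < a)]. *)
Lemma cdf_of_picdf d (T : measurableType d) (R : realType) (P : probability T R)
    (Z : T -> R) (n : nat) :
  measurable_fun setT Z ->
  (forall a, \int[P]_om (picdf 0 (a - Z om))%:E = (picdf n.+1 a)%:E)%E ->
  forall a, P (Z @^-1` `]-oo, a[) = (pcdf n.+1 a)%:E.
Proof.
move=> mZ EZ a; set A := Z @^-1` _.
have mA : measurable A by rewrite /A -[_ @^-1` _]setTI; exact: mZ.
have PA : P A = (fine (P A))%:E by rewrite fineK // fin_num_measure.
set p := fine (P A) in PA.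
have mpi b : measurable_fun setT (fun om => (picdf 0 (b - Z om))%:E).
  have mB : measurable_fun setT (fun om => b - Z om) by exact: measurable_funB.
  by apply/measurable_EFinP; exact: (measurableT_comp (@measurable_picdf R 0) mB).
have pi0 b om : (0 <= (picdf 0 (b - Z om))%:E)%E by rewrite lee_fin picdf_ge0.
have inA om : (\1_A om : R) = if Z om < a then 1 else 0.
  rewrite indicE /A; case: ifPn => h; first by rewrite mem_set //= in_itv.
  by rewrite memNset //= in_itv /=; exact/negP.
have IA e : 0 <= e -> (\int[P]_om (e * \1_A om)%:E = (e * p)%:E)%E.
  move=> e0; under eq_integral do rewrite EFinM.
  rewrite ge0_integralZl //; first by rewrite integral_indic // setIT [X in (_ * X)%E]PA EFinM.
  by apply/measurable_EFinP; exact: measurable_indic.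
have mI e : measurable_fun setT (fun om => (e * \1_A om)%:E).
  by apply/measurable_EFinP; apply: measurable_funM => //; exact: measurable_indic.
have sum b e : 0 <= e -> (\int[P]_om ((picdf 0 (b - Z om))%:E + (e * \1_A om)%:E) =
    (picdf n.+1 b + e * p)%:E)%E.
  move=> e0; rewrite ge0_integralD //; first by rewrite EZ IA.
  by move=> om _; rewrite lee_fin mulr_ge0.
(* Expectation of [e 1_(Z < a) <= (a + e - Z)_+ - (a - Z)_+]; the next bound uses
   [(a - Z)_+ - (a - e - Z)_+ <= e 1_(Z < a)]. Continuity of [pcdf] then closes the gap. *)
have up e : 0 < e -> p <= pcdf n.+1 (a + e).
  move=> e0; rewrite -(ler_pM2l e0).
  have : picdf n.+1 a + e * p <= picdf n.+1 (a + e).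
    rewrite -lee_fin -sum ?(ltW e0) // -EZ; apply: ge0_le_integral => //.
    - by move=> om _; rewrite adde_ge0 // lee_fin mulr_ge0 // ltW.
    - exact: emeasurable_funD.
    - move=> om _; rewrite -EFinD lee_fin inA /picdf.
      case: (ltP (Z om) a); case: (leP 0 (a - Z om)); case: (leP 0 (a + e - Z om)); lra.
  have ae : a <= a + e by rewrite lerDl ltW.
  by have /andP[_] := picdf_bounds n ae; rewrite addrAC subrr add0r [_ * e]mulrC; lra.
have lo e : 0 < e -> pcdf n.+1 (a - e) <= p.
  move=> e0; rewrite -(ler_pM2l e0).
  have : picdf n.+1 a <= picdf n.+1 (a - e) + e * p.
    rewrite -lee_fin -sum ?(ltW e0) // -EZ; apply: ge0_le_integral => //.
    - exact: emeasurable_funD.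
    - move=> om _; rewrite -EFinD lee_fin inA /picdf.
      case: (ltP (Z om) a); case: (leP 0 (a - Z om)); case: (leP 0 (a - e - Z om)); lra.
  have ae : a - e <= a by rewrite gerBl ltW.
  have /andP[h _] := picdf_bounds n ae; move: h.
  by rewrite opprB addrCA subrr addr0 [_ * e]mulrC; lra.
rewrite PA; congr (_%:E); apply/eqP; rewrite eq_le.
have cF : continuous (@pcdf R n.+1).
  move=> x; have cM : {for x, continuous (fun y : R => Num.max 0 y)}.
    by apply: continuous_max; [exact: cvg_cst|exact: cvg_id].
  exact: (@continuous_comp R R R (fun y => Num.max 0 y) (@hypo_cdf R n.+1) x cM
    (@continuous_hypo_cdf R n.+1 _)).
have ce e : 0 < e -> exists2 q, 0 < q & forall y, `|a - y| < q -> `|pcdf n.+1 a - pcdf n.+1 y| < e.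
  move=> e0; have /cvgrPdist_lt /(_ e e0) := cF a.
  by move=> [q q0 H]; exists q => // y yq; apply: H.
apply/andP; split; apply/ler_addgt0Pr => e e0; have [q q0 H] := ce e e0.
  have q20 : 0 < q / 2 by rewrite divr_gt0.
  have := H (a + q / 2); rewrite opprD addNKr normrN gtr0_norm // => /(_ _)/ltr_normlP[|h _].
    by lra.
  by have := up _ q20; lra.
have q20 : 0 < q / 2 by rewrite divr_gt0.
have := H (a - q / 2); rewrite opprB addrC subrK gtr0_norm // => /(_ _)/ltr_normlP[|_ h].
  by lra.
by have := lo _ q20; lra.
Qed.

Theorem theorem1p2 (d : measure_display) (T : measurableType d) (R : realType)
    (P : probability T R) (gamma : nat) (sigma : R) (W : R -> {RV P >-> R})
    (hgamma : (2 <= gamma)%N) (hsigma : 0 < sigma)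
    (hW : brownian_motion sigma W) :
  exists zeta : R -> {RV P >-> R},
    [/\ forall t : R, 1 < t ->
          {ae P, forall om, is_zeta gamma t (fun x => W x om) (zeta t om)},
        forall t t' : R, 1 < t -> 1 < t' -> forall B : set R, measurable B ->
          distribution P (zeta t) B = distribution P (zeta t') B &
        forall t : R, 1 < t ->
          has_density P
            (fun om => zeta t om - (gamma * (gamma - 1))%:R / 2)
            (f_density gamma)].
Proof.
case: gamma hgamma => [//|[//|n]] _.
set c : R := (n.+2 * (n.+2 - 1))%:R / 2.
pose Z := excess W n.+1.
have mZ t : measurable_fun setT (Z t) by exact: measurable_excess.
have mzeta t : measurable_fun setT (fun om => Z t om + c) by exact: measurable_funD.
exists (fun t => mfun_Sub (mem_set (mzeta t))).
(* The law of the excess is given by an expression that does not contain [t]; both remaining claims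
   follow from it by translation by [c]. *)
have law t (B : set R) : 1 < t -> measurable B -> P (Z t @^-1` B) = density_law n B.
  move=> t1 mB; pose ZRV : {RV P >-> R} := mfun_Sub (mem_set (mZ t)).
  apply: (@law_of_cdf R n (distribution P ZRV)) => // a.
  apply: (cdf_of_picdf (mZ t)) => b.
  exact: (expected_excess n.+1 hsigma hW b t1).
split.
- move=> t t1; apply: filterS (ae_excess n.+1 hsigma hW t1) => om [H _].
  exact: H.
- move=> t t' t1 t'1 B mB.
  have mS : measurable ((fun x : R => x + c) @^-1` B).
    by rewrite -[_ @^-1` _]setTI; apply: (measurable_funD _ _).
  have E s : distribution P (mfun_Sub (mem_set (mzeta s))) B =
     P (Z s @^-1` ((fun x : R => x + c) @^-1` B)) by [].
  by rewrite !E !law.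
- move=> t t1; split.
  + exact: measurable_f_density.
  + exact: f_density_ge0.
  + move=> B mB.
    have -> : (fun om => mfun_Sub (mem_set (mzeta t)) om - c) = Z t.
      by apply/funext => om /=; rewrite addrK.
    exact: law.
Qed.
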